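(* Let $0<\alpha<1$. Let $s=\lfloor p(t)N(t)\rfloor\to\infty$ for a function $p(t)$ with $p(t)\to0$ and $tp(t)\to\infty$ as $t\to\infty$. Then, as $t\to\infty$, $$\left(\frac{\Lambda_s(t)}{U(t)},\frac{X^*_{N(t)-s}}{U(p^{-1}(t))},\frac{\Sigma_s(t)}{t\,p(t)\,U(p^{-1}(t))}\right)\overset{D}{\to}(\Lambda,\Xi,\Sigma),$$ where the limit has the joint Laplace transform $$E\left\{\exp(-u\Lambda-v\Xi-w\Sigma)\right\}=e^{-v}\,q_0\left(\int_0^\infty\frac{1-e^{-u\eta}}{\eta^{1+1/\gamma}}d\eta+\frac{w}{\gamma-1}\right).$$ If $\Theta=1$ a.s., $$E\left\{\exp(-u\Lambda-v\Xi-w\Sigma)\right\}=\exp\left(-\int_0^\infty\frac{1-e^{-u\eta}}{\eta^{1+1/\gamma}}d\eta-v-\frac{w}{\gamma-1}\right).$$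
   Context: Let $X_1,X_2,\ldots$ be independent positive random variables (claims) with common distribution function $F$ satisfying $1-F(x)=x^{-\alpha}\ell(x)$, $x>0$, with $\alpha>0$ and $\ell$ slowly varying at infinity. Put $\gamma=1/\alpha$ and $U(y)=F^{\leftarrow}(1-1/y)$, where $F^{\leftarrow}$ is the generalized inverse of $F$. Here $p^{-1}(t)=1/p(t)$. Let $N(t)$ be the number of claims up to time $t$, where $(N(t))_{t\ge0}$ is independent of $(X_i)_{i\ge1}$ and is near mixed Poisson: $N(t)/t\overset{D}{\to}\Theta$ as $t\to\infty$ for some random variable $\Theta$. Let $q_0(w)=E\{e^{-w\Theta}\}$. For given $N(t)=n$, $X_1^*\le\cdots\le X_n^*$ are the order statistics of $X_1,\ldots,X_n$, and $X_r^*=0$ for $r\le 0$. Set $$\Sigma_s(t)=\sum_{j=1}^{N(t)-s-1}X_j^*,\qquad \Lambda_s(t)=\sum_{j=N(t)-s+1}^{N(t)}X_j^*,$$ where empty sums are $0$; here $s$ depends on $t$ and on $N(t)$. $\overset{D}{\to}$ is convergence in distribution.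
   Formalization: In both Laplace transforms the integral of (1-e^{-uη})/η^{1+1/γ} is multiplied by 1/γ; the printed formulas lack this factor and fail e.g. for Pareto claims with N(t)=⌊t⌋, Θ=1, p(t)=t^{-1/2}. *)

(* Defs.v *)
From HB Require Import structures.
From mathcomp Require Export all_boot all_order all_algebra.
From mathcomp Require Export all_classical all_reals all_analysis.
Export Order.TTheory GRing.Theory Num.Theory.
Export numFieldNormedType.Exports.

Set Implicit Arguments.
Unset Strict Implicit.
Unset Printing Implicit Defensive.

Local Open Scope classical_set_scope.
Local Open Scope ring_scope.

Section RegularVariation.
Context {R : realType}.

Definition slowly_varying (l : R -> R) : Prop :=
  [/\ measurable_fun (`]0, +oo[%classic : set R) l,
      \forall x \near +oo, 0 < l x &
      forall a : R, 0 < a -> l (a * x) / l x @[x --> +oo] --> (1 : R)].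

Definition gen_inverse (F : R -> R) (q : R) : R := inf [set x | q <= F x].

Definition tail_quantile (F : R -> R) (y : R) : R := gen_inverse F (1 - y^-1).

End RegularVariation.

Section Probability.
Context {R : realType} {d : measure_display} {T : measurableType d}.
Variable P : probability T R.

Definition mutually_independent (X : nat -> {RV P >-> R}) : Prop :=
  forall (J : seq nat) (B : nat -> set R), uniq J ->
    (forall i, measurable (B i)) ->
    P (\bigcap_(i in [set` J]) (X i @^-1` B i)) =
    (\prod_(i <- J) P (X i @^-1` B i))%E.

Definition sigma_of_family {I : Type} {d' : measure_display}
    {T' : measurableType d'} (D : set I) (Y : I -> T -> T') : set_system T :=
  <<s \bigcup_(i in D) preimage_set_system setT (Y i) measurable >>.

Definition independent_systems (G H : set_system T) : Prop :=
  forall A B, G A -> H B -> P (A `&` B) = (P A * P B)%E.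

(* The limit variable W may live on another probability space. *)
Definition cvg_in_distribution {d' : measure_display} {T' : measurableType d'}
    (Q : probability T' R) {E : topologicalType}
    (V : R -> T -> E) (W : T' -> E) : Prop :=
  forall f : E -> R, continuous f -> (exists M : R, forall x, `|f x| <= M) ->
    'E_P[f \o V t]%E @[t --> +oo] --> 'E_Q[f \o W]%E.

Definition diverges_in_probability (Z : R -> T -> nat) : Prop :=
  forall M : nat, P [set x | (M <= Z t x)%N] @[t --> +oo] --> 1%E.

Definition laplace (Y : T -> R) (w : R) : \bar R :=
  'E_P[fun x => expR (- (w * Y x))]%E.

Definition laplace3 (Y1 Y2 Y3 : T -> R) (u v w : R) : \bar R :=
  'E_P[fun x => expR (- (u * Y1 x) - v * Y2 x - w * Y3 x)]%E.

End Probability.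

Section Claims.
Context {R : realType} {T : Type}.
(* The claims X_1, X_2, ... are X 0, X 1, ... *)
Variables (X : nat -> T -> R) (N : R -> T -> nat) (p : R -> R).

(* The r-th smallest of the first n claims for 1 <= r <= n, and 0 for r = 0.
   Ranks are natural numbers, so a rank N(t) - s with s > N(t) truncates to 0,
   where the order statistic is 0 as it is for negative ranks. *)
Definition order_stat (n r : nat) (x : T) : R :=
  nth 0 (0 :: sort <=%R [seq X i x | i <- iota 0 n]) r.

(* Num.truncn is the floor on nonnegative reals (and 0 on negative ones, which
   do not occur for large t when t * p t tends to +oo). *)
Definition trim (t : R) (x : T) : nat := Num.truncn (p t * (N t x)%:R).

Definition mid_claim (t : R) (x : T) : R :=
  order_stat (N t x) (N t x - trim t x) x.

Definition small_claims (t : R) (x : T) : R :=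
  \sum_(1 <= j < N t x - trim t x) order_stat (N t x) j x.

Definition large_claims (t : R) (x : T) : R :=
  \sum_((N t x - trim t x).+1 <= j < (N t x).+1) order_stat (N t x) j x.

End Claims.

(* Laplace exponent of the alpha-stable law, gamma = 1/alpha, whose Levy measure
   has tail eta ^ (- 1/gamma). The density of that measure carries the constant
   1/gamma, without which the limit law of the large claims is off by a scale
   factor: for Theta = 1 and 1 - F(x) = x ^ (- alpha) the normalized sum has
   Laplace exponent Gamma(1 - alpha) * u ^ alpha, which is this one. *)
Definition stable_exponent {R : realType} (gamma u : R) : R :=
  gamma^-1 * \int[lebesgue_measure]_(eta in `]0, +oo[)
               ((1 - expR (- (u * eta))) / eta `^ (1 + gamma^-1)).

(* Main.v *)
Require Import Defs.
From mathcomp Require Import measurable_realfun zify ring lra.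

(* Given [N t], the claims are independent, so counts of exceedances and sums of
   truncated claims at the levels [(1 +- e) * U (1 / p t)] concentrate by
   Chernoff's bound with an error exponential in [p t * N t]. On the resulting
   good event the intermediate claim is close to [b = U (1 / p t)] and the small
   claims add up to about [N t * p t * b / (gamma - 1)]; since
   [t * p t * b = o(U t)], the large claims may be replaced by the sum of all
   claims. The Laplace transform of the resulting triple is an expectation of
   [phi (u / U t) ^ N t] times an exponential of [N t / t], where [phi] is the
   Laplace transform of a claim, and [t * (1 - phi (u / U t))] tends to
   [stable_exponent gamma u] by Potter's bound and dominated convergence.
   The limit variables live on the product of the space of [Theta] with [0, 1],
   which carries the stable variable as a limit of quantile functions. *)

Set Implicit Arguments.
Unset Strict Implicit.
Unset Printing Implicit Defensive.

Local Open Scope classical_set_scope.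
Local Open Scope ring_scope.

(** * Expectations of bounded random variables *)

Section BoundedExpectation.
Context {R : realType} {d : measure_display} {T : measurableType d}.
Variable P : probability T R.
Implicit Types f g : T -> R.

(** The obstacle is that the small claims are cut off at a level $Y$ which is itself an order
    statistic, so they are no sum of independent terms. The sum of $\min(X_i, Y)$ equals the small
    claims plus $(s+1)Y$ and is monotone in $Y$; once $Y$ is bracketed by the deterministic levels
    $(1 \pm e)b$, only sums of independent terms remain. Since $E\min(X,b) \approx
    b\,p(t)/(1-\alpha)$, removing $sY \approx N(t)p(t)b$ leaves the factor $1/(1-\alpha) - 1 =
    1/(\gamma-1)$. Laplace transforms are compared at natural arguments only: their combinations are
    the polynomials in $e^{-x}, e^{-y}, e^{-z}$, and Bernstein polynomials in these variables
    approximate a bounded continuous function away from infinity. The limit is $(\Theta^{1/\alpha}S,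
    1, \Theta/(\gamma-1))$ with $S$ one-sided stable and independent of $\Theta$: after
    normalization the intermediate claim is deterministic, and the small claims retain only the
    randomness of $N(t)/t$. *)

Definition bounded_rv f : Prop :=
  measurable_fun [set: T] f /\ exists M, forall x, `|f x| <= M.

(** A real-valued expectation, which for bounded variables agrees with ['E_P] ([expectation_Ex]). It
    keeps extended reals and integrability conditions out of the estimates. *)
Definition Ex f : R := \int[P]_x f x.

Lemma bounded_rv_integrable f : bounded_rv f -> P.-integrable setT (EFin \o f).
Proof.
move=> [mf [M fM]]; apply: measurable_bounded_integrable => //.
  exact: le_lt_trans (probability_le1 P measurableT) (ltry 1).
exists M; split; first exact: num_real.
by move=> y My x _ /=; exact: le_trans (fM x) (ltW My).
Qed.

Lemma expectation_Ex f : bounded_rv f -> 'E_P[f]%E = (Ex f)%:E.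
Proof.
move=> bf; rewrite unlock /Ex /Rintegral fineK//.
exact/integrable_fin_num/bounded_rv_integrable.
Qed.

Lemma bounded_rv_cst (r : R) : bounded_rv (fun=> r).
Proof. by split; [exact: measurable_cst|exists `|r|]. Qed.

Lemma bounded_rvD f g : bounded_rv f -> bounded_rv g ->
  bounded_rv (fun x => f x + g x).
Proof.
move=> [mf [M fM]] [mg [K gK]]; split; first exact: measurable_funD.
by exists (M + K) => x; apply: le_trans (ler_normD _ _) _; exact: lerD.
Qed.

Lemma bounded_rvM f g : bounded_rv f -> bounded_rv g ->
  bounded_rv (fun x => f x * g x).
Proof.
move=> [mf [M fM]] [mg [K gK]]; split; first exact: measurable_funM.
by exists (M * K) => x; rewrite normrM; exact: ler_pM.
Qed.

Lemma bounded_rvN f : bounded_rv f -> bounded_rv (fun x => - f x).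
Proof.
move=> [mf [M fM]]; split; first exact: measurableT_comp.
by exists M => x; rewrite normrN.
Qed.

Lemma bounded_rvB f g : bounded_rv f -> bounded_rv g ->
  bounded_rv (fun x => f x - g x).
Proof. by move=> bf bg; apply: bounded_rvD => //; exact: bounded_rvN. Qed.

Lemma bounded_rv_norm f : bounded_rv f -> bounded_rv (fun x => `|f x|).
Proof.
move=> [mf [M fM]]; split; first exact: measurableT_comp.
by exists M => x; rewrite normr_id.
Qed.

Lemma bounded_rv_unit f : measurable_fun setT f ->
  (forall x, 0 <= f x <= 1) -> bounded_rv f.
Proof.
move=> mf f01; split=> //; exists 1 => x.
by have /andP[f0 f1] := f01 x; rewrite ger0_norm.
Qed.

Lemma bounded_rv_indic (A : set T) : measurable A -> bounded_rv (\1_A : T -> R).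
Proof.
move=> mA; apply: bounded_rv_unit; first exact: measurable_indic.
by move=> x; rewrite indicE ler0n lern1 leq_b1.
Qed.

Lemma bounded_rv_prod (I : Type) (s : seq I) (g : I -> T -> R) :
  (forall i, bounded_rv (g i)) -> bounded_rv (fun x => \prod_(i <- s) g i x).
Proof.
move=> bg; elim: s => [|i s IH].
  by under eq_fun do rewrite big_nil; exact: bounded_rv_cst.
by under eq_fun do rewrite big_cons; exact: bounded_rvM.
Qed.

Lemma Ex_cst (r : R) : Ex (fun=> r) = r.
Proof.
by apply: EFin_inj; rewrite -expectation_Ex ?expectation_cst//; exact: bounded_rv_cst.
Qed.

Lemma ExD f g : bounded_rv f -> bounded_rv g ->
  Ex (fun x => f x + g x) = Ex f + Ex g.
Proof. by move=> bf bg; apply: RintegralD => //; exact: bounded_rv_integrable. Qed.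

Lemma ExB f g : bounded_rv f -> bounded_rv g ->
  Ex (fun x => f x - g x) = Ex f - Ex g.
Proof. by move=> bf bg; apply: RintegralB => //; exact: bounded_rv_integrable. Qed.

Lemma ExZ (r : R) f : bounded_rv f -> Ex (fun x => r * f x) = r * Ex f.
Proof. by move=> bf; apply: RintegralZl => //; exact: bounded_rv_integrable. Qed.

Lemma Ex_sum (I : Type) (s : seq I) (g : I -> T -> R) :
  (forall i, bounded_rv (g i)) ->
  bounded_rv (fun x => \sum_(i <- s) g i x) /\
  Ex (fun x => \sum_(i <- s) g i x) = \sum_(i <- s) Ex (g i).
Proof.
move=> bg; elim: s => [|i s [bs IH]].
  under eq_fun do rewrite big_nil.
  by split; [exact: bounded_rv_cst|rewrite big_nil; exact: Ex_cst].
have -> : (fun x => \sum_(j <- i :: s) g j x) =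
          (fun x => g i x + \sum_(j <- s) g j x).
  by apply/funext => x; rewrite big_cons.
by split; [exact: bounded_rvD|rewrite ExD// IH big_cons].
Qed.

Lemma Ex_le f g : bounded_rv f -> bounded_rv g -> (forall x, f x <= g x) ->
  Ex f <= Ex g.
Proof.
by move=> bf bg fg; apply: le_Rintegral => //; exact: bounded_rv_integrable.
Qed.

Lemma Ex_ge0 f : (forall x, 0 <= f x) -> 0 <= Ex f.
Proof. by move=> f0; apply: Rintegral_ge0. Qed.

Lemma normr_Ex f : bounded_rv f -> `|Ex f| <= Ex (fun x => `|f x|).
Proof. by move=> bf; apply: le_normr_Rintegral => //; exact: bounded_rv_integrable. Qed.

Lemma normr_ExB f g (h : T -> R) : bounded_rv f -> bounded_rv g -> bounded_rv h ->
  (forall x, `|f x - g x| <= h x) -> `|Ex f - Ex g| <= Ex h.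
Proof.
move=> bf bg bh fgh; rewrite -ExB//.
apply: le_trans (normr_Ex (bounded_rvB bf bg)) _.
by apply: Ex_le => //; exact/bounded_rv_norm/bounded_rvB.
Qed.

Lemma Ex_itv f (a b : R) : bounded_rv f -> (forall x, a <= f x <= b) ->
  a <= Ex f <= b.
Proof.
move=> bf fab; rewrite -{1}(Ex_cst a) -(Ex_cst b).
by apply/andP; split; apply: Ex_le => //; (try exact: bounded_rv_cst) => x;
  case/andP: (fab x).
Qed.

Definition Pr (A : set T) : R := fine (P A).

Lemma PrE A : measurable A -> P A = (Pr A)%:E.
Proof. by move=> mA; rewrite /Pr fineK// fin_num_measure. Qed.

Lemma Ex_indic A : measurable A -> Ex (\1_A : T -> R) = Pr A.
Proof.
by move=> mA; apply: EFin_inj; rewrite -expectation_Ex ?expectation_indic ?PrE//;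
  exact: bounded_rv_indic.
Qed.

Lemma Pr_ge0 A : 0 <= Pr A.
Proof. by rewrite /Pr fine_ge0. Qed.

Lemma Pr_le1 A : measurable A -> Pr A <= 1.
Proof. by move=> mA; rewrite -lee_fin -PrE// probability_le1. Qed.

Lemma le_Pr A B : measurable A -> measurable B -> A `<=` B -> Pr A <= Pr B.
Proof. by move=> mA mB AB; rewrite -lee_fin -!PrE// le_measure// inE. Qed.

Lemma Pr_setC A : measurable A -> Pr (~` A) = 1 - Pr A.
Proof.
move=> mA; apply: EFin_inj; rewrite -PrE; last exact: measurableC.
by rewrite probability_setC// PrE.
Qed.

Lemma Pr_setU A B : measurable A -> measurable B -> Pr (A `|` B) <= Pr A + Pr B.
Proof.
move=> mA mB; rewrite -lee_fin EFinD -!PrE//; last exact: measurableU.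
exact: measureU2.
Qed.

End BoundedExpectation.

(** * Conditioning on a variable with countably many values *)

Section CountableConditioning.
Context {R : realType} {d : measure_display} {T : measurableType d}.
Variables (P : probability T R) (N : {RV P >-> nat}).

Lemma measurable_Neq n : measurable [set x | N x = n].
Proof.
rewrite (_ : [set x | N x = n] = N @^-1` [set n])//.
exact: measurable_funPTI.
Qed.

Lemma integral_partition (f : T -> \bar R) : measurable_fun setT f ->
  (forall x, 0 <= f x)%E ->
  (\int[P]_x f x = \sum_(0 <= n <oo) \int[P]_(x in [set x | N x = n]) f x)%E.
Proof.
move=> mf f0; rewrite -ge0_integral_bigcup//.
- by congr (integral _ _ _); apply/seteqP; split=> // x _; exists (N x).
- by move=> n; exact: measurable_Neq.
- exact: measurable_funTS.
- by apply/trivIsetP => i j _ _ ij; apply/seteqP; split=> // x [/= -> /eqP]; rewrite (negPf ij).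
Qed.

(** Stands in for conditional expectation given [N]: inequalities on the events [N = n], weighted by
    indicators, are summed over [n]. Nonnegativity makes the sums meaningful in the extended
    reals. *)
Lemma le_Ex_partition (f g : T -> R) :
  bounded_rv f -> bounded_rv g -> (forall x, 0 <= f x) -> (forall x, 0 <= g x) ->
  (forall n, Ex P (fun x => \1_[set x | N x = n] x * f x) <=
             Ex P (fun x => \1_[set x | N x = n] x * g x)) ->
  Ex P f <= Ex P g.
Proof.
move=> bf bg f0 g0 fg; rewrite -lee_fin -!expectation_Ex// unlock.
have mfE (h : T -> R) : bounded_rv h -> measurable_fun setT (EFin \o h).
  by move=> [mh _]; exact/measurable_EFinP.
rewrite integral_partition; [|exact: mfE|by move=> x; rewrite lee_fin].
rewrite [leRHS]integral_partition; [|exact: mfE|by move=> x; rewrite lee_fin].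
have E n (h : T -> R) : bounded_rv h -> (\int[P]_(x in [set x | N x = n]) (h x)%:E =
   (Ex P (fun x => \1_[set x | N x = n] x * h x)%R)%:E)%E.
  move=> bh; rewrite -expectation_Ex; last first.
    by apply: bounded_rvM => //; apply/bounded_rv_indic/measurable_Neq.
  rewrite unlock integral_mkcond; apply: eq_integral => x _.
  by rewrite epatch_indic muleC.
apply: lee_nneseries => [n _ _|n _].
  by apply: integral_ge0 => x _; rewrite lee_fin.
by rewrite /= !E// lee_fin fg.
Qed.

Lemma eq_Ex_partition (f g : T -> R) :
  bounded_rv f -> bounded_rv g -> (forall x, 0 <= f x) -> (forall x, 0 <= g x) ->
  (forall n, Ex P (fun x => \1_[set x | N x = n] x * f x) =
             Ex P (fun x => \1_[set x | N x = n] x * g x)) ->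
  Ex P f = Ex P g.
Proof.
by move=> bf bg f0 g0 fg; apply/eqP; rewrite eq_le; apply/andP; split;
  apply: le_Ex_partition => // n; rewrite fg.
Qed.

(** Serves for functionals of the first [N t] claims, whose index set is random. *)
Lemma measurable_fun_partition d' (T' : measurableType d') (g : nat -> T -> T') :
  (forall n, measurable_fun setT (g n)) -> measurable_fun setT (fun x => g (N x) x).
Proof.
move=> mg _ B mB; rewrite setTI.
have -> : (fun x => g (N x) x) @^-1` B =
    \bigcup_n ([set x | N x = n] `&` g n @^-1` B).
  by apply/seteqP; split=> [x Bx|x [n _ [<-]]//]; exists (N x).
apply: bigcupT_measurable => n; apply: measurableI; first exact: measurable_Neq.
by rewrite -[X in measurable X]setTI; exact: mg.
Qed.

End CountableConditioning.

(** * Dominated convergence under a probability *)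

Section DominatedConvergence.
Context {R : realType} {d : measure_display} {T : measurableType d}.
Variable P : probability T R.

Lemma cvg_Ex (f_ : nat -> T -> R) (f : T -> R) (M : R) :
  (forall n, measurable_fun setT (f_ n)) -> (forall n x, `|f_ n x| <= M) ->
  (forall x, f_ n x @[n --> \oo] --> f x) ->
  Ex P (f_ n) @[n --> \oo] --> Ex P f.
Proof.
move=> mf fM fcvg.
have mfl : measurable_fun setT f by apply: (measurable_fun_cvg mf) => x _; exact: fcvg.
have lM x : `|f x| <= M.
  have h : `|f_ n x| @[n --> \oo] --> `|f x| by apply: cvg_norm.
  rewrite -(cvg_lim _ h)//; apply: limr_le; first by apply/cvg_ex; exists `|f x|.
  exact: nearW.
have bf n : bounded_rv (f_ n) by split => //; exists M.
have bl : bounded_rv f by split => //; exists M.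
have [] := @dominated_convergence _ _ _ P setT measurableT (fun n => EFin \o f_ n)
  (EFin \o f) (cst M%:E).
- by move=> n; exact/measurable_EFinP.
- exact/measurable_EFinP.
- by apply: aeW => x _; apply: cvg_EFin; [exact: nearW|exact: fcvg].
- exact: (bounded_rv_integrable P (bounded_rv_cst M)).
- by apply: aeW => x n _; rewrite lee_fin.
move=> _ _ h.
have : fine \o (fun n => \int[P]_x (f_ n x)%:E)%E @ \oo --> Ex P f; last by [].
apply: fine_cvg; rewrite /Ex /Rintegral fineK; first exact: h.
exact/integrable_fin_num/bounded_rv_integrable.
Qed.

End DominatedConvergence.

(** * Independence and Chernoff bounds *)

Section Independence.
Context {R : realType} {d : measure_display} {T : measurableType d}.
Variable P : probability T R.

Lemma prodr_const_seq (I : Type) (r : seq I) (m : R) :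
  \prod_(i <- r) m = m ^+ size r.
Proof. by elim: r => [|i r IH]; rewrite ?big_nil// big_cons IH exprS. Qed.

Lemma sumr_const_seq (I : Type) (r : seq I) (m : R) :
  \sum_(i <- r) m = (size r)%:R * m.
Proof.
elim: r => [|i r IH]; first by rewrite big_nil mul0r.
by rewrite big_cons IH/= -natr1 mulrDl mul1r addrC.
Qed.

(** The sum counts the integers from 1 up to [m.+1 * z], so it is the floor of that number. Applied
    to the values of a function, it gives a uniform approximation by averages of indicators of level
    sets. *)
Lemma staircase_approx (m : nat) (z : R) : 0 <= z <= 1 ->
  `|z - m.+1%:R^-1 * \sum_(k < m.+1) (k.+1%:R <= m.+1%:R * z)%R%:R| <= m.+1%:R^-1.
Proof.
move=> /andP[z0 z1]; set x := m.+1%:R * z.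
have x0 : 0 <= x by rewrite mulr_ge0.
have sumE n : \sum_(k < n) (k.+1%:R <= x)%R%:R = (minn n (Num.truncn x))%:R :> R.
  elim: n => [|n IH]; first by rewrite big_ord0 min0n.
  rewrite big_ord_recr/= IH -natrD; congr (_%:R).
  by rewrite -truncn_ge_nat//; lia.
have /andP[tx xt] := truncn_itv x0.
have m0 : 0 < m.+1%:R :> R by rewrite ltr0n.
have tm : (Num.truncn x <= m.+1)%N.
  rewrite -(ler_nat R); apply: le_trans tx _.
  by rewrite -[leRHS]mulr1 /x ler_wpM2l.
rewrite sumE (minn_idPr tm).
have -> : z = m.+1%:R^-1 * x by rewrite mulrA mulVf ?mul1r// pnatr_eq0.
rewrite -mulrBr normrM ger0_norm ?invr_ge0// ler_piMr ?invr_ge0//.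
rewrite ger0_norm ?subr_ge0// lerBlDl; apply: ltW.
by rewrite natr1.
Qed.

(** The factorization passes from indicators to [g] because averages of indicators of level sets of
    [g] approximate it uniformly. *)
Lemma Ex_indep (Y H : T -> R) (g : R -> R) :
  measurable_fun setT Y -> bounded_rv H -> (forall x, 0 <= H x <= 1) ->
  measurable_fun setT g -> (forall y, 0 <= g y <= 1) ->
  (forall B, measurable B ->
    Ex P (fun x => H x * \1_B (Y x)) = Ex P H * Pr P (Y @^-1` B)) ->
  Ex P (fun x => H x * g (Y x)) = Ex P H * Ex P (g \o Y).
Proof.
move=> mY bH H01 mg g01 HB.
pose B m k := [set y | k.+1%:R <= m.+1%:R * g y].
have mB m k : measurable (B m k).
  rewrite -[B m k]setTI; apply: (measurable_fun_ler _ _ measurableT (Y := [set true])) => //.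
  exact: measurable_funM.
have mBY m k : measurable (Y @^-1` B m k).
  by rewrite -[X in measurable X]setTI; exact: mY.
pose s m x := m.+1%:R^-1 * \sum_(k < m.+1) \1_(B m k) (Y x) : R.
have b1 m k : bounded_rv (fun x => \1_(B m k) (Y x) : R).
  exact: (bounded_rv_indic (mBY m k)).
have sg m x : `|g (Y x) - s m x| <= m.+1%:R^-1.
  have -> : s m x = m.+1%:R^-1 * \sum_(k < m.+1) (k.+1%:R <= m.+1%:R * g (Y x))%R%:R.
    congr (_ * _); apply: eq_bigr => k _; rewrite indicE; congr (nat_of_bool _)%:R.
    by apply/idP/idP => [/set_mem//|h]; exact/mem_set.
  exact: staircase_approx.
have bs m : bounded_rv (s m).
  by apply: bounded_rvM; [exact: bounded_rv_cst|apply: (Ex_sum P _ _).1 => k; exact: b1].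
have bg : bounded_rv (g \o Y).
  apply: bounded_rv_unit => [|x]; first exact: measurableT_comp.
  exact: g01.
have ExHs m : Ex P (fun x => H x * s m x) = Ex P H * Ex P (s m).
  rewrite /s (ExZ P)//; last by apply: (Ex_sum P _ _).1 => k; exact: b1.
  have -> : (fun x => H x * (m.+1%:R^-1 * \sum_(k < m.+1) \1_(B m k) (Y x))) =
      (fun x => m.+1%:R^-1 * \sum_(k < m.+1) (H x * \1_(B m k) (Y x))).
    by apply/funext => x; rewrite mulrCA mulr_sumr.
  have bH1 k : bounded_rv (fun x => H x * \1_(B m k) (Y x)) by exact: bounded_rvM.
  rewrite (ExZ P)//; last by apply: (Ex_sum P _ _).1 => k; exact: bH1.
  rewrite mulrCA; congr (_ * _).
  rewrite (Ex_sum P _ (fun k => bH1 (nat_of_ord k))).2.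
  rewrite (Ex_sum P _ (fun k => b1 m (nat_of_ord k))).2 mulr_sumr.
  apply: eq_bigr => k _; rewrite HB//; congr (_ * _).
  by rewrite -Ex_indic.
have H1 : 0 <= Ex P H <= 1 by exact: Ex_itv.
(* One error [m.+1%:R^-1] for putting the staircase [s m] in place of [g \o Y] on each side. *)
have key m : `|Ex P (fun x => H x * g (Y x)) - Ex P H * Ex P (g \o Y)| <= 2 * m.+1%:R^-1.
  have h1 : `|Ex P (fun x => H x * g (Y x)) - Ex P (fun x => H x * s m x)| <= m.+1%:R^-1.
    rewrite -[leRHS](Ex_cst P); apply: normr_ExB; [exact: bounded_rvM|exact: bounded_rvM|
      exact: bounded_rv_cst|move=> x].
    rewrite -mulrBr normrM; have /andP[h0 h1] := H01 x.
    by rewrite ger0_norm// (le_trans _ (sg m x))// ler_piMl.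
  have h2 : `|Ex P (g \o Y) - Ex P (s m)| <= m.+1%:R^-1.
    rewrite -[leRHS](Ex_cst P); apply: normr_ExB => //;
      [exact: bounded_rv_cst|exact: sg].
  rewrite ExHs in h1.
  have h3 : `|Ex P H * Ex P (s m) - Ex P H * Ex P (g \o Y)| <= m.+1%:R^-1.
    case/andP: H1 => h0 h1'; rewrite -mulrBr normrM ger0_norm// distrC.
    by apply: le_trans h2; rewrite ler_piMl.
  apply: le_trans (ler_distD (Ex P H * Ex P (s m)) _ _) _.
  by rewrite mulr2n mulrDl mul1r lerD.
apply/eqP; rewrite -subr_eq0 -normr_eq0 eq_le normr_ge0 andbT.
apply/ler_addgt0Pr => e e0; rewrite add0r.
have [m hm] : exists m, m.+1%:R^-1 <= e / 2.
  exists (Num.truncn (e / 2)^-1).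
  rewrite -[leRHS]invrK lef_pV2 ?posrE ?invr_gt0 ?divr_gt0//.
  exact/ltW/truncnS_gt.
by apply: le_trans (key m) _; rewrite mulrC -ler_pdivlMr.
Qed.

Section Family.
Variables (X : nat -> {RV P >-> R}) (A : set T).
Hypothesis mA : measurable A.
Hypothesis indep : forall (J : seq nat) (B : nat -> set R), uniq J ->
  (forall i, measurable (B i)) ->
  P (A `&` \bigcap_(i in [set` J]) (X i @^-1` B i)) =
  (P A * \prod_(i <- J) P (X i @^-1` B i))%E.

(** [indep] speaks of events only. In [claim k] the functions from index [k] on are indicators; the
    induction on [k] then frees one factor at a time by means of [Ex_indep]. *)
Lemma Ex_indep_prod (g : nat -> R -> R) (n : nat) :
  (forall i, measurable_fun setT (g i)) -> (forall i y, 0 <= g i y <= 1) ->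
  Ex P (fun x => \1_A x * \prod_(i <- iota 0 n) g i (X i x)) =
  Pr P A * \prod_(i <- iota 0 n) Ex P (g i \o X i).
Proof.
have mXB i B : measurable B -> measurable (X i @^-1` B) by move=> mB; exact: measurable_funPTI.
suff claim k : forall g : nat -> R -> R,
    (forall i, measurable_fun setT (g i)) -> (forall i y, 0 <= g i y <= 1) ->
    (forall i, (k <= i)%N -> exists2 B, measurable B & g i = \1_B) ->
    Ex P (fun x => \1_A x * \prod_(i <- iota 0 n) g i (X i x)) =
    Pr P A * \prod_(i <- iota 0 n) Ex P (g i \o X i).
  (* The product ignores indices from [n] on, so they may be given indicators, and [claim n]
     applies. *)
  move=> mg g01; pose g' i := if (i < n)%N then g i else \1_setT.
  have E i : i \in iota 0 n -> g' i = g i.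
    by rewrite mem_iota /g' add0n => /andP[_ ->].
  have := claim n g'.
  have -> : (fun x => \1_A x * \prod_(i <- iota 0 n) g' i (X i x)) =
      (fun x => \1_A x * \prod_(i <- iota 0 n) g i (X i x)).
    by apply/funext => x; congr (_ * _); apply: eq_big_seq => i /E ->.
  have -> : \prod_(i <- iota 0 n) Ex P (g' i \o X i) =
            \prod_(i <- iota 0 n) Ex P (g i \o X i).
    by apply: eq_big_seq => i /E ->.
  apply.
  - by move=> i; rewrite /g'; case: ifP => // _; exact: measurable_indic.
  - by move=> i y; rewrite /g'; case: ifP => // _; rewrite indicE ler0n lern1 leq_b1.
  - by move=> i; rewrite /g' leqNgt => /negbTE ->; exists setT.
elim: k => [|k IH] {}g mg g01 gB.
  have [B mB gE] : exists2 B : nat -> set R, forall i, measurable (B i) & forall i, g i = \1_(B i).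
    have [B hB] := choice (fun i => let: ex_intro2 B mB gE := gB i (leq0n i) in
      ex_intro (fun B => measurable B /\ g i = \1_B) B (conj mB gE)).
    by exists B => i; case: (hB i).
  have mI : measurable (\bigcap_(i in [set` iota 0 n]) (X i @^-1` B i)).
    by apply: fin_bigcap_measurable => [|i _]; [exact: finite_seq|exact: mXB].
  have -> : (fun x => \1_A x * \prod_(i <- iota 0 n) g i (X i x)) =
      \1_(A `&` \bigcap_(i in [set` iota 0 n]) (X i @^-1` B i)).
    apply/funext => x; rewrite indicI/=; congr (_ * _).
    elim: (iota 0 n) => [|j s IHs].
      by rewrite big_nil set_nil bigcap_set0 indicT.
    have -> : [set` j :: s] = j |` [set` s].
      apply/seteqP; split=> i /=; rewrite inE.
        by case/predU1P; [left|right].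
      by case=> [->|->]; rewrite ?eqxx ?orbT.
    by rewrite big_cons bigcap_setU1 indicI/= IHs gE.
  rewrite Ex_indic; last exact: measurableI.
  apply: EFin_inj; rewrite -PrE; last exact: measurableI.
  rewrite indep ?iota_uniq// EFinM -PrE//; congr (_ * _)%E.
  elim: (iota 0 n) => [|j s IHs]; first by rewrite !big_nil.
  rewrite !big_cons EFinM IHs; congr (_ * _)%E.
  by rewrite gE -expectation_Ex ?(@expectation_indic _ _ _ P (X j @^-1` B j))//;
    [exact: mXB|exact: (bounded_rv_indic (mXB _ _ (mB j)))].
pose gk B i := if i == k then \1_B else g i.
have IHk B : measurable B ->
    Ex P (fun x => \1_A x * \prod_(i <- iota 0 n) gk B i (X i x)) =
    Pr P A * \prod_(i <- iota 0 n) Ex P (gk B i \o X i).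
  move=> mB; apply: IH => [i|i y|i]; rewrite /gk.
  - by case: ifP => // _; exact: measurable_indic.
  - by case: ifP => // _; rewrite indicE ler0n lern1 leq_b1.
  - by case: eqP => [_ _|/eqP ik ki]; [exists B|apply: gB; rewrite ltn_neqAle eq_sym ik].
have gkE B i : i != k -> gk B i = g i by rewrite /gk => /negPf ->.
have [kn|kn] := boolP (k \in iota 0 n); last first.
  have E B i : i \in iota 0 n -> gk B i = g i.
    by move=> hi; apply: gkE; apply: contraNneq kn => <-.
  have := IHk _ measurableT.
  have -> : (fun x => \1_A x * \prod_(i <- iota 0 n) gk setT i (X i x)) =
      (fun x => \1_A x * \prod_(i <- iota 0 n) g i (X i x)).
    by apply/funext => x; congr (_ * _); apply: eq_big_seq => i /E ->.
  move=> ->; congr (_ * _).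
  by apply: eq_big_seq => i /E ->.
(* The product without factor [k]. The induction hypothesis with an indicator at [k] is the premise
   of [Ex_indep] for this [H], and the indicator of [setT] evaluates [Ex P H]. *)
pose H x := \1_A x * \prod_(i <- iota 0 n | i != k) g i (X i x) : R.
pose K := Pr P A * \prod_(i <- iota 0 n | i != k) Ex P (g i \o X i).
have g01X i : (forall x, 0 <= (g i \o X i) x <= 1) by move=> x; exact: g01.
have bg i : bounded_rv (g i \o X i).
  by apply: bounded_rv_unit => //; exact: measurableT_comp.
have lhsE f x : (forall i, i != k -> f i = g i) ->
    \1_A x * \prod_(i <- iota 0 n) f i (X i x) = H x * f k (X k x).
  move=> fg; rewrite /H (bigD1_seq k)//= ?iota_uniq//.
  rewrite mulrCA mulrC; congr (_ * _ * _).
  by apply: eq_bigr => i /fg ->.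
have rhsE f : (forall i, i != k -> f i = g i) ->
    Pr P A * \prod_(i <- iota 0 n) Ex P (f i \o X i) = K * Ex P (f k \o X k).
  move=> fg; rewrite /K (bigD1_seq k)//= ?iota_uniq//.
  rewrite mulrCA mulrC; congr (_ * _ * _).
  by apply: eq_bigr => i /fg ->.
have H01 x : 0 <= H x <= 1.
  have h0 : 0 <= \prod_(i <- iota 0 n | i != k) g i (X i x).
    by apply: prodr_ge0 => i _; case/andP: (g01 i (X i x)).
  have h1 : \prod_(i <- iota 0 n | i != k) g i (X i x) <= 1.
    by apply: prodr_ile1 => i _; exact: g01.
  rewrite /H indicE; case: (x \in A); first by rewrite mul1r h0.
  by rewrite mul0r lexx ler01.
have bH : bounded_rv H.
  apply: bounded_rvM; first exact: bounded_rv_indic.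
  rewrite (_ : (fun x => _) =
      (fun x => \prod_(i <- [seq i <- iota 0 n | i != k]) (g i \o X i) x)).
    exact: bounded_rv_prod.
  by apply/funext => x; rewrite big_filter.
have HB B : measurable B -> Ex P (fun x => H x * \1_B (X k x)) = K * Pr P (X k @^-1` B).
  move=> mB; have := IHk B mB.
  have -> : (fun x => \1_A x * \prod_(i <- iota 0 n) gk B i (X i x)) =
      (fun x => H x * \1_B (X k x)).
    by apply/funext => x; rewrite (lhsE _ _ (gkE B)) /gk eqxx.
  rewrite (rhsE _ (gkE B)) => ->; congr (_ * _).
  by rewrite -Ex_indic; [rewrite /gk eqxx|exact: mXB].
have EH : Ex P H = K.
  have := HB _ measurableT; rewrite preimage_setT /Pr probability_setT mulr1 => <-.
  by congr (Ex P _); apply/funext => x; rewrite indicT mulr1.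
have -> : (fun x => \1_A x * \prod_(i <- iota 0 n) g i (X i x)) =
    (fun x => H x * g k (X k x)) by apply/funext => x; exact: lhsE.
rewrite rhsE// -EH; apply: Ex_indep => // B mB.
by rewrite HB// EH.
Qed.

(** From $e^{-y} \ge 1-y$ follows $e^y \le 1/(1-y) = 1 + y + y^2/(1-y)$, where $1-y \ge 1/2$. *)
Lemma expR_le_quadratic (y : R) : y <= 2^-1 -> expR y <= 1 + y + 2 * y ^+ 2.
Proof.
move=> y2; have h1 : 0 < 1 - y by lra.
have := expR_ge1Dx (- y); rewrite expRN => h.
have h2 : expR y <= (1 - y)^-1.
  by rewrite -[leLHS]invrK lef_pV2 ?posrE ?invr_gt0 ?expR_gt0.
apply: le_trans h2 _; rewrite -div1r ler_pdivrMr//; nra.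
Qed.

Lemma Ex_exp_sum (h : R -> R) (m s : R) (n : nat) :
  measurable_fun setT h -> (forall y, 0 <= h y) ->
  (forall i, Ex P (fun x => expR (- (s * h (X i x)))) = m) -> 0 <= s ->
  Ex P (fun x => \1_A x * expR (- (s * \sum_(i <- iota 0 n) h (X i x)))) =
  Pr P A * m ^+ n.
Proof.
move=> mh h0 hm s0.
have := @Ex_indep_prod (fun _ y => expR (- (s * h y))) n.
have -> : (fun x => \1_A x * \prod_(i <- iota 0 n) expR (- (s * h (X i x)))) =
   (fun x => \1_A x * expR (- (s * \sum_(i <- iota 0 n) h (X i x)))).
  apply/funext => x; congr (_ * _).
  by rewrite mulr_sumr -sumrN expR_sum.
move=> ->.
- congr (_ * _); rewrite (eq_bigr (fun=> m)) ?prodr_const_seq ?size_iota// => i _.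
  exact: hm.
- move=> _; apply: (measurableT_comp (@measurable_expR R)).
  by apply: measurable_funN; exact: measurable_funM.
- by move=> _ y; rewrite expR_ge0 -expR0 ler_expR oppr_le0 mulr_ge0.
Qed.

(* Chernoff: Markov's inequality for [expR (s * _)] with [s = +- delta / 4]. *)
Lemma chernoff (h : R -> R) (m delta s : R) (n : nat) :
  measurable_fun setT h -> (forall y, 0 <= h y <= 1) ->
  (forall i, Ex P (h \o X i) = m) -> 0 < delta <= 1 -> `|s| = delta / 4 ->
  Ex P (fun x => \1_A x * \1_[set x | `|s| * delta * n%:R * m <=
      s * (\sum_(i <- iota 0 n) h (X i x) - n%:R * m)] x) <=
  Pr P A * expR (- (n%:R * m * (delta ^+ 2 / 8))).
Proof.
move=> mh h01 hm d01 sd.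
(* Subtracting the norm of [s] puts [g] into [[0, 1]], as [Ex_indep_prod] requires; the constant [c]
   below undoes it. *)
pose g y := expR (s * h y - `|s|).
have bhX i : bounded_rv (h \o X i).
  by apply: bounded_rv_unit => [|x]; [exact: measurableT_comp|exact: h01].
have mg : measurable_fun setT g.
  apply: (measurableT_comp (@measurable_expR R)).
  by apply: measurable_funB => //; exact: measurable_funM.
have g01 y : 0 <= g y <= 1.
  rewrite expR_ge0 -expR0 ler_expR subr_le0.
  have /andP[h0 h1] := h01 y.
  apply: le_trans (ler_norm _) _; rewrite normrM (ger0_norm h0).
  by rewrite ler_piMr.
have bgX i : bounded_rv (g \o X i).
  by apply: bounded_rv_unit => [|x]; [exact: measurableT_comp|exact: g01].
have Eg i : Ex P (g \o X i) <= expR (- `|s| + (s + 2 * s ^+ 2) * m).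
  have : forall x, (g \o X i) x <= expR (- `|s|) * (1 + (s + 2 * s ^+ 2) * h (X i x)).
    move=> x; rewrite /g/= addrC expRD ler_pM2l ?expR_gt0//.
    have /andP[h0 h1] := h01 (X i x).
    have s2 : s * h (X i x) <= 2^-1.
      apply: le_trans (ler_norm _) _; rewrite normrM (ger0_norm h0) sd.
      apply: le_trans (ler_piMr _ h1) _; lra.
    apply: le_trans (expR_le_quadratic s2) _.
    (* This bounds the second moment by the mean [m], so that the final exponent is proportional to
       [n * m]; this matters because the exceedance probabilities tend to 0. *)
    have : h (X i x) ^+ 2 <= h (X i x) by rewrite expr2 ler_piMl.
    have := sqr_ge0 s; nra.
  have bh2 : bounded_rv (fun x => (s + 2 * s ^+ 2) * h (X i x)).
    by apply: bounded_rvM; [exact: bounded_rv_cst|exact: bhX].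
  move=> /Ex_le => /(_ P (bgX i)).
  have b3 : bounded_rv (fun x => 1 + (s + 2 * s ^+ 2) * h (X i x)).
    by apply: bounded_rvD => //; exact: bounded_rv_cst.
  move=> /(_ (bounded_rvM (bounded_rv_cst _) b3)) => /le_trans; apply.
  rewrite ExZ// ExD//; last exact: bounded_rv_cst.
  rewrite Ex_cst ExZ; last exact: bhX.
  rewrite (hm i : Ex P (fun x => h (X i x)) = m) expRD ler_pM2l ?expR_gt0//.
  exact: expR_ge1Dx.
pose S x := \sum_(i <- iota 0 n) h (X i x).
have mS : measurable_fun setT S.
  by apply: (Ex_sum P (iota 0 n) bhX).1.1.
set B := [set x | _].
have mB : measurable B.
  rewrite -[B]setTI; apply: (measurable_fun_ler _ _ measurableT (Y := [set true])) => //.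
  by apply: measurable_funM => //; exact: measurable_funB.
pose c := expR (`|s| * n%:R - s * n%:R * m - `|s| * delta * n%:R * m).
have bprod : bounded_rv (fun x => \prod_(i <- iota 0 n) g (X i x)).
  exact: (@bounded_rv_prod _ _ _ _ _ (fun i => g \o X i)).
apply: (@le_trans _ _ (Ex P (fun x => c * (\1_A x * \prod_(i <- iota 0 n) g (X i x))))).
  apply: Ex_le.
  - by apply: bounded_rvM; exact: bounded_rv_indic.
  - apply: bounded_rvM; first exact: bounded_rv_cst.
    by apply: bounded_rvM => //; exact: bounded_rv_indic.
  - move=> x; rewrite mulrCA; apply: ler_wpM2l; first by rewrite indicE.
    have -> : \prod_(i <- iota 0 n) g (X i x) = expR (s * S x - `|s| * n%:R).
      rewrite -expR_sum big_split/= -mulr_sumr; congr (expR (_ + _)).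
      by rewrite sumr_const_seq size_iota mulrN mulrC.
    rewrite -expRD indicE; have [/set_mem hx|_] := boolP (x \in B); last exact: expR_ge0.
    have {}hx : `|s| * delta * n%:R * m <= s * (S x - n%:R * m) by exact: hx.
    by rewrite -[leLHS]expR0 ler_expR; lra.
rewrite ExZ; last by apply: bounded_rvM => //; exact: bounded_rv_indic.
rewrite (@Ex_indep_prod (fun=> g))// mulrCA; apply: ler_wpM2l; first exact: Pr_ge0.
have : \prod_(i <- iota 0 n) Ex P (g \o X i) <= expR (- `|s| + (s + 2 * s ^+ 2) * m) ^+ n.
  rewrite -{2}(size_iota 0 n) -prodr_const_seq.
  by apply: ler_prod => i _; rewrite Eg andbT; apply: Ex_ge0 => x; case/andP: (g01 (X i x)).
move=> /(ler_wpM2l (expR_ge0 _ : 0 <= c)) /le_trans; apply.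
rewrite -expRM_natr -expRD ler_expR.
(* The exponent collapses to $nm(2s^2 - |s|\delta)$, which is minimal at $|s| = \delta/4$ with value
   $-nm\delta^2/8$. *)
have -> : s ^+ 2 = delta ^+ 2 / 16 by rewrite -real_normK ?num_real// sd; field.
by rewrite sd le_eqVlt; apply/orP; left; apply/eqP; field.
Qed.

End Family.
End Independence.

Lemma measurable_le_rv {R : realType} {d} {T : measurableType d} (f g : T -> R) :
  measurable_fun setT f -> measurable_fun setT g -> measurable [set x | f x <= g x].
Proof.
move=> mf mg; rewrite -[X in measurable X]setTI.
exact: (measurable_fun_ler mf mg measurableT (Y := [set true])).
Qed.

(** * Concentration of sums with a random number of terms *)

Section Concentration.
Context {R : realType} {d : measure_display} {T : measurableType d}.
Variables (P : probability T R) (X : nat -> {RV P >-> R}) (N : {RV P >-> nat}).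
Hypothesis indN : forall n (J : seq nat) (B : nat -> set R), uniq J ->
  (forall i, measurable (B i)) ->
  P ([set x | N x = n] `&` \bigcap_(i in [set` J]) (X i @^-1` B i)) =
  (P [set x | N x = n] * \prod_(i <- J) P (X i @^-1` B i))%E.
Variables (h : R -> R) (m delta M : R).
Hypothesis mh : measurable_fun setT h.
Hypothesis h01 : forall y, 0 <= h y <= 1.
Hypothesis hm : forall i, Ex P (h \o X i) = m.
Hypothesis d01 : 0 < delta <= 1.

Definition random_sum (x : T) : R := \sum_(i <- iota 0 (N x)) h (X i x).

Lemma measurable_partial_sum n : measurable_fun setT (fun x => \sum_(i <- iota 0 n) h (X i x)).
Proof. by apply: measurable_sum => i; exact: (measurableT_comp mh). Qed.

Lemma measurable_random_sum : measurable_fun setT random_sum.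
Proof.
apply: (@measurable_fun_partition _ _ _ P N _ R
  (fun n x => \sum_(i <- iota 0 n) h (X i x))) => n.
exact: measurable_partial_sum.
Qed.

Let mN : measurable_fun setT (fun x => (N x)%:R * m).
Proof.
apply: (@measurable_fun_partition _ _ _ P N _ R (fun n x => n%:R * m)) => n.
exact: measurable_cst.
Qed.

(** The sign of [s] selects the side: for [delta / 4] the sum is at least [1 + delta] times its
    conditional mean, for [- (delta / 4)] at most [1 - delta] times. Requiring a conditional mean of
    at least [M] permits one bound for all values of [N]. *)
Definition deviation (s : R) : set T := [set x | M <= (N x)%:R * m] `&`
  [set x | `|s| * delta * ((N x)%:R * m) <= s * (random_sum x - (N x)%:R * m)].

Lemma measurable_deviation s : measurable (deviation s).
Proof.
apply: measurableI; first exact: (measurable_le_rv (measurable_cst _) mN).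
apply: measurable_le_rv; first by apply: measurable_funM.
apply: measurable_funM => //; apply: measurable_funB => //.
exact: measurable_random_sum.
Qed.

Lemma Pr_deviation s : `|s| = delta / 4 ->
  Pr P (deviation s) <= expR (- (M * (delta ^+ 2 / 8))).
Proof.
move=> sd; have mD := measurable_deviation s.
rewrite -Ex_indic// -[leRHS](Ex_cst P).
apply: (@le_Ex_partition _ _ _ P N) => //; [exact: bounded_rv_indic|exact: bounded_rv_cst|].
move=> n; have mA := measurable_Neq N n.
have -> : Ex P (fun x => \1_[set x | N x = n] x * expR (- (M * (delta ^+ 2 / 8)))) =
    Pr P [set x | N x = n] * expR (- (M * (delta ^+ 2 / 8))).
  under eq_fun do rewrite mulrC.
  by rewrite ExZ ?Ex_indic 1?mulrC//; exact: bounded_rv_indic.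
(* If [n * m < M], the event does not meet [N = n]; otherwise [n * m] in Chernoff's exponent may be
   lowered to [M]. *)
have [Mn|nM] := leP M (n%:R * m); last first.
  have -> : (fun x => \1_[set x | N x = n] x * \1_(deviation s) x) = fun=> 0 :> R.
    apply/funext => x; rewrite !indicE.
    have [/set_mem/= Nx|_] := boolP (x \in _); last by rewrite mul0r.
    have [/set_mem/= [/=]|_] := boolP (x \in _); last by rewrite mulr0.
    by rewrite Nx leNgt nM.
  by rewrite Ex_cst mulr_ge0 ?Pr_ge0 ?expR_ge0.
have := chernoff mA (indN n) n mh h01 hm d01 sd.
set E := [set x | _ <= _] => hE.
have mE : measurable E.
  apply: measurable_le_rv; first exact: measurable_cst.
  apply: measurable_funM => //; apply: measurable_funB => //.
  exact: measurable_partial_sum.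
apply: (@le_trans _ _ (Ex P (fun x => \1_[set x | N x = n] x * \1_E x))).
  apply: Ex_le => [| |x].
  - by apply: bounded_rvM; exact: bounded_rv_indic.
  - by apply: bounded_rvM; exact: bounded_rv_indic.
  rewrite !indicE; have [/set_mem/= Nx|_] := boolP (x \in [set x | N x = n]); last by rewrite !mul0r.
  rewrite !mul1r; have [/set_mem/= [/= _ Dx]|_] := boolP (x \in deviation s); last by rewrite ler0n.
  by rewrite mem_set// /E/=; move: Dx; rewrite /random_sum Nx mulrA.
apply: le_trans hE _; rewrite ler_wpM2l ?Pr_ge0// ler_expR lerN2.
by rewrite ler_wpM2r// divr_ge0// sqr_ge0.
Qed.

Lemma deviation_upper x : ~ deviation (delta / 4) x -> M <= (N x)%:R * m ->
  random_sum x < (1 + delta) * ((N x)%:R * m).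
Proof.
move=> /not_andP[//|] + _ => /negP; rewrite -ltNge.
have d0 : 0 < delta / 4 by rewrite divr_gt0//; case/andP: d01.
by rewrite gtr0_norm// -(mulrA (delta / 4)) ltr_pM2l//; lra.
Qed.

Lemma deviation_lower x : ~ deviation (- (delta / 4)) x -> M <= (N x)%:R * m ->
  (1 - delta) * ((N x)%:R * m) < random_sum x.
Proof.
move=> /not_andP[//|] + _ => /negP; rewrite -ltNge.
have d0 : 0 < delta / 4 by rewrite divr_gt0//; case/andP: d01.
by rewrite normrN gtr0_norm// -(mulrA (delta / 4)) mulNr -mulrN ltr_pM2l//; lra.
Qed.

End Concentration.

(** * Convergence of Laplace transforms implies convergence in distribution *)

Lemma cvg_near_eq {R : realType} (g f : R -> R) (a : R) :
  (\forall t \near +oo, f t = g t) -> g t @[t --> +oo] --> a ->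
  f t @[t --> +oo] --> a.
Proof.
move=> fg; apply: cvg_trans; apply: near_eq_cvg.
by near=> t; apply/esym; near: t.
Unshelve. all: by end_near. Qed.

Section Bernstein.
Context {R : realType}.
Implicit Types (a b c : R) (phi psi : nat -> R).

(* [bern n a phi] is the expectation of [phi] under the binomial law of
   parameters [n] and [a]. *)
Fixpoint bern (n : nat) a phi : R :=
  if n is m.+1 then (1 - a) * bern m a phi + a * bern m a (fun i => phi i.+1)
  else phi 0%N.

Lemma bernD n a phi psi :
  bern n a (fun i => phi i + psi i) = bern n a phi + bern n a psi.
Proof.
elim: n phi psi => //= n IH phi psi.
by rewrite IH (IH (fun i => phi i.+1) (fun i => psi i.+1)); ring.
Qed.

Lemma bernZ n a r phi : bern n a (fun i => r * phi i) = r * bern n a phi.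
Proof. by elim: n phi => //= n IH phi; rewrite !IH; ring. Qed.

Lemma bern_cst n a r : bern n a (fun=> r) = r.
Proof. by elim: n => //= n ->; ring. Qed.

Lemma bern_le n a phi psi : 0 <= a <= 1 -> (forall i, phi i <= psi i) ->
  bern n a phi <= bern n a psi.
Proof.
move=> /andP[a0 a1]; elim: n phi psi => //= n IH phi psi pp.
by rewrite lerD// ler_wpM2l ?subr_ge0//; apply: IH.
Qed.

(** Variance plus squared bias; the induction moves the centre to [c - 1] after a success. *)
Lemma bern_sqr n a c :
  bern n a (fun i => (i%:R - c) ^+ 2) = n%:R * a * (1 - a) + (n%:R * a - c) ^+ 2.
Proof.
elim: n c => [|n IH] c /=; first by ring.
have -> : (fun i : nat => (i.+1%:R - c) ^+ 2) = (fun i => (i%:R - (c - 1)) ^+ 2).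
  by apply/funext => i; rewrite -natr1; congr (_ ^+ 2); ring.
by rewrite !IH -natr1; ring.
Qed.

Lemma bern_var n a : 0 <= a <= 1 ->
  bern n.+1 a (fun i => (i%:R / n.+1%:R - a) ^+ 2) <= n.+1%:R^-1.
Proof.
move=> /andP[a0 a1]; have n0 : n.+1%:R != 0 :> R by rewrite pnatr_eq0.
have -> : (fun i : nat => (i%:R / n.+1%:R - a) ^+ 2) =
          (fun i => (n.+1%:R^-1) ^+ 2 * (i%:R - n.+1%:R * a) ^+ 2).
  by apply/funext => i; rewrite -exprMn mulrBr mulrA mulVf// mul1r mulrC.
rewrite bernZ bern_sqr subrr expr0n/= addr0.
have -> : n.+1%:R^-1 ^+ 2 * (n.+1%:R * a * (1 - a)) = n.+1%:R^-1 * (a * (1 - a)).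
  by field.
by rewrite ler_piMr ?invr_ge0//; nra.
Qed.

Definition bern3 (n : nat) a b c (g : nat -> nat -> nat -> R) : R :=
  bern n a (fun i => bern n b (fun j => bern n c (g i j))).

Lemma bern3_le n a b c (g h : nat -> nat -> nat -> R) :
  0 <= a <= 1 -> 0 <= b <= 1 -> 0 <= c <= 1 ->
  (forall i j k, g i j k <= h i j k) -> bern3 n a b c g <= bern3 n a b c h.
Proof.
move=> a1 b1 c1 gh; apply: bern_le => // i; apply: bern_le => // j.
by apply: bern_le => // k.
Qed.

(** Bernstein's argument: the deviation of [g] from [v] is dominated by a quadratic function of the
    grid point, whose mean involves only the three binomial variances, each at most [n.+1%:R^-1]. *)
Lemma bern3_approx n a b c (g : nat -> nat -> nat -> R) (v e r : R) :
  0 <= a <= 1 -> 0 <= b <= 1 -> 0 <= c <= 1 -> 0 <= r ->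
  (forall i j k, `|g i j k - v| <= e + r * ((i%:R / n.+1%:R - a) ^+ 2 +
     (j%:R / n.+1%:R - b) ^+ 2 + (k%:R / n.+1%:R - c) ^+ 2)) ->
  `|bern3 n.+1 a b c g - v| <= e + r * (3 * n.+1%:R^-1).
Proof.
move=> a1 b1 c1 r0 gv.
pose D i j k := (i%:R / n.+1%:R - a) ^+ 2 +
     (j%:R / n.+1%:R - b) ^+ 2 + (k%:R / n.+1%:R - c) ^+ 2.
have E (w s : R) : bern3 n.+1 a b c (fun i j k => w + s * D i j k) =
   w + s * (bern n.+1 a (fun i => (i%:R / n.+1%:R - a) ^+ 2) +
            bern n.+1 b (fun i => (i%:R / n.+1%:R - b) ^+ 2) +
            bern n.+1 c (fun i => (i%:R / n.+1%:R - c) ^+ 2)).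
  rewrite /bern3.
  under eq_fun do under eq_fun do rewrite bernD bern_cst bernZ bernD bern_cst.
  under eq_fun do rewrite bernD bern_cst bernZ !bernD !bern_cst.
  by rewrite bernD bern_cst bernZ !bernD !bern_cst.
have := bern_var n a1; have := bern_var n b1; have := bern_var n c1.
set x := bern _ _ _; set y := bern _ _ _; set z := bern _ _ _ => x1 y1 z1.
have xyz : r * (z + y + x) <= r * (3 * n.+1%:R^-1).
  apply: ler_wpM2l => //; move: x1 y1 z1.
  by move: n.+1%:R^-1 => q; lra.
have gv' i j k : v - e + (- r) * D i j k <= g i j k <= v + e + r * D i j k.
  have : `|g i j k - v| <= e + r * D i j k := gv i j k.
  rewrite mulNr; move: (r * D i j k) => D'; rewrite ler_norml => /andP[h1 h2].
  by apply/andP; split; lra.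
have u1 := @bern3_le n.+1 a b c g _ a1 b1 c1 (fun i j k => proj2 (andP (gv' i j k))).
have u2 := @bern3_le n.+1 a b c _ g a1 b1 c1 (fun i j k => proj1 (andP (gv' i j k))).
rewrite E -/x -/y -/z in u1; rewrite E -/x -/y -/z in u2.
move: u1 u2 xyz; rewrite mulNr; move: (bern3 _ _ _ _ _) (r * (z + y + x)) (r * (3 * _)).
move=> b3 s q u1 u2 xyz.
rewrite ler_norml; apply/andP; split; lra.
Qed.

End Bernstein.

(** * Polynomials in the exponentials of the coordinates *)

Section LaplaceContinuity.
Context {R : realType}.

(** The functions whose expectations are combinations of Laplace transforms at natural arguments.
    Exponentials enter one factor at a time, so that an induction step raises one index of
    [lap3]. *)
Inductive exp_poly : (R * R * R -> R) -> Prop :=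
| exp_poly_cst r : exp_poly (fun=> r)
| exp_polyD f g : exp_poly f -> exp_poly g -> exp_poly (fun v => f v + g v)
| exp_poly1 f : exp_poly f -> exp_poly (fun v => expR (- v.1.1) * f v)
| exp_poly2 f : exp_poly f -> exp_poly (fun v => expR (- v.1.2) * f v)
| exp_poly3 f : exp_poly f -> exp_poly (fun v => expR (- v.2) * f v)
| exp_polyZ r f : exp_poly f -> exp_poly (fun v => r * f v).

Definition nonneg3 (v : R * R * R) : Prop := [/\ 0 <= v.1.1, 0 <= v.1.2 & 0 <= v.2].

(** [pi] stands for any of the three coordinates. The recursion of [bern] is rewritten without the
    factor $1 - e^{-\pi(v)}$, which is not a generator. *)
Lemma exp_poly_bern (pi : R * R * R -> R) n (phi : nat -> R * R * R -> R) :
  (forall f, exp_poly f -> exp_poly (fun v => expR (- pi v) * f v)) ->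
  (forall i, exp_poly (phi i)) ->
  exp_poly (fun v => bern n (expR (- pi v)) (phi^~ v)).
Proof.
move=> piP; elim: n phi => [|n IH] phi hphi; first exact: hphi.
have -> : (fun v => bern n.+1 (expR (- pi v)) (phi^~ v)) =
   (fun v => bern n (expR (- pi v)) (phi^~ v) +
     expR (- pi v) * (bern n (expR (- pi v)) (fun i => phi i.+1 v) +
       (-1) * bern n (expR (- pi v)) (phi^~ v))).
  by apply/funext => v /=; ring.
apply: exp_polyD; first exact: IH.
apply: piP; apply: exp_polyD; first exact: (IH (fun i => phi i.+1)).
by apply: exp_polyZ; exact: IH.
Qed.

Lemma exp_poly_bern3 n (g : nat -> nat -> nat -> R) :
  exp_poly (fun v => bern3 n (expR (- v.1.1)) (expR (- v.1.2)) (expR (- v.2)) g).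
Proof.
apply: (@exp_poly_bern (fun v => v.1.1)) => [f|i]; first exact: exp_poly1.
apply: (@exp_poly_bern (fun v => v.1.2)) => [f|j]; first exact: exp_poly2.
apply: (@exp_poly_bern (fun v => v.2) n (fun k _ => g i j k)) => [f|k]; first exact: exp_poly3.
exact: exp_poly_cst.
Qed.

Lemma exp_poly_tail (pi : R * R * R -> R) m :
  (forall f, exp_poly f -> exp_poly (fun v => expR (- pi v) * f v)) ->
  exp_poly (fun v => (1 - expR (- pi v)) ^+ m).
Proof.
move=> piP; elim: m => [|m IH].
  by under eq_fun do rewrite expr0; exact: exp_poly_cst.
have -> : (fun v => (1 - expR (- pi v)) ^+ m.+1) = (fun v => (1 - expR (- pi v)) ^+ m +
    (-1) * (expR (- pi v) * (1 - expR (- pi v)) ^+ m)).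
  by apply/funext => v; rewrite exprS; ring.
by apply: exp_polyD => //; apply: exp_polyZ; exact: piP.
Qed.

(* [(1 - e^-y) ^ m] detects large [y] while being a polynomial in [e^-y], so that
   convergence of Laplace transforms yields tightness. *)
Definition tail3 m (v : R * R * R) : R :=
  (1 - expR (- v.1.1)) ^+ m + (1 - expR (- v.1.2)) ^+ m + (1 - expR (- v.2)) ^+ m.

Lemma exp_poly_tail3 m : exp_poly (tail3 m).
Proof.
apply: exp_polyD; first apply: exp_polyD.
- by apply: (@exp_poly_tail (fun v => v.1.1)) => f; exact: exp_poly1.
- by apply: (@exp_poly_tail (fun v => v.1.2)) => f; exact: exp_poly2.
- by apply: (@exp_poly_tail (fun v => v.2)) => f; exact: exp_poly3.
Qed.

Lemma expRN_itv (y : R) : 0 <= y -> 0 < expR (- y) <= 1.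
Proof. by move=> y0; rewrite expR_gt0 -expR0 ler_expR oppr_le0. Qed.

Lemma exp_poly_bounded f : exp_poly f ->
  exists M, forall v, nonneg3 v -> `|f v| <= M.
Proof.
have aux (y z M : R) : 0 <= y -> `|z| <= M -> `|expR (- y) * z| <= M.
  move=> /expRN_itv/andP[e0 e1] zM; rewrite normrM gtr0_norm//.
  by apply: le_trans zM; rewrite ler_piMl.
elim=> {f} [r|f g _ [M fM] _ [K gK]|f _ [M fM]|f _ [M fM]|f _ [M fM]|r f _ [M fM]].
- by exists `|r|.
- by exists (M + K) => v v0; apply: le_trans (ler_normD _ _) _; rewrite lerD ?fM ?gK.
- by exists M => v v0; apply: aux; [case: v0|exact: fM].
- by exists M => v v0; apply: aux; [case: v0|exact: fM].
- by exists M => v v0; apply: aux; [case: v0|exact: fM].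
- by exists (`|r| * M) => v v0; rewrite normrM ler_wpM2l ?fM.
Qed.

Section RandomVector.
Context {d : measure_display} {T : measurableType d}.

Definition random_nonneg3 (V : T -> R * R * R) : Prop :=
  [/\ measurable_fun setT (fun x => (V x).1.1),
      measurable_fun setT (fun x => (V x).1.2),
      measurable_fun setT (fun x => (V x).2) & forall x, nonneg3 (V x)].

Lemma measurable_expRN (Y : T -> R) : measurable_fun setT Y ->
  measurable_fun setT (fun x => expR (- Y x)).
Proof.
by move=> mY; apply: (measurableT_comp (@measurable_expR R)); exact: measurable_funN.
Qed.

Lemma exp_poly_rv V f : random_nonneg3 V -> exp_poly f -> bounded_rv (f \o V).
Proof.
move=> [m1 m2 m3 V0] pf; split; last first.
  by have [M fM] := exp_poly_bounded pf; exists M => x; exact: fM.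
elim: pf => {f} [r|f g _ mf _ mg|f _ mf|f _ mf|f _ mf|r f _ mf].
- exact: measurable_cst.
- exact: measurable_funD.
- by apply: measurable_funM => //; exact: measurable_expRN.
- by apply: measurable_funM => //; exact: measurable_expRN.
- by apply: measurable_funM => //; exact: measurable_expRN.
- exact: measurable_funM.
Qed.

End RandomVector.

Definition lap3 (i j k : nat) (v : R * R * R) : R :=
  expR (- (i%:R * v.1.1 + j%:R * v.1.2 + k%:R * v.2)).

Lemma lap3_exp_poly i j k : exp_poly (lap3 i j k).
Proof.
have E f (pi : R * R * R -> R) n :
  (forall f, exp_poly f -> exp_poly (fun v => expR (- pi v) * f v)) ->
  exp_poly f -> exp_poly (fun v => expR (- (n%:R * pi v)) * f v).
  move=> piP pf; elim: n => [|n IH].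
    by under eq_fun do rewrite mul0r oppr0 expR0 mul1r.
  have -> : (fun v => expR (- (n.+1%:R * pi v)) * f v) =
    (fun v => expR (- pi v) * (expR (- (n%:R * pi v)) * f v)).
    by apply/funext => v; rewrite mulrA -expRD -natr1; congr (expR _ * _); ring.
  exact: piP.
have -> : lap3 i j k = (fun v => expR (- (i%:R * v.1.1)) * (expR (- (j%:R * v.1.2)) *
    (expR (- (k%:R * v.2)) * 1))).
  by apply/funext => v; rewrite mulr1 -!expRD; congr expR; ring.
apply: (E _ (fun v => v.1.1)) => [f|]; first exact: exp_poly1.
apply: (E _ (fun v => v.1.2)) => [f|]; first exact: exp_poly2.
apply: (E _ (fun v => v.2)) => [f|]; first exact: exp_poly3.
exact: exp_poly_cst.
Qed.

(** The substitution $y = e^{-x}$ carries the half-line to []0, 1]], where Bernstein polynomials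
    live; infinity becomes the boundary point 0. *)
Lemma continuous_lnN3 (f : R * R * R -> R) (x : R * R * R) : continuous f ->
  0 < x.1.1 -> 0 < x.1.2 -> 0 < x.2 ->
  {for x, continuous (fun y => f (- ln y.1.1, - ln y.1.2, - ln y.2))}.
Proof.
move=> cf x1 x2 x3.
have cl (pi : R * R * R -> R) : {for x, continuous pi} -> 0 < pi x ->
    - ln (pi y) @[y --> x] --> - ln (pi x).
  move=> cpi pix; apply: cvgN.
  have : {for x, continuous (@ln R \o pi)}.
    by apply: continuous_comp => //; exact: continuous_ln.
  exact.
have c1 : {for x, continuous (fun y : R * R * R => y.1.1)}.
  have : {for x, continuous (fst \o fst : R * R * R -> R)}.
    by apply: continuous_comp; exact: cvg_fst.
  exact.
have c2 : {for x, continuous (fun y : R * R * R => y.1.2)}.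
  have : {for x, continuous (snd \o fst : R * R * R -> R)}.
    by apply: continuous_comp; [exact: cvg_fst|exact: cvg_snd].
  exact.
have c3 : {for x, continuous (fun y : R * R * R => y.2)} by exact: cvg_snd.
have h := cvg_pair (cvg_pair (cl _ c1 x1) (cl _ c2 x2)) (cl _ c3 x3).
pose L y : R * R * R := (- ln y.1.1, - ln y.1.2, - ln y.2).
have cL : {for x, continuous L} by exact: h.
have : {for x, continuous (f \o L)} by apply: continuous_comp => //; exact: cf.
exact.
Qed.

(** Compactness of the cube [[delta, 1]^3]. Only [x] is confined to it, because a grid point close
    to [x] may lie outside. *)
Lemma unif_continuous_lnN3 (f : R * R * R -> R) (delta e : R) : continuous f ->
  0 < delta -> 0 < e -> exists2 r, 0 < r & forall x y : R * R * R,
    delta <= x.1.1 <= 1 -> delta <= x.1.2 <= 1 -> delta <= x.2 <= 1 ->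
    `|x.1.1 - y.1.1| < r -> `|x.1.2 - y.1.2| < r -> `|x.2 - y.2| < r ->
    `|f (- ln x.1.1, - ln x.1.2, - ln x.2) -
      f (- ln y.1.1, - ln y.1.2, - ln y.2)| < e.
Proof.
move=> cf d0 e0; pose I := `[delta, 1]%classic : set R.
pose G y := f (- ln y.1.1, - ln y.1.2, - ln y.2).
pose K : set (R * R * R) := I `*` I `*` I.
have cK : compact K by do 2?apply: compact_setX; exact: segment_compact.
pose B (k : nat) (x : R * R * R) := forall y, ball x k.+1%:R^-1 y -> `|G x - G y| < e.
have [N _ KB] : \forall k \near \oo, K `<=` B k.
  apply: ((compact_near_coveringP K).1 cK) => x [[/= x1 x2] x3].
  have {x1 x2 x3} [x1 x2 x3] : [/\ 0 < x.1.1, 0 < x.1.2 & 0 < x.2].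
    move: x1 x2 x3; rewrite /I/= !in_itv/= => /andP[h1 _] /andP[h2 _] /andP[h3 _].
    by split; exact: lt_le_trans d0 _.
  have /cvgrPdist_lt /(_ (e / 2)) := continuous_lnN3 cf x1 x2 x3.
  move=> /(_ (divr_gt0 e0 (ltr0n R 2))) /nbhs_ballP[r /= r0 rG].
  exists (ball x (r / 2), [set k : nat | k.+1%:R^-1 < r / 2]).
    split=> /=; first by apply: nbhsx_ballx; rewrite divr_gt0.
    exact: near_infty_natSinv_lt (PosNum (divr_gt0 r0 _)).
  move=> [x' k] [/= xx' kr] y x'y.
  have xy : ball x r y.
    rewrite [r]splitr; apply: ball_triangle xx' _.
    by apply: le_ball x'y; exact: ltW.
  have xx'r : ball x r x' by apply: le_ball xx'; rewrite ler_pdivrMr// ler_peMr// ?ler1n// ltW.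
  have h1 := rG _ xy; have h2 := rG _ xx'r.
  rewrite (splitr e) (_ : G x' - G y = (G x - G y) - (G x - G x')); last by ring.
  by apply: le_lt_trans (ler_normB _ _) _; exact: ltrD.
exists N.+1%:R^-1; first by rewrite invr_gt0 ltr0n.
move=> x y x1 x2 x3 h1 h2 h3; apply: (KB N (leqnn N) x).
  by rewrite /K /I /=; split; [split|]; rewrite /= in_itv.
by split; [split|].
Qed.

Lemma bernoulli_ineq (a : R) m : 0 <= a <= 1 -> 1 - m%:R * a <= (1 - a) ^+ m.
Proof.
move=> /andP[a0 a1]; elim: m => [|m IH]; first by rewrite mul0r subr0 expr0.
rewrite exprS -natr1; have h : 0 <= 1 - a by rewrite subr_ge0.
apply: le_trans (ler_wpM2l h IH).
have : 0 <= m%:R * a * a by rewrite !mulr_ge0.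
lra.
Qed.

(** Bernstein approximation works where all exponentials are at least [delta]. Elsewhere [tail3] is
    at least 1/2, and [4 * M * tail3] exceeds the trivial error [2 * M]. *)
Lemma bern3_tail_approx (f : R * R * R -> R) (M e : R) m : continuous f ->
  (forall x, `|f x| <= M) -> 0 < e ->
  exists n, forall v, nonneg3 v ->
    `|bern3 n.+1 (expR (- v.1.1)) (expR (- v.1.2)) (expR (- v.2))
        (fun i j k => f (- ln (i%:R / n.+1%:R), - ln (j%:R / n.+1%:R), - ln (k%:R / n.+1%:R)))
      - f v| <= e + 4 * M * tail3 m.+1 v.
Proof.
move=> cf fM e0; have M0 : 0 <= M := le_trans (normr_ge0 _) (fM (0, 0, 0)).
(* Chosen so that $e^{-y} < \delta$ gives $(1-e^{-y})^{m+1} \ge 1 - (m+1)\delta = 1/2$. *)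
pose delta : R := (2 * m.+1%:R)^-1.
have m0 : 0 < m.+1%:R :> R by rewrite ltr0n.
have d0 : 0 < delta by rewrite invr_gt0 mulr_gt0.
have [r r0 rf] := unif_continuous_lnN3 cf d0 (divr_gt0 e0 (ltr0n R 2)).
(* At grid points with squared distance at least [r ^+ 2] the trivial bound [2 * M] is at most [q]
   times that squared distance. *)
pose q := 2 * M / r ^+ 2.
have q0 : 0 <= q by apply: divr_ge0; [rewrite mulr_ge0|exact: sqr_ge0].
have [n nq] : exists n : nat, q * (3 * n.+1%:R^-1) <= e / 2.
  exists (Num.truncn (q * 3 / (e / 2))).
  rewrite mulrA ler_pdivrMr ?ltr0n// [leRHS]mulrC -ler_pdivrMr ?divr_gt0//.
  exact/ltW/truncnS_gt.
(* An index 0 evaluates [f] with the default [ln 0 = 0]; this is harmless, as [rf] holds for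
   arbitrary [y] with the same default. *)
exists n => v v0; set g := fun i j k : nat => _.
have [v1 v2 v3] := v0.
have iv (y : R) : 0 <= y -> 0 <= expR (- y) <= 1.
  by move=> /expRN_itv/andP[/ltW -> ->].
have gM i j k : `|g i j k - f v| <= 2 * M.
  apply: le_trans (ler_normB _ _) _; rewrite mulr2n mulrDl mul1r.
  by rewrite lerD// /g.
have tail0 (y : R) : 0 <= y -> 0 <= (1 - expR (- y)) ^+ m.+1.
  by move=> /iv/andP[_ h]; rewrite exprn_ge0// subr_ge0.
have tail_big (y : R) : 0 <= y -> expR (- y) < delta -> 2^-1 <= (1 - expR (- y)) ^+ m.+1.
  move=> /iv y1 yd; apply: le_trans (bernoulli_ineq m.+1 y1).
  have : m.+1%:R * expR (- y) <= m.+1%:R * delta by rewrite ler_pM2l// ltW.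
  have -> : m.+1%:R * delta = 2^-1 by rewrite /delta invfM mulrCA mulfV ?mulr1 ?gt_eqF.
  lra.
have big : 2^-1 <= tail3 m.+1 v ->
    `|bern3 n.+1 (expR (- v.1.1)) (expR (- v.1.2)) (expR (- v.2)) g - f v| <=
    e + 4 * M * tail3 m.+1 v.
  move=> tv; apply: (@le_trans _ _ (2 * M + 0 * (3 * n.+1%:R^-1))).
    by apply: bern3_approx; rewrite ?iv// => i j k; rewrite mul0r addr0.
  rewrite mul0r addr0; have : M * 2^-1 <= M * tail3 m.+1 v by rewrite ler_wpM2l.
  lra.
have t1 := tail0 _ v1; have t2 := tail0 _ v2; have t3 := tail0 _ v3.
have [h1|h1] := ltP (expR (- v.1.1)) delta.
  by apply: big; rewrite /tail3; have := tail_big _ v1 h1; lra.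
have [h2|h2] := ltP (expR (- v.1.2)) delta.
  by apply: big; rewrite /tail3; have := tail_big _ v2 h2; lra.
have [h3|h3] := ltP (expR (- v.2)) delta.
  by apply: big; rewrite /tail3; have := tail_big _ v3 h3; lra.
have tv0 : 0 <= 4 * M * tail3 m.+1 v.
  by rewrite mulr_ge0 ?mulr_ge0// /tail3 !addr_ge0.
apply: (@le_trans _ _ (e / 2 + q * (3 * n.+1%:R^-1))); last first.
  by rewrite [in leRHS](splitr e) -addrA lerD2l (le_trans nq)// lerDl.
apply: bern3_approx; rewrite ?iv// => i j k.
pose x : R * R * R := (expR (- v.1.1), expR (- v.1.2), expR (- v.2)).
pose y : R * R * R := (i%:R / n.+1%:R, j%:R / n.+1%:R, k%:R / n.+1%:R).
set s := (_ + _ + _); have s0 : 0 <= s by rewrite /s !addr_ge0 ?sqr_ge0.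
have [rs|sr] := leP (r ^+ 2) s.
  apply: (le_trans (gM i j k)).
  have : 2 * M <= q * s.
    by rewrite /q mulrAC ler_pdivlMr ?exprn_gt0// ler_wpM2l ?mulr_ge0.
  have := divr_gt0 e0 (ltr0n R 2); lra.
have close (a b c : R) : 0 <= b -> 0 <= c -> a ^+ 2 + b + c < r ^+ 2 -> `|a| < r.
  move=> b0 c0 h; rewrite -(ltr_pXn2r (n := 2)) ?nnegrE ?(ltW r0)// real_normK ?num_real//; lra.
have := rf x y; rewrite /x /y /=.
have -> : (- ln (expR (- v.1.1)), - ln (expR (- v.1.2)), - ln (expR (- v.2))) = v.
  by rewrite !expRK !opprK; case: v {v0 g gM x y s s0 sr v1 v2 v3 t1 t2 t3 h1 h2 h3 tv0 big} => [[]].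
move=> /(_ _ _ _ _ _ _) h.
apply: (@le_trans _ _ (e / 2)); last by rewrite lerDl mulr_ge0.
rewrite distrC ltW//; apply: h.
- by rewrite h1; have /andP[] := iv _ v1.
- by rewrite h2; have /andP[] := iv _ v2.
- by rewrite h3; have /andP[] := iv _ v3.
- rewrite distrC; apply: close sr; exact: sqr_ge0.
- rewrite distrC; move: sr; rewrite /s addrAC addrC addrA addrAC.
  by apply: close; exact: sqr_ge0.
- rewrite distrC; move: sr; rewrite /s addrC addrA; apply: close; exact: sqr_ge0.
Qed.

Section Cvg.
Context {d d' : measure_display} {T : measurableType d} {T' : measurableType d'}.
Variables (P : probability T R) (Q : probability T' R).
Variables (V : R -> T -> R * R * R) (W : T' -> R * R * R).
Hypothesis rV : \forall t \near +oo, random_nonneg3 (V t).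
Hypothesis rW : random_nonneg3 W.
Hypothesis lapV : forall i j k : nat,
  Ex P (lap3 i j k \o V t) @[t --> +oo] --> Ex Q (lap3 i j k \o W).

Lemma exp_polyM f g : exp_poly f -> exp_poly g -> exp_poly (fun v => f v * g v).
Proof.
move=> pf pg; elim: pf => {f} [r|f h _ pf _ ph|f _ pf|f _ pf|f _ pf|r f _ pf].
- exact: exp_polyZ.
- by under eq_fun do rewrite mulrDl; exact: exp_polyD.
- by under eq_fun do rewrite -mulrA; exact: exp_poly1.
- by under eq_fun do rewrite -mulrA; exact: exp_poly2.
- by under eq_fun do rewrite -mulrA; exact: exp_poly3.
- by under eq_fun do rewrite -mulrA; exact: exp_polyZ.
Qed.

(** The induction runs on expectations of [lap3 i j k * f] for all indices, so that an exponential
    factor of [f] is absorbed into [lap3]. *)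
Lemma cvg_Ex_exp_poly f : exp_poly f -> Ex P (f \o V t) @[t --> +oo] --> Ex Q (f \o W).
Proof.
move=> pf.
suff H : forall i j k, Ex P (fun x => lap3 i j k (V t x) * f (V t x)) @[t --> +oo] -->
    Ex Q (fun x => lap3 i j k (W x) * f (W x)).
  have lap0 : lap3 0 0 0 = fun=> 1.
    by apply/funext => v; rewrite /lap3 !mul0r !addr0 oppr0 expR0.
  have := H 0%N 0%N 0%N; rewrite lap0.
  have E (U : Type) (Y : U -> R * R * R) : (fun x => 1 * f (Y x)) = f \o Y.
    by apply/funext => x; rewrite mul1r.
  by rewrite E; under eq_fun do rewrite E.
have bL dU (U : measurableType dU) (Y : U -> R * R * R) h i j k : random_nonneg3 Y ->
    exp_poly h -> bounded_rv (fun x => lap3 i j k (Y x) * h (Y x)).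
  by move=> rY ph; exact: (exp_poly_rv rY (exp_polyM (lap3_exp_poly i j k) ph)).
elim: pf => {f} [r|f g pf IHf pg IHg|f _ IH|f _ IH|f _ IH|r f pf IH] i j k.
- have -> : Ex Q (fun x => lap3 i j k (W x) * r) = r * Ex Q (lap3 i j k \o W).
    rewrite -ExZ; last exact/exp_poly_rv/lap3_exp_poly.
    by congr (Ex Q _); apply/funext => x; rewrite mulrC.
  apply: (@cvg_near_eq R (fun t => r * Ex P (lap3 i j k \o V t))); last first.
    by apply: cvgM; [exact: cvg_cst|exact: lapV].
  near=> t; rewrite -ExZ; last by apply/exp_poly_rv/lap3_exp_poly; near: t.
  by congr (Ex P _); apply/funext => x; rewrite mulrC.
- have E (U : Type) (Y : U -> R * R * R) : (fun x => lap3 i j k (Y x) * (f (Y x) + g (Y x))) =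
     (fun x => lap3 i j k (Y x) * f (Y x) + lap3 i j k (Y x) * g (Y x)).
    by apply/funext => x; rewrite mulrDr.
  rewrite E ExD; [|exact: bL..].
  apply: (cvg_near_eq _ (cvgD (IHf i j k) (IHg i j k))); near=> t.
  have rt : random_nonneg3 (V t) by near: t.
  by rewrite E ExD//; exact: bL.
- have E (U : Type) (Y : U -> R * R * R) :
      (fun x => lap3 i j k (Y x) * (expR (- (Y x).1.1) * f (Y x))) =
      (fun x => lap3 i.+1 j k (Y x) * f (Y x)).
    by apply/funext => x; rewrite mulrA /lap3 -expRD -natr1; congr (expR _ * _); ring.
  by rewrite E; under eq_fun do rewrite E; exact: IH.
- have E (U : Type) (Y : U -> R * R * R) :
      (fun x => lap3 i j k (Y x) * (expR (- (Y x).1.2) * f (Y x))) =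
      (fun x => lap3 i j.+1 k (Y x) * f (Y x)).
    by apply/funext => x; rewrite mulrA /lap3 -expRD -natr1; congr (expR _ * _); ring.
  by rewrite E; under eq_fun do rewrite E; exact: IH.
- have E (U : Type) (Y : U -> R * R * R) :
      (fun x => lap3 i j k (Y x) * (expR (- (Y x).2) * f (Y x))) =
      (fun x => lap3 i j k.+1 (Y x) * f (Y x)).
    by apply/funext => x; rewrite mulrA /lap3 -expRD -natr1; congr (expR _ * _); ring.
  by rewrite E; under eq_fun do rewrite E; exact: IH.
- have E (U : Type) (Y : U -> R * R * R) : (fun x => lap3 i j k (Y x) * (r * f (Y x))) =
     (fun x => r * (lap3 i j k (Y x) * f (Y x))).
    by apply/funext => x; rewrite mulrCA.
  rewrite E ExZ; last exact: bL.
  apply: (cvg_near_eq _ (cvgM (cvg_cst r) (IH i j k))); near=> t.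
  have rt : random_nonneg3 (V t) by near: t.
  by rewrite E ExZ//; exact: bL.
Unshelve. all: by end_near. Qed.

Lemma cvg_tail3_pointwise v : nonneg3 v -> tail3 m.+1 v @[m --> \oo] --> (0 : R).
Proof.
move=> [w1 w2 w3].
have H (y : R) : 0 <= y -> (1 - expR (- y)) ^+ m.+1 @[m --> \oo] --> (0 : R).
  move=> /expRN_itv/andP[h1 h2]; rewrite (cvg_shiftS (fun m => (1 - expR (- y)) ^+ m)).
  by apply: cvg_expr; rewrite ger0_norm ?subr_ge0// ltrBlDr ltrDl.
have h := cvgD (cvgD (H _ w1) (H _ w2)) (H _ w3).
by rewrite !addr0 in h; exact: h.
Qed.

(** Tightness of the limit. For a fixed [m], [tail3 m.+1] is an exponential polynomial, so its
    expectation under [V t] is eventually small as well. *)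
Lemma cvg_tail3 : Ex Q (tail3 m.+1 \o W) @[m --> \oo] --> (0 : R).
Proof.
rewrite -(Ex_cst Q 0); apply: (@cvg_Ex _ _ _ _ _ _ 3) => [m|m x|x].
- by have [] := exp_poly_rv rW (exp_poly_tail3 m.+1).
- have [_ _ _ /(_ x)[w1 w2 w3]] := rW.
  have H (y : R) : 0 <= y -> 0 <= (1 - expR (- y)) ^+ m.+1 <= 1.
    move=> /expRN_itv/andP[h1 h2]; rewrite exprn_ge0 ?subr_ge0//=.
    by rewrite exprn_ile1 ?subr_ge0// lerBlDr lerDl ltW.
  have := H _ w1; have := H _ w2; have := H _ w3.
  rewrite /tail3 => /andP[a1 a2] /andP[b1 b2] /andP[c1 c2].
  by rewrite ger0_norm ?addr_ge0// (_ : 3 = 1 + 1 + 1) ?lerD//; ring.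
- by apply: cvg_tail3_pointwise; have [] := rW.
Qed.

(** [f] is exchanged for a Bernstein polynomial in the exponentials, at a cost controlled by [tail3]
    under both laws; expectations of such polynomials converge. *)
Theorem laplace_cvg_in_distribution : cvg_in_distribution P Q V W.
Proof.
move=> f cf [M fM].
have M0 : 0 <= M := le_trans (normr_ge0 _) (fM (0, 0, 0)).
pose B n (v : R * R * R) := bern3 n.+1 (expR (- v.1.1)) (expR (- v.1.2)) (expR (- v.2))
        (fun i j k => f (- ln (i%:R / n.+1%:R), - ln (j%:R / n.+1%:R), - ln (k%:R / n.+1%:R))).
have pB n : exp_poly (B n) by exact: exp_poly_bern3.
(* Measurability of [Y] is known by coordinates and [f] is merely continuous; [f \o Y] is measurable
   as a pointwise limit of exponential polynomials in [Y]. *)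
have brv dU (U : measurableType dU) (Y : U -> R * R * R) : random_nonneg3 Y ->
    bounded_rv (f \o Y).
  move=> rY; split; last by exists M => x; exact: fM.
  have tm (m : nat) : 0 < m.+1%:R^-1 :> R by rewrite invr_gt0 ltr0n.
  have [n_ hn] := choice (fun m => bern3_tail_approx m cf fM (tm m)).
  apply: (measurable_fun_cvg (h := fun m x => B (n_ m) (Y x))) => [m|x _].
    by have [] := exp_poly_rv rY (pB (n_ m)).
  have [_ _ _ /(_ x) Yx] := rY.
  have h : (m.+1%:R^-1 + 4 * M * tail3 m.+1 (Y x)) @[m --> \oo] --> (0 : R).
    have -> : 0 = 0 + 4 * M * 0 :> R by rewrite mulr0 addr0.
    apply: cvgD; first exact: cvg_harmonic.
    by apply: cvgM; [exact: cvg_cst|exact: cvg_tail3_pointwise].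
  apply/cvgrPdist_le => e e0.
  have /cvgrPdist_le /(_ _ e0) [N _ hN] := h; exists N => // m Nm.
  rewrite distrC; apply: le_trans (hn m _ Yx) _; apply: le_trans (ler_norm _) _.
  by have := hN m Nm; rewrite /= sub0r normrN.
suff : Ex P (f \o V t) @[t --> +oo] --> Ex Q (f \o W).
  move=> h; rewrite expectation_Ex; last exact: brv.
  have h' : (Ex P (f \o V t))%:E @[t --> +oo] --> (Ex Q (f \o W))%:E.
    by apply: cvg_EFin => //; exact: nearW.
  apply: cvg_trans h'; apply: near_eq_cvg; near=> t.
  by rewrite expectation_Ex//; apply: brv; near: t.
apply/cvgrPdist_le => e e0.
have e8 : 0 < e / 8 by rewrite divr_gt0.
(* First [m] for the tail, then [n] for the approximation. The total is at most [3e/8] under [V t],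
   [e/4] under [W] and [e/8] between the polynomials. *)
have [m hm] : exists m, 4 * M * Ex Q (tail3 m.+1 \o W) <= e / 8.
  have h : (4 * M * Ex Q (tail3 m.+1 \o W)) @[m --> \oo] --> (0 : R).
    have -> : 0 = 4 * M * 0 :> R by rewrite mulr0.
    by apply: cvgM; [exact: cvg_cst|exact: cvg_tail3].
  have /cvgrPdist_le /(_ _ e8) [m _ /(_ m (leqnn m))] := h.
  by rewrite /= sub0r normrN => hm; exists m; exact: le_trans (ler_norm _) hm.
have [n hn] := bern3_tail_approx m cf fM e8.
have bnd dU (U : measurableType dU) (K : probability U R) (Y : U -> R * R * R) :
    random_nonneg3 Y ->
    `|Ex K (f \o Y) - Ex K (B n \o Y)| <= e / 8 + 4 * M * Ex K (tail3 m.+1 \o Y).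
  move=> rY; have bt := exp_poly_rv rY (exp_poly_tail3 m.+1).
  have bc (r : R) : bounded_rv (fun=> r : R) := @bounded_rv_cst R _ U r.
  rewrite -(ExZ K _ bt) -(Ex_cst K (e / 8)) -ExD//; last exact: bounded_rvM.
  apply: normr_ExB; [exact: brv|exact: exp_poly_rv|by apply: bounded_rvD => //; exact: bounded_rvM|].
  by move=> x; rewrite distrC; apply: hn; have [] := rY.
have h1 := cvg_Ex_exp_poly (pB n); have h2 := cvg_Ex_exp_poly (exp_poly_tail3 m.+1).
have {}h2 : (4 * M * Ex P (tail3 m.+1 \o V t)) @[t --> +oo] -->
    4 * M * Ex Q (tail3 m.+1 \o W).
  by apply: cvgM; [exact: cvg_cst|exact: h2].
near=> t.
have rt : random_nonneg3 (V t) by near: t.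
have a1 := bnd _ _ P _ rt; have a2 := bnd _ _ Q _ rW.
have a3 : `|Ex Q (B n \o W) - Ex P (B n \o V t)| <= e / 8.
  by near: t; exact: (cvgrPdist_le _ _).1.
have a4 : `|4 * M * Ex Q (tail3 m.+1 \o W) - 4 * M * Ex P (tail3 m.+1 \o V t)| <= e / 8.
  by near: t; exact: (cvgrPdist_le _ _).1.
move: a1 a2 a3 a4 hm; rewrite !ler_norml => /andP[? ?] /andP[? ?] /andP[? ?] /andP[? ?] ?.
apply/andP; split; lra.
Unshelve. all: by end_near. Qed.

End Cvg.
End LaplaceContinuity.

(** * Tail formulas *)

Section TailFormula.
Context {R : realType}.
Local Notation mu := (@lebesgue_measure R).

(** Tonelli's theorem on the region [v < Z x]. With weight 1 under a probability it yields tail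
    formulas for expectations; with [m] Lebesgue measure it integrates against a Lévy density. *)
Lemma integral_weight_tail {d} {T : measurableType d}
    (m : {sigma_finite_measure set T -> \bar R}) (w Z : T -> R) (f : R -> R) :
  measurable_fun setT w -> measurable_fun setT Z -> measurable_fun setT f ->
  (forall x, 0 <= w x) -> (forall v, 0 <= f v) ->
  (\int[m]_x ((w x)%:E * \int[mu]_(v in `]0%R, +oo[) (f v * (v < Z x)%R%:R)%:E) =
   \int[mu]_(v in `]0%R, +oo[) ((f v)%:E * \int[m]_x (w x * (v < Z x)%R%:R)%:E))%E.
Proof.
move=> mw mZ mf w0 f0.
pose D : set R := `]0%R, +oo[%classic.
have mD : measurable D by exact: measurable_itv.
pose k (z : T * R) : \bar R := (w z.1 * (\1_D z.2 * f z.2 * (z.2 < Z z.1)%R%:R))%:E.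
have mlt : measurable_fun setT (fun z : T * R => (z.2 < Z z.1)%R%:R : R).
  have -> : (fun z : T * R => (z.2 < Z z.1)%R%:R : R) = \1_[set z | z.2 < Z z.1].
    apply/funext => z; rewrite indicE; congr (nat_of_bool _)%:R.
    by apply/idP/idP => [h|/set_mem//]; exact/mem_set.
  apply: measurable_indic; rewrite -[X in measurable X]setTI.
  apply: (measurable_fun_ltr _ _ measurableT (Y := [set true])) => //.
  exact: measurableT_comp.
have mk : measurable_fun setT k.
  apply/measurable_EFinP; apply: measurable_funM; first exact: measurableT_comp.
  apply: measurable_funM => //; apply: measurable_funM; last exact: measurableT_comp.
  have m1 : measurable_fun setT (\1_D : R -> R) by exact: measurable_indic.
  exact: (measurableT_comp m1 measurable_snd).
have k0 z : (0 <= k z)%E by rewrite lee_fin !mulr_ge0.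
have mx x : measurable_fun setT (fun v : R => (v < Z x)%R%:R : R).
  have -> : (fun v : R => (v < Z x)%R%:R : R) = \1_`]-oo, Z x[.
    by apply/funext => v; rewrite indicE; congr (nat_of_bool _)%:R; rewrite mem_setE in_itv/=.
  exact: measurable_indic.
have mv v : measurable_fun setT (fun x : T => (v < Z x)%R%:R : R).
  have -> : (fun x : T => (v < Z x)%R%:R : R) = \1_[set x | v < Z x].
    apply/funext => x; rewrite indicE; congr (nat_of_bool _)%:R.
    by apply/idP/idP => [h|/set_mem//]; exact/mem_set.
  apply: measurable_indic; rewrite -[X in measurable X]setTI.
  exact: (measurable_fun_ltr _ _ measurableT (Y := [set true])).
transitivity (\int[m]_x \int[mu]_v k (x, v))%E.
  apply: eq_integral => x _; rewrite -ge0_integralZl//=.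
  - rewrite integral_mkcond; apply: eq_integral => v _; rewrite /k/= -/D epatch_indic.
    by rewrite -!EFinM; congr EFin; rewrite -mulrA; ring.
  - by apply/measurable_EFinP/measurable_funTS; exact: (measurable_funM mf (mx x)).
  - by move=> v _; rewrite lee_fin mulr_ge0.
  - by rewrite lee_fin.
transitivity (\int[mu]_v \int[m]_x k (x, v))%E; first exact: (@fubini_tonelli _ _ _ _ _ m mu k mk k0).
rewrite [RHS]integral_mkcond; apply: eq_integral => v _ /=.
rewrite epatch_indic muleAC -EFinM -ge0_integralZl//=.
- by apply: eq_integral => x _; rewrite /k/= -EFinM; congr EFin; ring.
- by apply/measurable_EFinP; exact: (measurable_funM mw (mv v)).
- by move=> x _; rewrite lee_fin mulr_ge0.
- by rewrite lee_fin mulr_ge0.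
Qed.

Lemma integral_expR_itv (u z : R) : 0 <= u -> 0 <= z ->
  (\int[mu]_(v in `]0%R, +oo[) (u * expR (- (u * v)) * (v < z)%R%:R)%:E =
   (1 - expR (- (u * z)))%:E)%E.
Proof.
move=> u0; rewrite le_eqVlt => /predU1P[<-|z0].
  rewrite mulr0 oppr0 expR0 subrr integral0_eq// => v.
  by rewrite /= in_itv/= andbT => v0; rewrite ltNge ltW// mulr0.
have -> : (\int[mu]_(v in `]0%R, +oo[) (u * expR (- (u * v)) * (v < z)%R%:R)%:E =
  \int[mu]_(v in `]0%R, z[) (u * expR (- (u * v)))%:E)%E.
  rewrite integral_mkcond [RHS]integral_mkcond; apply: eq_integral => v _.
  rewrite !epatch_indic/= !indicE !mem_setE !in_itv/= andbT.
  by case: (0 < v) (v < z) => [] []; rewrite ?mulr1 ?mulr0 ?mule0 ?mule1.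
have dF (v : R) : is_derive v 1 (fun v => - expR (- (u * v))) (u * expR (- (u * v))).
  have h1 : is_derive v 1 (fun v : R => - (u * v)) (- u).
    apply: is_deriveN; have h := is_deriveZ u (is_derive_id v (1 : R)).
    by apply: is_derive_eq h _; exact: mulr1.
  have h2 := is_deriveN (@is_derive1_comp _ expR (fun v => - (u * v)) v _ _
    (is_derive_expR (- (u * v))) h1).
  by apply: is_derive_eq h2 _; rewrite mulrN opprK mulrC.
have ce : continuous (fun v : R => u * expR (- (u * v))).
  move=> v; apply: cvgM; first exact: cvg_cst.
  apply: continuous_comp; last exact: continuous_expR.
  by apply: cvgN; apply: cvgM; [exact: cvg_cst|exact: cvg_id].
have cF : continuous (fun v : R => - expR (- (u * v))).
  move=> v; apply: cvgN.
  apply: continuous_comp; last exact: continuous_expR.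
  by apply: cvgN; apply: cvgM; [exact: cvg_cst|exact: cvg_id].
transitivity (\int[mu]_(v in `[0%R, z]) (u * expR (- (u * v)))%:E)%E.
  apply/esym/integral_itv_bndoo/measurable_EFinP/measurable_funTS.
  exact: continuous_measurable_fun.
rewrite (@continuous_FTC2 _ _ (fun v => - expR (- (u * v))))//.
- by rewrite -EFinB mulr0 oppr0 expR0; congr EFin; ring.
- exact: continuous_subspaceT.
- split=> [v _||]; first exact: ex_derive.
  + by apply/cvg_at_right_filter; exact: cF.
  + by apply/cvg_at_left_filter; exact: cF.
- by move=> v _; rewrite derive1E; exact: derive_val.
Qed.

Lemma integral_min_itv (z : R) : 0 <= z ->
  (\int[mu]_(v in `]0%R, +oo[) (\1_`]0%R, 1[ v * (v < z)%R%:R)%:E =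
   (Num.min z 1)%:E)%E.
Proof.
move=> z0; pose y := Num.min z 1.
have -> : (\int[mu]_(v in `]0%R, +oo[) (\1_`]0%R, 1[ v * (v < z)%R%:R)%:E =
  \int[mu]_(v in `]0%R, y[) 1)%E.
  rewrite integral_mkcond [RHS]integral_mkcond; apply: eq_integral => v _.
  rewrite !epatch_indic/= !indicE !mem_setE !in_itv/= andbT mul1e /y lt_min.
  case: (0 < v) (v < z) (v < 1) => [] [] []; rewrite ?mulr1 ?mulr0 ?mule0 ?mule1 ?mul0r//.
rewrite integral_cst//= mul1e lebesgue_measure_itv/= lte_fin.
have : 0 <= y by rewrite /y le_min z0 ler01.
rewrite -/y; move: y => y; rewrite le_eqVlt => /predU1P[<-|->]; first by rewrite ltxx.
by rewrite oppr0 adde0.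
Qed.

Section Probability.
Context {d : measure_display} {T : measurableType d}.
Variables (P : probability T R) (Z : T -> R).
Hypotheses (mZ : measurable_fun setT Z) (Z0 : forall x, 0 <= Z x).

Lemma measurable_gt_rv v : measurable [set x | v < Z x].
Proof.
rewrite -[X in measurable X]setTI.
exact: (measurable_fun_ltr _ _ measurableT (Y := [set true])).
Qed.

(** Layer-cake formula: on the nonnegative half-line [g] is the primitive of [f] vanishing at 0. *)
Lemma Ex_tail (f g : R -> R) : measurable_fun setT f -> (forall v, 0 <= f v) ->
  (forall z : R, 0 <= z ->
    (\int[mu]_(v in `]0%R, +oo[) (f v * (v < z)%R%:R)%:E = (g z)%:E)%E) ->
  bounded_rv (g \o Z) ->
  (Ex P (g \o Z))%:E =
  (\int[mu]_(v in `]0%R, +oo[) (f v * Pr P [set x | v < Z x])%:E)%E.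
Proof.
move=> mf f0 fg bg.
have := @integral_weight_tail _ T P (fun=> 1) Z f (measurable_cst _) mZ mf
  (fun=> ler01) f0.
under eq_integral do rewrite mul1e fg//.
rewrite -(expectation_Ex P bg) unlock => ->.
apply: eq_integral => v _; rewrite EFinM; congr (_ * _)%E.
rewrite -Ex_indic; last exact: measurable_gt_rv.
rewrite -expectation_Ex; last exact/bounded_rv_indic/measurable_gt_rv.
rewrite unlock; apply: eq_integral => x _; rewrite mul1r indicE.
congr (nat_of_bool _)%:R%:E.
by apply/idP/idP => [h|/set_mem//]; exact/mem_set.
Qed.

Lemma laplace_tail (u : R) : 0 <= u ->
  (1 - Ex P (fun x => expR (- (u * Z x))))%:E =
  (\int[mu]_(v in `]0%R, +oo[) (u * expR (- (u * v)) * Pr P [set x | v < Z x])%:E)%E.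
Proof.
move=> u0.
have mfe : measurable_fun setT (fun v : R => expR (- (u * v))).
  apply: (measurableT_comp (@measurable_expR R)).
  by apply: measurable_funN; exact: measurable_funM.
have be : bounded_rv (fun x => expR (- (u * Z x))).
  apply: bounded_rv_unit => [|x]; first exact: (measurableT_comp mfe mZ).
  by rewrite expR_ge0 -expR0 ler_expR oppr_le0 mulr_ge0.
rewrite -(@Ex_tail _ (fun z => 1 - expR (- (u * z)))).
- by rewrite ExB ?Ex_cst//; exact: bounded_rv_cst.
- exact: measurable_funM.
- by move=> v; rewrite mulr_ge0// expR_ge0.
- by move=> z z0; exact: integral_expR_itv.
- by apply: bounded_rvB => //; exact: bounded_rv_cst.
Qed.

Lemma min_tail :
  (Ex P (fun x => Num.min (Z x) 1))%:E =
  (\int[mu]_(v in `]0%R, +oo[) (\1_`]0%R, 1[ v * Pr P [set x | v < Z x])%:E)%E.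
Proof.
rewrite -(@Ex_tail _ (fun z => Num.min z 1))//.
- exact: integral_min_itv.
- apply: bounded_rv_unit; first by apply: measurable_minr.
  by move=> x; rewrite le_min Z0 ler01 ge_min lexx orbT.
Qed.

End Probability.

Lemma cvg_powR_natinv (a : R) : 0 < a -> (n.+2%:R^-1) `^ a @[n --> \oo] --> (0 : R).
Proof.
move=> a0; have h := powR_cvg0 a0.
have h2 : (n.+2%:R^-1 : R) @[n --> \oo] --> (0:R).
  by rewrite (cvg_shiftS (@harmonic R)); exact: cvg_harmonic.
have /cvg_at_rightP/(_ (fun n => n.+2%:R^-1)) := h.
by apply; split => // n; rewrite invr_gt0.
Qed.

Lemma integral_powRN (b : R) : b < 1 ->
  (\int[mu]_(v in `]0%R, +oo[) (\1_`]0%R, 1[ v * v `^ (- b))%:E = ((1 - b)^-1)%:E)%E.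
Proof.
move=> b1; have b0 : 0 < 1 - b by rewrite subr_gt0.
pose G (v : R) := (1 - b)^-1 * v `^ (1 - b).
have dG (v : R) : 0 < v -> is_derive v 1 G (v `^ (- b)).
  move=> v0; have h := is_deriveZ (1 - b)^-1 (is_derive1_powR (1 - b) v0).
  apply: is_derive_eq h _; rewrite /GRing.scale/= mulrA mulVf ?gt_eqF// mul1r.
  by congr (_ `^ _); ring.
have mp : measurable_fun setT (fun v : R => v `^ (- b)) by exact: measurable_powR.
(* The integrand may be singular at 0, hence the exhaustion from the right; [n.+2] keeps every
   interval nondegenerate. *)
pose F n : set R := `[n.+2%:R^-1, 1]%classic.
have FE : \bigcup_n F n = `]0%R, 1%R]%classic.
  apply/seteqP; split => v.
    move=> [n _]; rewrite /F/= !in_itv/= => /andP[h ->]; rewrite andbT.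
    by apply: lt_le_trans h; rewrite invr_gt0.
  rewrite /= in_itv/= => /andP[v0 v1]; exists (Num.truncn v^-1) => //.
  rewrite /F /= in_itv/= v1 andbT -[leRHS]invrK lef_pV2 ?posrE ?invr_gt0//.
  by apply: ltW; apply: lt_trans (truncnS_gt _) _; rewrite ltr_nat.
have IF n : (\int[mu]_(v in F n) (v `^ (- b))%:E =
    ((1 - b)^-1 * (1 - n.+2%:R^-1 `^ (1 - b)))%:E)%E.
  have n1 : n.+2%:R^-1 < 1 :> R by rewrite invf_lt1// ltr1n.
  have np : 0 < n.+2%:R^-1 :> R by rewrite invr_gt0.
  have cd (f f' : R -> R) (v : R) : is_derive v 1 f (f' v) -> {for v, continuous f}.
    by move=> h; apply/differentiable_continuous/derivable1_diffP; exact: ex_derive.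
  rewrite /F (@continuous_FTC2 _ _ G)//.
  - by rewrite -EFinB /G powR1 mulrBr mulr1.
  - apply: continuous_in_subspaceT => v; rewrite inE/= in_itv/= => /andP[vn _].
    apply: (cd _ (fun v => - b * v `^ (- b - 1))).
    exact/is_derive1_powR/(lt_le_trans np).
  - split=> [v||].
    + by rewrite in_itv/= => /andP[h _]; have dGv := dG v (lt_trans np h); exact: ex_derive.
    + by apply/cvg_at_right_filter/(cd _ (fun v => v `^ (- b)))/dG.
    + by apply/cvg_at_left_filter/(cd _ (fun v => v `^ (- b)))/dG.
  - move=> v; rewrite in_itv/= => /andP[h _]; rewrite derive1E.
    by have dGv := dG v (lt_trans np h); exact: derive_val.
have <- : (\int[mu]_(v in `]0%R, 1%R]) (v `^ (- b))%:E =
  \int[mu]_(v in `]0%R, +oo[) (\1_`]0%R, 1[ v * v `^ (- b))%:E)%E.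
  rewrite (@integral_itv_bndoo _ 0 1 _ false false); last first.
    by apply/measurable_EFinP/measurable_funTS.
  rewrite integral_mkcond [RHS]integral_mkcond; apply: eq_integral => v _.
  rewrite !epatch_indic/= !indicE !mem_setE !in_itv/= andbT.
  by case: (0 < v) (v < 1) => [] []; rewrite ?mul1r ?mul0r ?mule1 ?mule0.
have h1 : (\int[mu]_(v in F n) (v `^ (- b))%:E @[n --> \oo] -->
    \int[mu]_(v in \bigcup_n F n) (v `^ (- b))%:E)%E.
  apply: ge0_nondecreasing_set_cvg_integral => //.
  - apply/nondecreasing_seqP => n; rewrite subsetEset => v; rewrite /F/= !in_itv/=.
    move=> /andP[h ->]; rewrite andbT; apply: le_trans h.
    by rewrite lef_pV2 ?posrE// ler_nat.
  - by move=> n; exact: measurable_itv.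
  - by move=> n; apply/measurable_EFinP/measurable_funTS.
  - by move=> n v _; rewrite lee_fin powR_ge0.
have h2 : (((1 - b)^-1 * (1 - n.+2%:R^-1 `^ (1 - b)))%:E @[n --> \oo] -->
    ((1 - b)^-1)%:E)%E.
  apply: cvg_EFin; first exact: nearW.
  have {2}-> : (1 - b)^-1 = (1 - b)^-1 * (1 - 0) by rewrite subr0 mulr1.
  apply: cvgM; first exact: cvg_cst.
  by apply: cvgB; [exact: cvg_cst|exact: cvg_powR_natinv].
rewrite -(funext IF) in h2; rewrite -FE.
exact: cvg_unique h1 h2.
Qed.

Lemma cvg_powRN_pinfty (a : R) : 0 < a -> x `^ (- a) @[x --> +oo] --> (0 : R).
Proof.
move=> a0; apply/cvgrPdist_le => e e0.
pose K := e `^ (- a^-1); have K0 : 0 < K by rewrite powR_gt0.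
near=> x; have Kx : K <= x by near: x; exact/nbhs_pinfty_ge/num_real.
have x0 : 0 < x := lt_le_trans K0 Kx.
rewrite sub0r normrN ger0_norm ?powR_ge0// powRN -[leRHS]invrK.
rewrite lef_pV2 ?posrE ?invr_gt0 ?powR_gt0//.
have -> : e^-1 = K `^ a.
  by rewrite /K -powRrM mulNr mulVf ?gt_eqF// powR_inv1// ltW.
by apply: ge0_ler_powR; rewrite ?nnegrE// ltW.
Unshelve. all: by end_near. Qed.

Lemma integral_powRN_tail (a v : R) : 0 < a -> 0 < v ->
  (\int[mu]_(x in `]v, +oo[) (a * x `^ (- (1 + a)))%:E = (v `^ (- a))%:E)%E.
Proof.
move=> a0 v0; have cd (f f' : R -> R) (x : R) : is_derive x 1 f (f' x) -> {for x, continuous f}.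
  by move=> h; apply/differentiable_continuous/derivable1_diffP; exact: ex_derive.
have dG (x : R) : 0 < x -> is_derive x 1 (fun x => - x `^ (- a)) (a * x `^ (- (1 + a))).
  move=> x0; have h := is_deriveN (is_derive1_powR (- a) x0).
  by apply: is_derive_eq h _; rewrite mulNr opprK; congr (_ * _ `^ _); ring.
have mp : measurable_fun setT (fun x : R => a * x `^ (- (1 + a))).
  by apply: measurable_funM => //; exact: measurable_powR.
rewrite integral_itv_obnd_cbnd; last by apply/measurable_EFinP/measurable_funTS.
rewrite (@ge0_continuous_FTC2y _ _ (fun x => - x `^ (- a)) v 0).
- by rewrite sub0e EFinN oppeK.
- by move=> x _; rewrite mulr_ge0 ?powR_ge0// ltW.
- apply: continuous_in_subspaceT => x; rewrite inE/= in_itv/= andbT => vx.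
  have h : {for x, continuous (fun x : R => x `^ (- (1 + a)))}.
    apply: (cd _ (fun v => - (1 + a) * v `^ (- (1 + a) - 1))).
    exact/is_derive1_powR/(lt_le_trans v0).
  by apply: cvgM; [exact: cvg_cst|exact: h].
- rewrite -oppr0; apply: cvgN.
  exact: cvg_powRN_pinfty.
- by move=> x vx; have dx := dG x (lt_trans v0 vx); exact: ex_derive.
- by apply/cvg_at_right_filter; exact: (cd (fun x => - x `^ (- a)) (fun x => a * x `^ (- (1 + a))) v (dG v v0)).
- move=> x; rewrite in_itv/= andbT => vx; rewrite derive1E.
  by have dx := dG x (lt_trans v0 vx); exact: derive_val.
Qed.

(** Integration by parts in the form of Tonelli's theorem, as $v^{-\alpha}$ is the tail of the
    density $\alpha x^{-1-\alpha}$. It brings the limits obtained from tails into the form of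
    [stable_exponent]. *)
Lemma stable_exponent_tail (alpha u : R) : 0 < alpha -> 0 <= u ->
  (\int[mu]_(v in `]0%R, +oo[) (u * expR (- (u * v)) * v `^ (- alpha))%:E =
   alpha%:E * \int[mu]_(x in `]0%R, +oo[) ((1 - expR (- (u * x))) / x `^ (1 + alpha))%:E)%E.
Proof.
move=> a0 u0; pose f v := u * expR (- (u * v)).
pose w x : R := \1_`]0, +oo[ x * (alpha * x `^ (- (1 + alpha))).
have mf : measurable_fun setT f.
  apply: measurable_funM => //; apply: (measurableT_comp (@measurable_expR R)).
  by apply: measurable_funN; exact: measurable_funM.
have f0 v : 0 <= f v by rewrite /f mulr_ge0 ?expR_ge0.
have mp : measurable_fun setT (fun x : R => x `^ (- (1 + alpha))) by exact: measurable_powR.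
have mw : measurable_fun setT w.
  apply: measurable_funM; first exact: measurable_indic.
  exact: measurable_funM.
have w0 x : 0 <= w x by rewrite /w !mulr_ge0 ?powR_ge0 ?(ltW a0)// indicE.
have H := @integral_weight_tail _ _ mu w id f mw (@measurable_id _ _ _) mf w0 f0.
transitivity (\int[mu]_(v in `]0%R, +oo[) ((f v)%:E * \int[mu]_x (w x * (v < x)%R%:R)%:E))%E.
  apply: eq_integral => v; rewrite inE/= in_itv/= andbT => v0.
  rewrite EFinM -(integral_powRN_tail a0 v0); congr (_ * _)%E.
  rewrite integral_mkcond; apply: eq_integral => x _.
  rewrite epatch_indic/= -EFinM /w !indicE !mem_setE !in_itv/= !andbT.
  have [vx|_] := ltP v x; last by rewrite !mulr0.
  by rewrite (lt_trans v0 vx) mul1r.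
rewrite -H -ge0_integralZl; [|exact: measurable_itv| | |].
- rewrite [RHS]integral_mkcond; apply: eq_integral => x _.
  rewrite epatch_indic/= /w indicE mem_setE in_itv/= andbT.
  have [x0|_] := ltP 0 x; last by rewrite mul0r mul0e mule0.
  rewrite mul1r mule1 integral_expR_itv// ?ltW// -!EFinM powRN; congr EFin; ring.
- apply/measurable_EFinP/measurable_funTS; apply: measurable_funM.
    apply: measurable_funB => //; apply: (measurableT_comp (@measurable_expR R)).
    by apply: measurable_funN; exact: measurable_funM.
  by under eq_fun do rewrite -powRN.
- move=> x; rewrite /= in_itv/= andbT => x0; rewrite lee_fin divr_ge0 ?powR_ge0//.
  by rewrite subr_ge0 -expR0 ler_expR oppr_le0 mulr_ge0// ltW.
- by rewrite lee_fin ltW.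
Qed.

End TailFormula.

(** * Regularly varying tails *)

Section RegularVariation.
Context {R : realType}.
Local Notation mu := (@lebesgue_measure R).
Variables (alpha : R) (Fb : R -> R).
Hypothesis alpha01 : 0 < alpha < 1.
Hypothesis Fb_gt0 : forall x, 0 < Fb x.
Hypothesis Fb_le1 : forall x, Fb x <= 1.
Hypothesis Fb_anti : forall x y, x <= y -> Fb y <= Fb x.
Hypothesis Fb_rv : forall a : R, 0 < a ->
  Fb (a * x) / Fb x @[x --> +oo] --> a `^ (- alpha).

(** Far out, halving the argument multiplies [Fb] by at most $2^\beta$, since the limiting ratio is
    $2^\alpha$; [eta] is reached by repeated halving. Where [x * eta] falls below the threshold
    [x0], the bound [Fb <= 1] takes over and [C] absorbs [1 / Fb x0]. *)
Lemma potter (beta : R) : alpha < beta ->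
  exists C X0 : R, [/\ 0 < C, 0 < X0 & forall x eta, X0 <= x -> 0 < eta <= 1 ->
    Fb (x * eta) <= C * eta `^ (- beta) * Fb x].
Proof.
move=> ab; have /andP[a0 a1] := alpha01.
have b0 : 0 < beta := lt_trans a0 ab.
have h2 : 2^-1 `^ (- alpha) < 2 `^ beta :> R.
  rewrite /powR invr_eq0 pnatr_eq0/= lnV ?posrE// mulrNN ltr_expR ltr_pM2r//.
  by rewrite ln_gt0// ltr1n.
have [K [Kr hK]] : \forall x \near +oo, Fb (2^-1 * x) / Fb x < 2 `^ beta.
  by have := cvgr_lt _ (Fb_rv (a := 2^-1) _); apply => //; rewrite invr_gt0.
pose x0 := Num.max 1 (K + 1).
have x0_gt0 : 0 < x0 by rewrite /x0 lt_max ltr01.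
have step y : x0 <= y -> Fb y <= 2 `^ beta * Fb (2 * y).
  move=> xy; have y0 : 0 < y := lt_le_trans x0_gt0 xy.
  have := hK (2 * y); rewrite mulrA mulVf ?pnatr_eq0// mul1r ltr_pdivrMr// => h.
  apply/ltW/h; have : K + 1 <= x0 by rewrite /x0 le_max lexx orbT.
  lra.
have iter k y : x0 <= y -> Fb y <= (2 `^ beta) ^+ k * Fb (2 ^+ k * y).
  elim: k y => [|k IH] y xy; first by rewrite !expr0 !mul1r.
  apply: le_trans (step _ xy) _; rewrite exprS -mulrA ler_pM2l ?powR_gt0//.
  rewrite [2 ^+ k.+1]exprSr -mulrA; apply: IH.
  by have y0 := lt_le_trans x0_gt0 xy; lra.
have main x eta : x0 <= x * eta -> 0 < eta <= 1 ->
    Fb (x * eta) <= 2 `^ beta * eta `^ (- beta) * Fb x.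
  move=> xe /andP[e0 e1].
  have xpos : 0 < x by rewrite -(pmulr_lgt0 _ e0) (lt_le_trans x0_gt0).
  have ex : exists k, 1 <= 2 ^+ k * eta.
    exists (Num.truncn eta^-1).+1; rewrite -ler_pdivrMr// div1r.
    apply: le_trans (ltW (truncnS_gt _)) _.
    by rewrite -natrX ler_nat ltnW// ltn_expl.
  (* By minimality $1 \le 2^k\eta \le 2$, hence $(2^\beta)^k \le 2^\beta\eta^{-\beta}$. *)
  pose k := ex_minn ex.
  have k1 : 1 <= 2 ^+ k * eta by rewrite /k; case: ex_minnP.
  have k2 : 2 ^+ k * eta <= 2.
    rewrite /k; case: ex_minnP => -[|n] _ hn; first by rewrite expr0 mul1r (le_trans e1)// ler1n.
    rewrite exprS -mulrA ger_pMr//; rewrite leNgt; apply/negP => /ltW/hn.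
    by rewrite ltnn.
  apply: le_trans (iter k _ xe) _; apply: ler_pM => //.
  - exact: ltW.
  - rewrite -powR_mulrn ?powR_ge0// -powRrM mulrC powRrM powR_mulrn//.
    rewrite powRN -ler_pdivrMr ?invr_gt0 ?powR_gt0// invrK -powRM ?exprn_ge0// ?(ltW e0)//.
    by apply: ge0_ler_powR; rewrite ?nnegrE ?mulr_ge0 ?exprn_ge0// ltW.
  - by apply: Fb_anti; rewrite mulrCA ler_peMr// ltW.
pose C := 2 `^ beta / Fb x0.
have C0 : 0 < C by rewrite divr_gt0 ?powR_gt0.
exists C, x0; split=> // x eta xx0 e01; have /andP[e0 e1] := e01.
have xpos : 0 < x := lt_le_trans x0_gt0 xx0.
have [xe|xe] := leP x0 (x * eta).
  apply: le_trans (main _ _ xe e01) _; rewrite ler_pM2r// ler_pM2r ?powR_gt0//.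
  by rewrite /C ler_pdivlMr// ler_piMr// powR_ge0.
(* With this ratio [x * eta'] is the threshold, and [main] bounds [Fb x] from below; moreover
   [eta <= eta']. *)
pose eta' := x0 / x.
have e' : 0 < eta' <= 1 by rewrite divr_gt0//= ler_pdivrMr// mul1r.
have := main x eta' _ e'; rewrite /eta' mulrC divfK ?gt_eqF// => /(_ (lexx _)) h.
apply: le_trans (Fb_le1 _) _; rewrite /C -mulrA mulrAC ler_pdivlMr// mul1r.
apply: le_trans h _; rewrite -mulrA ler_pM2l ?powR_gt0// ler_pM2r//.
rewrite !powRN lef_pV2 ?posrE ?powR_gt0 ?divr_gt0//.
apply: ge0_ler_powR; rewrite ?nnegrE ?divr_ge0 ?(ltW b0) ?(ltW e0) ?(ltW x0_gt0) ?(ltW xpos)//.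
by rewrite ler_pdivlMr// mulrC ltW.
Qed.

Lemma measurable_Fb : measurable_fun setT Fb.
Proof. by apply: nonincreasing_measurable => // x y _ _; exact: Fb_anti. Qed.

Section Integral.
Variables (f : R -> R) (M : R).
Hypotheses (mf : measurable_fun setT f) (f0 : forall v, 0 <= f v <= M).
Hypothesis intf : (\int[mu]_(v in `]0%R, +oo[) (f v)%:E < +oo)%E.

(** Dominated convergence: [Fb (x * v) / Fb x] tends to $v^{-\alpha}$, is at most 1 for $v \ge 1$ by
    monotonicity, and for $v < 1$ is at most $Cv^{-\beta}$ by Potter's bound. The midpoint [beta] of
    [alpha] and 1 makes the latter integrable at 0. *)
Lemma cvg_rv_integral (H : R -> R) :
  (\forall x \near +oo, (H x)%:E = (\int[mu]_(v in `]0%R, +oo[) (f v * Fb (x * v))%:E)%E) ->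
  (\int[mu]_(v in `]0%R, +oo[) (f v * v `^ (- alpha))%:E < +oo)%E /\
  H x / Fb x @[x --> +oo] -->
    fine (\int[mu]_(v in `]0%R, +oo[) (f v * v `^ (- alpha))%:E)%E.
Proof.
have /andP[a0 a1] := alpha01 => HE.
have M0 : 0 <= M by have /andP[h1 h2] := f0 0; exact: le_trans h2.
pose beta := (alpha + 1) / 2.
have ab : alpha < beta by rewrite /beta; lra.
have b1 : beta < 1 by rewrite /beta; lra.
have [C [X0 [C0 X00 hC]]] := potter ab.
have HEX : \forall x \near +oo, X0 <= x /\ (H x)%:E = (\int[mu]_(v in `]0%R, +oo[) (f v * Fb (x * v))%:E)%E.
  near=> x; split; last by near: x.
  by near: x; exact/nbhs_pinfty_ge/num_real.
pose D : set R := `]0%R, +oo[%classic.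
have mD : measurable D by exact: measurable_itv.
pose g v : R := M * C * (\1_`]0%R, 1[ v * v `^ (- beta)) + f v.
have mpow b : measurable_fun setT (fun v : R => v `^ b) by exact: measurable_powR.
have mg1 : measurable_fun setT (fun v : R => \1_`]0%R, 1[ v * v `^ (- beta)).
  by apply: measurable_funM => //; exact: measurable_indic.
have ig1 : mu.-integrable D (fun v => (\1_`]0%R, 1[ v * v `^ (- beta))%:E).
  apply/integrableP; split; first by apply/measurable_EFinP/measurable_funTS.
  under eq_integral do rewrite gee0_abs ?lee_fin ?mulr_ge0 ?powR_ge0// ?indicE//.
  by under eq_integral do rewrite -indicE; rewrite integral_powRN// ltry.
have iff : mu.-integrable D (EFin \o f).
  apply/integrableP; split; first by apply/measurable_EFinP/measurable_funTS.
  under eq_integral => v _ do rewrite gee0_abs ?lee_fin ?(proj1 (andP (f0 v)))//.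
  exact: intf.
have ig : mu.-integrable D (EFin \o g).
  have igZ : mu.-integrable D (fun v => (M * C)%:E * (\1_`]0%R, 1[ v * v `^ (- beta))%:E)%E.
    exact: integrableZl.
  have igD : mu.-integrable D ((fun v => (M * C)%:E * (\1_`]0%R, 1[ v * v `^ (- beta))%:E)
      \+ (EFin \o f))%E by exact: integrableD.
  by apply: eq_integrable igD => // v _; rewrite /g /= EFinD EFinM.
(* The limit is taken along sequences. Domination must hold at every index, so the first [n0] terms
   are dropped. *)
have key (u : nat -> R) : u n @[n --> \oo] --> +oo ->
   (\int[mu]_(v in D) (f v * v `^ (- alpha))%:E < +oo)%E /\
   H (u n) / Fb (u n) @[n --> \oo] -->
    fine (\int[mu]_(v in D) (f v * v `^ (- alpha))%:E)%E.
  move=> uy; have [n0 _ hn0] := uy _ HEX.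
  pose f_ n v := (f v * (Fb (u (n + n0)%N * v) / Fb (u (n + n0)%N)))%:E.
  have mFu n : measurable_fun setT (fun v => Fb (u n * v)).
    by apply: (measurableT_comp measurable_Fb); exact: measurable_funM.
  have [] := @dominated_convergence _ _ _ mu D mD f_
    (fun v => (f v * v `^ (- alpha))%:E) (EFin \o g).
  - move=> n; apply/measurable_EFinP/measurable_funTS; apply: (measurable_funM mf).
    exact: (measurable_funM (mFu _) (measurable_cst _)).
  - by apply/measurable_EFinP/measurable_funTS; exact: (measurable_funM mf (mpow _)).
  - apply: aeW => v; rewrite /D/= in_itv/= andbT => v0.
    apply: cvg_EFin; first exact: nearW.
    apply: cvgM; first exact: cvg_cst.
    have h := (cvg_pinftyP _ _).1 (Fb_rv v0) u uy.
    rewrite -(cvg_shiftn n0) in h; apply: cvg_trans h.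
    by apply: near_eq_cvg; apply: nearW => n; rewrite /= (mulrC v).
  - exact: ig.
  - apply: aeW => v n; rewrite /D/= in_itv/= andbT => v0.
    have [un _] := hn0 (n + n0)%N (leq_addl _ _).
    have /andP[fv0 fvM] := f0 v.
    rewrite lee_fin ger0_norm ?mulr_ge0 ?invr_ge0 ?(ltW (Fb_gt0 _))//.
    rewrite /g indicE mem_setE in_itv/= v0/=.
    have [v1|v1] := ltP v 1.
      rewrite mul1r -[leLHS]addr0; apply: lerD => //.
      rewrite -mulrA; apply: ler_pM => //; first by rewrite divr_ge0// ltW.
      rewrite ler_pdivrMr//; apply: hC => //.
      by rewrite v0 ltW.
    rewrite mul0r mulr0 add0r ler_piMr// ler_pdivrMr// mul1r.
    by apply: Fb_anti; rewrite ler_peMr// (le_trans _ un)// ltW.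
  move=> ifl _ cvgf; split.
    by apply: (integral_fune_lt_pinfty _ ifl); exact: mD.
  rewrite -(cvg_shiftn n0 (fun n => H (u n) / Fb (u n)) _).
  have cvgf' : fine (\int[mu]_(v in D) f_ n v)%E @[n --> \oo] -->
      fine (\int[mu]_(v in D) (f v * v `^ (- alpha))%:E)%E.
    apply: fine_cvg; rewrite fineK; first exact: cvgf.
    by apply: (integrable_fin_num _ ifl); exact: mD.
  apply: cvg_trans cvgf'; apply: near_eq_cvg; apply: nearW => n.
  have [un Hn] := hn0 (n + n0)%N (leq_addl _ _).
  have -> : (\int[mu]_(v in D) f_ n v = (H (u (n + n0)%N) / Fb (u (n + n0)%N))%:E)%E.
    rewrite mulrC EFinM Hn -ge0_integralZl//.
    - apply: eq_integral => v _; rewrite /f_ -EFinM; congr EFin; ring.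
    - by apply/measurable_EFinP/measurable_funTS; exact: (measurable_funM mf (mFu _)).
    - by move=> v _; rewrite lee_fin mulr_ge0 ?(ltW (Fb_gt0 _))//; case/andP: (f0 v).
    - by rewrite lee_fin invr_ge0 ltW.
  by [].
split; last by apply/cvg_pinftyP => u uy; exact: (key u uy).2.
have ny : (n%:R : R) @[n --> \oo] --> +oo by exact: cvgr_idn.
exact: (key _ ny).1.
Unshelve. all: by end_near. Qed.

End Integral.
End RegularVariation.

(** * Asymptotics of the tail quantile function *)

Section TailQuantile.
Context {R : realType}.
Variables (alpha : R) (F : R -> R).
Hypothesis alpha01 : 0 < alpha < 1.
Hypothesis F_mono : forall x y, x <= y -> F x <= F y.
Hypothesis F_lt1 : forall x, F x < 1.
Hypothesis F_neg : forall x, x <= 0 -> F x = 0.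
Hypothesis F_rc : forall a, F x @[x --> a^'+] --> F a.
Hypothesis F_y1 : F x @[x --> +oo] --> (1 : R).
Let Fb x := 1 - F x.
Hypothesis Fb_rv : forall a : R, 0 < a ->
  Fb (a * x) / Fb x @[x --> +oo] --> a `^ (- alpha).
Let U := tail_quantile F.

Lemma tail_gt0 x : 0 < Fb x. Proof. by rewrite subr_gt0. Qed.

Lemma tail_anti x y : x <= y -> Fb y <= Fb x.
Proof. by move=> xy; rewrite lerD2l lerN2 F_mono. Qed.

Lemma tail_le1 x : Fb x <= 1.
Proof.
have [x0|x0] := leP x 0; first by rewrite /Fb F_neg// subr0.
by apply: le_trans (tail_anti (ltW x0)) _; rewrite /Fb F_neg// subr0.
Qed.

Lemma tail_quantile_set y : 1 < y -> has_inf [set x | 1 - y^-1 <= F x].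
Proof.
move=> y1; have y0 : 0 < y := lt_trans ltr01 y1; split.
  have [K [_ hK]] : \forall x \near +oo, 1 - y^-1 < F x.
    by apply: (cvgr_gt _ F_y1); rewrite ltrBlDr ltrDl invr_gt0.
  by exists (K + 1); apply/ltW/hK; rewrite ltrDl.
exists 0 => x /= hx; rewrite leNgt; apply/negP => x0.
by move: hx; rewrite (F_neg (ltW x0)) subr_le0 leNgt invf_lt1// y1.
Qed.

Lemma tail_quantile_lt y x : 1 < y -> x < U y -> y^-1 < Fb x.
Proof.
move=> y1 xU; rewrite ltNge; apply/negP => h.
have : U y <= x; last by rewrite leNgt xU.
by apply: inf_lbound; [have [] := tail_quantile_set y1|rewrite /= /Fb in h *; lra].
Qed.

(** Right continuity of [F] places the infimum [U y] in the set that defines it. *)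
Lemma tail_quantile_ge y : 1 < y -> Fb (U y) <= y^-1.
Proof.
move=> y1; suff : 1 - y^-1 <= F (U y) by rewrite /Fb; lra.
have h : \forall x \near (U y)^'+, 1 - y^-1 <= F x.
  near=> x; have xU : U y < x by near: x; exact: nbhs_right_gt.
  have xU0 : 0 < x - U y by rewrite subr_gt0.
  have [z zS zx] := inf_adherent xU0 (tail_quantile_set y1).
  apply: (le_trans zS); apply: F_mono; apply: ltW.
  by rewrite /U /tail_quantile /gen_inverse in zx *; lra.
by apply: (@cvgr_to_ge _ _ _ _ F _ _ _ h); exact: F_rc.
Unshelve. all: by end_near. Qed.

Lemma tail_quantile_pinfty : U y @[y --> +oo] --> +oo.
Proof.
apply/cvgryPge => K; near=> y.
have y1 : 1 < y by near: y; exact/nbhs_pinfty_gt/num_real.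
have yK : (Fb K)^-1 < y by near: y; exact/nbhs_pinfty_gt/num_real.
rewrite leNgt; apply/negP => UK.
have := tail_quantile_ge y1; rewrite leNgt => /negP; apply.
apply: lt_le_trans (tail_anti (ltW UK)).
by rewrite -[ltRHS]invrK ltf_pV2// posrE ?invr_gt0 ?tail_gt0// (lt_trans ltr01).
Unshelve. all: by end_near. Qed.

(** [F] may jump, so the product can be below 1. At [k * U y] with [k < 1] the tail still exceeds
    [y^-1], and regular variation compares the tails at [k * U y] and [U y] up to a factor near
    $k^\alpha$. *)
Lemma cvg_tail_quantile : y * Fb (U y) @[y --> +oo] --> (1 : R).
Proof.
have /andP[a0 a1] := alpha01.
apply/cvgrPdist_le => e e0.
(* Since [alpha < 1], $k^\alpha \ge k \ge 1 - e/2$; the entry [2^-1] keeps [k] positive for large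
   [e]. *)
pose k : R := Num.max (2^-1) (1 - e / 2).
have k0 : 0 < k by rewrite /k lt_max invr_gt0 ltr0n.
have k1 : k < 1 by rewrite /k gt_max invf_lt1// ltr1n ltrBlDr ltrDl divr_gt0.
have ka : 1 - e / 2 <= k `^ alpha.
  apply: le_trans (ger1_powR _ _); first by rewrite /k le_max lexx orbT.
    by rewrite k0 ltW.
  exact: ltW.
have h : Fb (k * U y) / Fb (U y) @[y --> +oo] --> k `^ (- alpha).
  exact: (@cvg_comp _ _ _ U (fun x => Fb (k * x) / Fb x) _ _ _ tail_quantile_pinfty (Fb_rv k0)).
have h' : (Fb (k * U y) / Fb (U y))^-1 @[y --> +oo] --> k `^ alpha.
  have := cvgV _ h; rewrite powRN invrK; apply.
  by rewrite invr_eq0 gt_eqF// powR_gt0.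
have e2 : 0 < e / 2 by rewrite divr_gt0.
near=> y.
have y1 : 1 < y by near: y; exact/nbhs_pinfty_gt/num_real.
have y0 : 0 < y := lt_trans ltr01 y1.
have U0 : 0 < U y by near: y; apply: (cvgryPgt _).1; exact: tail_quantile_pinfty.
have le1 : y * Fb (U y) <= 1.
  by rewrite -ler_pdivlMl// mulr1; exact: tail_quantile_ge.
rewrite ger0_norm ?subr_ge0// lerBlDl -lerBlDr.
have : `|k `^ alpha - (Fb (k * U y) / Fb (U y))^-1| <= e / 2.
  by near: y; exact: (cvgrPdist_le _ _).1.
rewrite ler_norml => /andP[_]; rewrite invf_div => h2.
have : Fb (U y) / Fb (k * U y) <= y * Fb (U y).
  rewrite mulrC ler_pM2r ?tail_gt0// -[leRHS]invrK lef_pV2 ?posrE ?invr_gt0 ?tail_gt0//.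
  by apply/ltW/tail_quantile_lt => //; rewrite gtr_pMl.
lra.
Unshelve. all: by end_near. Qed.

Lemma cvg_tail_scaled (k : R) : 0 < k ->
  y * Fb (k * U y) @[y --> +oo] --> k `^ (- alpha).
Proof.
move=> k0; rewrite -[k `^ _]mul1r.
have h : Fb (k * U y) / Fb (U y) @[y --> +oo] --> k `^ (- alpha).
  exact: (@cvg_comp _ _ _ U (fun x => Fb (k * x) / Fb x) _ _ _ tail_quantile_pinfty (Fb_rv k0)).
have := cvgM cvg_tail_quantile h.
have -> : (fun y => y * Fb (U y)) \* (fun y => Fb (k * U y) / Fb (U y)) =
    (fun y => y * Fb (k * U y)).
  by apply/funext => y /=; rewrite mulrA mulrAC -(mulrA y) mulrA mulfK// gt_eqF// tail_gt0.
exact.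
Qed.

End TailQuantile.

(** * Laplace transform and truncated mean of a heavy-tailed variable *)

Section HeavyTail.
Context {R : realType} {d : measure_display} {T : measurableType d}.
Local Notation mu := (@lebesgue_measure R).
Variables (P : probability T R) (alpha : R) (Fb : R -> R).
Hypothesis alpha01 : 0 < alpha < 1.
Hypothesis Fb_gt0 : forall x, 0 < Fb x.
Hypothesis Fb_le1 : forall x, Fb x <= 1.
Hypothesis Fb_anti : forall x y, x <= y -> Fb y <= Fb x.
Hypothesis Fb_rv : forall a : R, 0 < a ->
  Fb (a * x) / Fb x @[x --> +oo] --> a `^ (- alpha).
Variable Z : T -> R.
Hypotheses (mZ : measurable_fun setT Z) (Z0 : forall x, 0 <= Z x).
Hypothesis ZFb : forall v, Pr P [set x | v < Z x] = Fb v.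

Lemma integral_exp_density (u : R) : 0 <= u ->
  (\int[mu]_(v in `]0%R, +oo[) (u * expR (- (u * v)))%:E < +oo)%E.
Proof.
rewrite le_eqVlt => /predU1P[<-|u0].
  by rewrite integral0_eq// => v _; rewrite mul0r.
have mf : measurable_fun setT (fun v : R => u * expR (- (u * v))).
  apply: measurable_funM => //; apply: (measurableT_comp (@measurable_expR R)).
  by apply: measurable_funN; exact: measurable_funM.
have f0 (v : R) : 0 <= u * expR (- (u * v)) by rewrite mulr_ge0 ?expR_ge0// ltW.
pose D (n : nat) : set R := `]0%R, n%:R[%classic.
have DE : \bigcup_n D n = `]0%R, +oo[%classic.
  apply/seteqP; split=> v.
    by move=> [n _]; rewrite /D/= !in_itv/= andbT => /andP[].
  rewrite /= in_itv/= andbT => v0; exists (Num.truncn v).+1 => //.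
  by rewrite /D/= in_itv/= v0 truncnS_gt.
have h : (\int[mu]_(v in D n) (u * expR (- (u * v)))%:E @[n --> \oo] -->
    \int[mu]_(v in \bigcup_n D n) (u * expR (- (u * v)))%:E)%E.
  apply: ge0_nondecreasing_set_cvg_integral => //.
  - apply/nondecreasing_seqP => n; rewrite subsetEset => v; rewrite /D/= !in_itv/=.
    by move=> /andP[-> h]; apply: lt_le_trans h _; rewrite ler_nat.
  - by move=> n; exact: measurable_itv.
  - by move=> n; apply/measurable_EFinP/measurable_funTS.
  - by move=> n v _; rewrite lee_fin.
rewrite -DE; apply: (@le_lt_trans _ _ 1%E); last by rewrite ltry.
rewrite -(cvg_lim _ h)//; apply: lime_le; first by apply/cvg_ex; eexists; exact: h.
apply: nearW => n.
have -> : (\int[mu]_(v in D n) (u * expR (- (u * v)))%:E =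
  \int[mu]_(v in `]0%R, +oo[) (u * expR (- (u * v)) * (v < n%:R)%R%:R)%:E)%E.
  rewrite integral_mkcond [RHS]integral_mkcond; apply: eq_integral => v _.
  rewrite !epatch_indic/= !indicE !mem_setE !in_itv/= andbT.
  by case: (0 < v) (v < _) => [] []; rewrite ?mulr1 ?mulr0 ?mule0 ?mule1.
rewrite integral_expR_itv ?ler0n ?(ltW u0)// lee_fin.
by rewrite lerBlDr lerDl expR_ge0.
Qed.

Lemma tail_scaled x v : 0 < x -> Pr P [set y | v < Z y / x] = Fb (x * v).
Proof.
move=> x0; rewrite -ZFb; congr (Pr P _); apply/seteqP; split=> y /=;
  by rewrite ltr_pdivlMr// mulrC.
Qed.

(** By [laplace_tail] for [Z / y] the defect is the integral of $u e^{-uv}$ against [Fb (y * v)], so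
    [cvg_rv_integral] applies. *)
Lemma cvg_laplace_defect u : 0 <= u ->
  (1 - Ex P (fun x => expR (- (u / y * Z x)))) / Fb y @[y --> +oo] -->
    stable_exponent alpha^-1 u.
Proof.
move=> u0; have /andP[a0 a1] := alpha01.
have mf : measurable_fun setT (fun v : R => u * expR (- (u * v))).
  apply: measurable_funM => //; apply: (measurableT_comp (@measurable_expR R)).
  by apply: measurable_funN; exact: measurable_funM.
have f0 (v : R) : 0 <= v -> 0 <= u * expR (- (u * v)) <= u.
  move=> v0; rewrite mulr_ge0 ?expR_ge0// ler_piMr//.
  by rewrite -expR0 ler_expR oppr_le0 mulr_ge0.
(* [cvg_rv_integral] asks for a bound on the whole line; clamping at 0 provides it without changing
   the integral over []0, +oo[]. *)
pose f v := u * expR (- (u * Num.max 0 v)).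
have fE v : 0 < v -> f v = u * expR (- (u * v)).
  by move=> v0; rewrite /f max_r// ltW.
have intE (g : R -> R) : (\int[mu]_(v in `]0%R, +oo[) (f v * g v)%:E =
    \int[mu]_(v in `]0%R, +oo[) (u * expR (- (u * v)) * g v)%:E)%E.
  by apply: eq_integral => v; rewrite inE/= in_itv/= andbT => v0; rewrite fE.
have mff : measurable_fun setT f.
  apply: measurable_funM => //; apply: (measurableT_comp (@measurable_expR R)).
  apply: measurable_funN; apply: measurable_funM => //.
  exact: measurable_maxr.
have ff v : 0 <= f v <= u by rewrite /f f0// le_max lexx.
have fint : (\int[mu]_(v in `]0%R, +oo[) (f v)%:E < +oo)%E.
  have := intE (fun=> 1); under eq_integral do rewrite mulr1.
  by move=> ->; under eq_integral do rewrite mulr1; exact: integral_exp_density.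
have [] := @cvg_rv_integral R alpha Fb alpha01 Fb_gt0 Fb_le1 Fb_anti Fb_rv f u mff ff fint
  (fun y => 1 - Ex P (fun x => expR (- (u / y * Z x)))).
  near=> y; have y0 : 0 < y by near: y; exact/nbhs_pinfty_gt/num_real.
  have := @laplace_tail _ _ _ P (fun x => Z x / y) _ _ u u0.
  rewrite intE.
  have -> : (fun x => expR (- (u * (Z x / y)))) = (fun x => expR (- (u / y * Z x))).
    by apply/funext => x; congr (expR (- _)); ring.
  move=> ->.
  - by apply: eq_integral => v _; rewrite tail_scaled.
  - exact: measurable_funM.
  - by move=> x; rewrite divr_ge0// ltW.
move=> _; rewrite intE (stable_exponent_tail a0 u0) /stable_exponent invrK.
(* [fine] sends infinite values to 0, and does so on both sides. *)
rewrite /Rintegral; case: (integral _ _ _) => [r| |] //=.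
- by rewrite gt0_muley ?lte_fin//= mulr0.
- by rewrite gt0_muleNy ?lte_fin//= mulr0.
Unshelve. all: by end_near. Qed.

(** The limit is $\int_0^1 v^{-\alpha}\,dv$, by [min_tail] and [cvg_rv_integral]. *)
Lemma cvg_truncated_mean :
  Ex P (fun x => Num.min (Z x / y) 1) / Fb y @[y --> +oo] --> (1 - alpha)^-1.
Proof.
have /andP[a0 a1] := alpha01.
pose f : R -> R := \1_`]0, 1[.
have mf : measurable_fun setT f by exact: measurable_indic.
have ff v : 0 <= f v <= 1 by rewrite /f indicE ler0n lern1 leq_b1.
have fint : (\int[mu]_(v in `]0%R, +oo[) (f v)%:E < +oo)%E.
  rewrite integral_indic//=.
  apply: (@le_lt_trans _ _ (mu `]0, 1[%classic)).
    apply: le_measure; [|by rewrite inE; exact: measurable_itv|exact: subIsetl].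
    by rewrite inE; apply: measurableI; exact: measurable_itv.
  by rewrite lebesgue_measure_itv/= lte_fin ltr01 -EFinB ltry.
have [] := @cvg_rv_integral R alpha Fb alpha01 Fb_gt0 Fb_le1 Fb_anti Fb_rv f 1 mf ff fint
  (fun y => Ex P (fun x => Num.min (Z x / y) 1)).
  near=> y; have y0 : 0 < y by near: y; exact/nbhs_pinfty_gt/num_real.
  rewrite (@min_tail _ _ _ P (fun x => Z x / y)).
  - by apply: eq_integral => v _; rewrite tail_scaled.
  - exact: measurable_funM.
  - by move=> x; rewrite divr_ge0// ltW.
by move=> _; rewrite integral_powRN.
Unshelve. all: by end_near. Qed.

(** Read off from the limit rather than from the integral: passing from [y] to [a^-1 * y] in
    [cvg_laplace_defect] changes [Fb] by the asymptotic factor $a^\alpha$. *)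
Lemma stable_exponentZ (a u : R) : 0 < a -> 0 <= u ->
  stable_exponent alpha^-1 (a * u) = a `^ alpha * stable_exponent alpha^-1 u.
Proof.
move=> a0 u0.
have h1 := cvg_laplace_defect (mulr_ge0 (ltW a0) u0).
have ay : a^-1 * y @[y --> +oo] --> +oo by apply: gt0_cvgMry; [rewrite invr_gt0|].
have h2 : (1 - Ex P (fun x => expR (- (u / (a^-1 * y) * Z x)))) / Fb (a^-1 * y) @[y --> +oo] -->
    stable_exponent alpha^-1 u.
  exact: (@cvg_comp _ _ _ ( *%R a^-1) (fun y => (1 - Ex P (fun x => expR (- (u / y * Z x)))) / Fb y)
    _ _ _ ay (cvg_laplace_defect u0)).
have a'0 : 0 < a^-1 by rewrite invr_gt0.
have aE : a^-1 `^ (- alpha) = a `^ alpha.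
  by rewrite /powR invr_eq0 (gt_eqF a0) lnV ?posrE// mulrNN.
suff E : (fun y => (1 - Ex P (fun x => expR (- (a * u / y * Z x)))) / Fb y) =
    (fun y => Fb (a^-1 * y) / Fb y) \*
    (fun y => (1 - Ex P (fun x => expR (- (u / (a^-1 * y) * Z x)))) / Fb (a^-1 * y)).
  have h3 := Fb_rv a'0; rewrite aE in h3.
  have {}h3 : ((fun y => Fb (a^-1 * y) / Fb y) \*
    (fun y => (1 - Ex P (fun x => expR (- (u / (a^-1 * y) * Z x)))) / Fb (a^-1 * y))) y
    @[y --> +oo] --> a `^ alpha * stable_exponent alpha^-1 u by exact: cvgM.
  by rewrite -E in h3; rewrite -(cvg_lim _ h1)// -(cvg_lim _ h3).
apply/funext => y /=.
have -> : (fun x => expR (- (u / (a^-1 * y) * Z x))) = (fun x => expR (- (a * u / y * Z x))).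
  by apply/funext => x; rewrite invfM invrK mulrA (mulrC u).
by rewrite [RHS]mulrC mulrA divfK// gt_eqF.
Qed.

End HeavyTail.

(** * Order statistics *)

Section OrderStatistics.
Context {R : realType}.
Variable xs : seq R.
Let n := size xs.
Let o (j : nat) : R := nth 0 (0 :: sort <=%R xs) j.

(** Turns bounds on an order statistic into bounds on a count, that is, on a sum of indicators of
    independent claims. *)
Lemma nth_sort_le (k : nat) (y : R) : (0 < k <= n)%N ->
  (o k <= y) = (k <= count (fun x => (x <= y)%R) xs)%N.
Proof.
case: k => // k /andP[_ kn]; rewrite /o/=.
have so : sorted <=%R (sort <=%R xs) by exact: sort_le_sorted.
have ce : count (fun x => (x <= y)%R) xs = count (<= y) (sort <=%R xs).
  by rewrite count_sort.
rewrite ce; apply/idP/idP => [h|h]; last exact: nth_count_le.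
rewrite ltnNge; apply/negP => h2; move: h; rewrite leNgt => /negP; apply.
by apply: nth_count_gt => //; rewrite h2 size_sort.
Qed.

Lemma nth_sort_mono (j k : nat) : (0 < j <= k)%N -> (k <= n)%N -> o j <= o k.
Proof.
move=> jk kn; rewrite nth_sort_le; last by lia.
apply: (@leq_trans k); first by lia.
by rewrite -nth_sort_le ?lexx//; lia.
Qed.

Lemma sum_sort (h : R -> R) : \sum_(1 <= j < n.+1) h (o j) = \sum_(x <- xs) h x.
Proof.
rewrite big_add1/=; have -> : \sum_(x <- xs) h x = \sum_(x <- sort <=%R xs) h x.
  by apply: perm_big; rewrite perm_sym perm_sort.
by rewrite [RHS](big_nth 0) size_sort.
Qed.

Lemma sum_sort_split (k : nat) : (0 < k <= n)%N ->
  \sum_(x <- xs) x = \sum_(1 <= j < k) o j + o k + \sum_(k.+1 <= j < n.+1) o j.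
Proof.
move=> kn; rewrite -(sum_sort id) (@big_cat_nat _ _ _ k)/=; [|lia..].
by rewrite [X in _ + X]big_ltn ?addrA//; lia.
Qed.

(** The left side is monotone in the cap, so it can be compared with sums capped at deterministic
    levels, which concentrate. *)
Lemma sum_min_sort (k : nat) : (0 < k <= n)%N ->
  \sum_(x <- xs) Num.min x (o k) = \sum_(1 <= j < k) o j + (n - k).+1%:R * o k.
Proof.
move=> kn; rewrite -(sum_sort (fun x => Num.min x (o k))) (@big_cat_nat _ _ _ k)/=; [|lia..].
congr (_ + _).
  rewrite big_nat_cond [RHS]big_nat_cond; apply: eq_bigr => j jk.
  by rewrite min_l//; apply: nth_sort_mono; lia.
rewrite big_nat_cond (eq_bigr (fun=> o k)).
  rewrite -big_nat_cond big_const_nat iter_addr_0 subSn ?mulr_natl//; lia.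
by move=> j jk; rewrite min_r//; apply: nth_sort_mono; lia.
Qed.

Hypothesis xs_gt0 : forall x, x \in xs -> 0 < x.

Lemma nth_sort_ge0 j : 0 <= o j.
Proof.
have [jn|jn] := ltnP j n.+1; last by rewrite /o nth_default//= size_sort.
case: j jn => [|j] jn; first by [].
apply/ltW/xs_gt0; rewrite -(mem_sort <=%R); apply: mem_nth.
by rewrite size_sort.
Qed.

Lemma count_gtE (y : R) : (count (fun x => (x <= y)%R) xs + count (fun x => (y < x)%R) xs)%N = n.
Proof.
rewrite /n -(count_predC (fun x => (x <= y)%R)); congr (_ + _)%N.
by apply: eq_count => x /=; rewrite ltNge.
Qed.

Lemma sum_indic_count (y : R) :
  \sum_(x <- xs) (y < x)%R%:R = (count (fun x => (y < x)%R) xs)%:R :> R.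
Proof.
elim: xs => [|x s IH]; first by rewrite big_nil.
by rewrite big_cons IH /= natrD.
Qed.

(** The deterministic part of the argument. The counts bracket [o k], hence also the sum capped at
    [o k], and subtracting the capped terms of [sum_min_sort] leaves the small entries. The
    hypothesis [1 <= e * (n%:R * p)] lets a factor [1 + e] absorb the rounding of [n * p]. *)
Lemma order_stat_bounds (p b e al : R) (k : nat) :
  0 < p -> 0 < b -> 0 < al <= 1 -> 0 < e <= 2^-1 -> 1 <= e * (n%:R * p) ->
  k = (n - Num.truncn (p * n%:R))%N -> (0 < k)%N ->
  \sum_(x <- xs) ((1 + e) * b < x)%R%:R <= n%:R * p ->
  n%:R * p < \sum_(x <- xs) ((1 - e) * b < x)%R%:R ->
  \sum_(x <- xs) Num.min x ((1 + e) * b) <= n%:R * p * b * ((1 + e) ^+ 3 / al) ->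
  n%:R * p * b * ((1 - e) ^+ 3 / al) <= \sum_(x <- xs) Num.min x ((1 - e) * b) ->
  [/\ (1 - e) * b <= o k <= (1 + e) * b, 0 <= \sum_(1 <= j < k) o j &
      `|\sum_(1 <= j < k) o j - n%:R * p * b * (al^-1 - 1)| <= n%:R * p * b * (e * (8 / al))].
Proof.
move=> p0 b0 /andP[al0 al1] /andP[e0 e2] enp kE k0; rewrite !sum_indic_count => h1 h2 h3 h4.
set np := n%:R * p in enp h1 h2 h3 h4 *.
have pn : p * n%:R = np by rewrite mulrC.
have np0 : 0 <= np by rewrite mulr_ge0// ltW.
have /andP[t1 t2] := truncn_itv np0.
rewrite pn in kE; clearbody np; move: (Num.truncn np) kE t1 t2 => tr kE t1 t2.
have c1 := count_gtE ((1 + e) * b); have c2 := count_gtE ((1 - e) * b).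
have kn : (0 < k <= n)%N by rewrite k0 kE leq_subr.
have n1 : (count (fun x => ((1 + e) * b < x)%R) xs < tr.+1)%N.
  by rewrite -(ltr_nat R); exact: le_lt_trans h1 _.
have n2 : (tr < count (fun x => ((1 - e) * b < x)%R) xs)%N.
  by rewrite -(ltr_nat R); exact: le_lt_trans t1 _.
have Y1 : o k <= (1 + e) * b.
  rewrite nth_sort_le//; move: c1 n1 kE.
  by move: (count _ _) (count _ _) => ? ?; clear -k0; lia.
have Y2 : (1 - e) * b <= o k.
  apply: ltW; rewrite ltNge nth_sort_le// -ltnNge; move: c2 n2 kE kn.
  by move: (count _ _) (count _ _) => ? ?; clear -k0; lia.
have S0 : 0 <= \sum_(1 <= j < k) o j by apply: sumr_ge0 => j _; exact: nth_sort_ge0.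
split; [by rewrite Y1 Y2|exact: S0|].
have nk : (n - k)%N = tr by move: kE k0; clear; lia.
have Smin := sum_min_sort kn; rewrite nk in Smin.
have m1 : \sum_(x <- xs) Num.min x (o k) <= \sum_(x <- xs) Num.min x ((1 + e) * b).
  by apply: ler_sum => x _; rewrite le_min !ge_min lexx/= Y1 orbT.
have m2 : \sum_(x <- xs) Num.min x ((1 - e) * b) <= \sum_(x <- xs) Num.min x (o k).
  by apply: ler_sum => x _; rewrite le_min !ge_min lexx/= Y2 orbT.
have al3 : 0 < al^-1 by rewrite invr_gt0.
have trn : np < tr.+1%:R by exact: t2.
move: Smin h3 h4 m1 m2 S0 Y1 Y2 h1 enp trn t1.
move: (\sum_(1 <= j < k) o j) (o k) => S Y.
move: (\sum_(x <- xs) Num.min x Y) => S1.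
move: (\sum_(x <- xs) Num.min x ((1 + e) * b)) (\sum_(x <- xs) Num.min x ((1 - e) * b)).
move=> S2 S3 -> h3 h4 m1 m2 S0 Y1 Y2 h1 enp trn t1.
have np1 : 0 < np by rewrite -(pmulr_rgt0 _ e0); lra.
pose q := np * b; have q0 : 0 < q by rewrite mulr_gt0.
have tr2 : tr.+1%:R <= (1 + e) * np by rewrite -natr1; lra.
have u1 : (1 - e) * q <= tr.+1%:R * Y.
  rewrite /q mulrCA; apply: ler_pM => //; last exact: ltW.
  by rewrite mulr_ge0 ?(ltW b0)//; lra.
have u2 : tr.+1%:R * Y <= (1 + e) * (1 + e) * q.
  have -> : (1 + e) * (1 + e) * q = (1 + e) * np * ((1 + e) * b) by rewrite /q; ring.
  apply: ler_pM => //; apply: le_trans Y2.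
  by rewrite mulr_ge0 ?(ltW b0)//; lra.
move: (tr.+1%:R * Y) u1 u2 h3 h4 m1 m2 => A u1 u2 h3 h4 m1 m2.
rewrite -/q in h3 h4 *; clearbody q.
have B1 : S <= q * ((1 + e) ^+ 3 / al) - (1 - e) * q by lra.
have B2 : q * ((1 - e) ^+ 3 / al) - (1 + e) * (1 + e) * q <= S by lra.
(* The final constant 8 is this 7 plus 1 from the term [(1 - e) * q], using [1 <= al^-1]; the lower
   bound is less demanding. *)
have e3 : (1 + e) ^+ 3 <= 1 + 7 * e.
  rewrite (_ : (1 + e) ^+ 3 = 1 + 3 * e + 3 * e * e + e * e * e); last by ring.
  nra.
have e4 : 1 - 3 * e <= (1 - e) ^+ 3.
  rewrite (_ : (1 - e) ^+ 3 = 1 - 3 * e + e * e * (3 - e)); last by ring.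
  by rewrite lerDl mulr_ge0 ?mulr_ge0//; lra.
have al4 : 1 <= al^-1 by rewrite invf_ge1.
have C1 : q * ((1 + e) ^+ 3 / al) <= q * ((1 + 7 * e) / al).
  by rewrite ler_pM2l// ler_pM2r.
have C2 : q * ((1 - 3 * e) / al) <= q * ((1 - e) ^+ 3 / al).
  by rewrite ler_pM2l// ler_pM2r.
have qe : q * e <= q * e * al^-1 by rewrite ler_peMr// mulr_ge0// ltW.
have qee : q * e * e <= q * e by rewrite ler_piMr ?mulr_ge0 ?(ltW q0) ?(ltW e0)//; lra.
rewrite ler_norml; apply/andP; split; lra.
Qed.

End OrderStatistics.

(** * Weak limits realized by quantile functions *)

Section Uniform.
Context {R : realType}.

Local Notation RT := (measurableTypeR R).

Definition unif01 : probability RT R := @uniform_prob R 0 1 ltr01.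

Lemma unif01_itv (b0 b1 : bool) (a b : R) : 0 <= a -> a <= b -> b <= 1 ->
  Pr unif01 [set` Interval (BSide b0 a) (BSide b1 b)] = b - a.
Proof.
move=> a0 ab b1'; rewrite /Pr /unif01 /= /uniform_prob.
set I := [set` _].
have mI : measurable I by exact: measurable_itv.
rewrite (_ : integral _ _ _ = \int[lebesgue_measure]_(x in I) 1)%E.
  rewrite integral_cst// mul1e /I/= lebesgue_measure_itv/=.
  rewrite lte_fin; case: ltP => //= h; apply/esym/eqP; rewrite subr_eq0 eq_le ab andbT.
  exact: h.
apply: eq_integral => x; rewrite inE /I /= => xI.
suff : 0 <= x <= 1 by rewrite /uniform_pdf => ->; rewrite subr0 invr1.
move: xI; rewrite in_itv/= => /andP[h1 h2].
have {}h1 := lteifW h1; have {}h2 := lteifW h2.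
by rewrite (le_trans a0 h1) (le_trans h2).
Qed.

(** Monotonicity encloses [h] between two step functions whose integrals differ by one cell. The
    error does not depend on [h], so limits of expectations reduce to limits at finitely many
    points. *)
Lemma Ex_riemann (h : RT -> R) (m : nat) : measurable_fun setT h ->
  (forall r, 0 <= h r <= 1) ->
  (forall r s : R, 0 < r -> r <= s -> s < 1 -> h r <= h s) ->
  `|Ex unif01 h - m.+1%:R^-1 * \sum_(k < m) h (k.+1%:R / m.+1%:R)| <= m.+1%:R^-1.
Proof.
move=> mh h01 hmono.
have m0 : 0 < m.+1%:R :> R by rewrite ltr0n.
have bh : bounded_rv h by exact: bounded_rv_unit.
pose I (k : nat) : set RT := `[k%:R / m.+1%:R, k.+1%:R / m.+1%:R[%classic.
have mI k : measurable (I k) by exact: measurable_itv.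
have PI k : (k < m.+1)%N -> Pr unif01 (I k) = m.+1%:R^-1.
  move=> km; rewrite unif01_itv ?divr_ge0//.
  - by rewrite -mulrBl -natr1 addrAC subrr add0r mul1r.
  - by rewrite ler_pM2r ?invr_gt0// ler_nat.
  - by rewrite ler_pdivrMr// mul1r ler_nat.
have InE k (r : R) : (r \in I k) = (k%:R <= r * m.+1%:R) && (r * m.+1%:R < k.+1%:R).
  by rewrite mem_setE in_itv/= ler_pdivrMr// ltr_pdivlMr.
pose st (a : nat -> R) (r : RT) : R := \sum_(k <- iota 0 m.+1) a k * \1_(I k) r.
have bst1 (a : nat -> R) k : bounded_rv (fun r : RT => a k * \1_(I k) r).
  by apply: bounded_rvM; [exact: bounded_rv_cst|exact: bounded_rv_indic].
have bst a : bounded_rv (st a) by exact: (Ex_sum unif01 (iota 0 m.+1) (bst1 a)).1.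
have Est a : Ex unif01 (st a) = m.+1%:R^-1 * \sum_(k <- iota 0 m.+1) a k.
  rewrite (Ex_sum unif01 (iota 0 m.+1) (bst1 a)).2 mulr_sumr.
  apply: eq_big_seq => k; rewrite mem_iota add0n => /andP[_ km].
  by rewrite ExZ ?Ex_indic ?PI// 1?mulrC//; exact: bounded_rv_indic.
have stE a (r : R) : 0 <= r < 1 -> st a r = a (Num.truncn (r * m.+1%:R)).
  move=> /andP[r0 r1]; set j := Num.truncn _.
  have rm : 0 <= r * m.+1%:R by rewrite mulr_ge0.
  have /andP[j1 j2] := truncn_itv rm; rewrite -/j in j1 j2.
  have jm : (j < m.+1)%N.
    by rewrite -(ltr_nat R); apply: le_lt_trans j1 _; rewrite gtr_pMl.
  rewrite /st (bigD1_seq j) ?mem_iota ?iota_uniq//= indicE InE j1 j2 mulr1.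
  rewrite big1_seq ?addr0// => k /andP[kj _]; rewrite indicE InE.
  have [h1|h1] := leP k%:R (r * m.+1%:R); last by rewrite mulr0.
  have [h2|h2] := ltP (r * m.+1%:R) k.+1%:R; last by rewrite mulr0.
  case/eqP: kj; apply/eqP; rewrite eqn_leq.
  by rewrite -ltnS -(ltr_nat R) (le_lt_trans h1 j2) -ltnS -(ltr_nat R) (le_lt_trans j1 h2).
have st0 a (r : R) : ~~ (0 <= r < 1) -> st a r = 0.
  move=> rout; apply: big1_seq => k /andP[_]; rewrite mem_iota add0n => /andP[_ km].
  rewrite indicE InE; have [h1|h1] := leP k%:R (r * m.+1%:R); last by rewrite mulr0.
  have [h2|h2] := ltP (r * m.+1%:R) k.+1%:R; last by rewrite mulr0.
  case/negP: rout; apply/andP; split.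
    by rewrite -(pmulr_lge0 _ m0); apply: le_trans h1.
  rewrite -(ltr_pM2r m0) mul1r; apply: lt_le_trans h2 _; by rewrite ler_nat.
(* [h] is monotone on the open interval only, so its values at 0 and 1 are replaced by the bounds 0
   and 1 in the extreme cells. *)
pose lo k : R := if k is 0 then 0 else h (k%:R / m.+1%:R).
pose up k : R := if k == m then 1 else h (k.+1%:R / m.+1%:R).
have Slo : \sum_(k <- iota 0 m.+1) lo k = \sum_(k < m) h (k.+1%:R / m.+1%:R).
  by rewrite -(big_mkord xpredT (fun k => h (k.+1%:R / m.+1%:R))) -/(index_iota 0 m.+1)
    big_nat_recl//= add0r.
have Sup : \sum_(k <- iota 0 m.+1) up k = \sum_(k < m) h (k.+1%:R / m.+1%:R) + 1.
  rewrite -(big_mkord xpredT (fun k => h (k.+1%:R / m.+1%:R))) -/(index_iota 0 m.+1).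
  rewrite big_nat_recr//= {2}/up eqxx; congr (_ + _).
  by apply: eq_big_nat => k /andP[_ km]; rewrite /up ltn_eqF.
have lo_le (r : R) : st lo r <= h r.
  have [rin|rout] := boolP (0 <= r < 1); last by rewrite st0//; case/andP: (h01 r).
  rewrite stE//; have /andP[r0 r1] := rin; set j := Num.truncn _.
  have /andP[j1 j2] := truncn_itv (mulr_ge0 r0 (ltW m0)); rewrite -/j in j1 j2.
  case: j j1 j2 => [|j] j1 j2 /=; first by case/andP: (h01 r).
  by apply: hmono => //; rewrite ler_pdivrMr.
(* A null event on which the step function need not dominate [h]; its indicator restores the
   inequality. *)
pose out : set RT := ~` `]0, 1[%classic.
have mout : measurable out by apply: measurableC; exact: measurable_itv.
have le_up (r : R) : h r <= st up r + \1_out r.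
  have st_ge0 : 0 <= st up r.
    apply: sumr_ge0 => k _; apply: mulr_ge0; last by rewrite indicE.
    by rewrite /up; case: ifP => // _; case/andP: (h01 (k.+1%:R / m.+1%:R)).
  have [rin|rout] := boolP (0 < r < 1); last first.
    apply: (@le_trans _ _ 1); first by case/andP: (h01 r).
    rewrite indicE mem_set ?lerDr//.
    by rewrite /out/= in_itv/=; exact/negP.
  have /andP[r00 r1] := rin; have r0 := ltW r00.
  rewrite stE ?r0//; set j := Num.truncn _.
  have /andP[j1 j2] := truncn_itv (mulr_ge0 r0 (ltW m0)); rewrite -/j in j1 j2.
  apply: (@le_trans _ _ (up j)); last by rewrite lerDl indicE.
  rewrite /up; case: eqP => [_|jm]; first by case/andP: (h01 r).
  have jm' : (j.+1 < m.+1)%N.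
    have : (j < m.+1)%N by rewrite -(ltr_nat R); apply: le_lt_trans j1 _; rewrite gtr_pMl.
    by move: jm; clear; lia.
  apply: hmono => //; first by rewrite ler_pdivlMr// ltW.
  by rewrite ltr_pdivrMr// mul1r ltr_nat.
have Eout : Ex unif01 (\1_out) = 0.
  rewrite Ex_indic// Pr_setC; last exact: measurable_itv.
  by rewrite unif01_itv// subr0 subrr.
have h1 : Ex unif01 (st lo) <= Ex unif01 h by exact: Ex_le.
have h2 : Ex unif01 h <= Ex unif01 (st up).
  rewrite -[leRHS]addr0 -Eout -ExD//; last exact: bounded_rv_indic.
  by apply: Ex_le => //; apply: bounded_rvD => //; exact: bounded_rv_indic.
rewrite Est Slo in h1; rewrite Est Sup mulrDr mulr1 in h2.
move: h1 h2; move: (\sum_(k < m) h (k.+1%:R / m.+1%:R)) m.+1%:R^-1 => S b h1 h2.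
rewrite ger0_norm ?subr_ge0//; lra.
Qed.

End Uniform.

(** * Upper quantile functions *)

Section Quantile.
Context {R : realType} {d : measure_display} {T : measurableType d}.
Local Notation RT := (measurableTypeR R).
Variables (P : probability T R) (Z : T -> R).
Hypotheses (mZ : measurable_fun setT Z) (Z0 : forall x, 0 <= Z x).
Let G y := Pr P [set x | y < Z x].

Lemma cvg_Pr_nondecreasing (A : nat -> set T) : (forall n, measurable (A n)) ->
  {homo A : n m / (n <= m)%N >-> n `<=` m} ->
  Pr P (A n) @[n --> \oo] --> Pr P (\bigcup_n A n).
Proof.
move=> mA ndA; apply: fine_cvg; rewrite -PrE; last exact: bigcupT_measurable.
apply: nondecreasing_cvg_mu => //; first exact: bigcupT_measurable.
by move=> n m nm; rewrite subsetEset; exact: ndA.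
Qed.

Lemma tail_right_cts (y r : R) : r < G y -> exists2 y', y < y' & r < G y'.
Proof.
move=> ry; pose A n := [set x | y + n.+1%:R^-1 < Z x].
have mA n : measurable (A n) by exact: measurable_gt_rv.
have UA : \bigcup_n A n = [set x | y < Z x].
  apply/seteqP; split=> x; first by move=> [n _] /=; apply: lt_trans; rewrite ltrDl invr_gt0.
  move=> /= yZ; have Zy : 0 < Z x - y by rewrite subr_gt0.
  exists (Num.truncn (Z x - y)^-1) => //=.
  rewrite /A /= addrC -ltrBrDr -[ltRHS]invrK ltf_pV2 ?posrE ?invr_gt0//.
  exact: truncnS_gt.
have h := cvg_Pr_nondecreasing mA.
have {}h : Pr P (A n) @[n --> \oo] --> G y.
  rewrite /G -UA; apply: h => n m nm x; apply: le_lt_trans.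
  by rewrite lerD2l lef_pV2 ?posrE// ler_nat.
have [n _ hn] := cvgr_gt _ h _ ry.
by exists (y + n.+1%:R^-1); [rewrite ltrDl invr_gt0|exact: (hn n (leqnn n))].
Qed.

Lemma tail_vanish (r : R) : 0 < r -> exists2 K, 0 <= K & G K < r.
Proof.
move=> r0; pose A (n : nat) := ~` [set x | n%:R < Z x].
have mA n : measurable (A n) by apply: measurableC; exact: measurable_gt_rv.
have UA : \bigcup_n A n = setT.
  apply/seteqP; split=> // x _; exists (Num.truncn (Z x)).+1 => //=.
  by rewrite /A/=; apply/negP; rewrite -leNgt ltW// truncnS_gt.
have h := cvg_Pr_nondecreasing mA; rewrite UA in h.
have {}h : Pr P (A n) @[n --> \oo] --> (1 : R).
  rewrite [X in _ --> X](_ : _ = Pr P setT); last by rewrite /Pr probability_setT.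
  apply: h => n m nm x; rewrite /A/= => /negP; rewrite -leNgt => h1.
  by apply/negP; rewrite -leNgt (le_trans h1)// ler_nat.
have r1 : 1 - r < 1 by rewrite ltrBlDr ltrDl.
have [n _ /(_ n (leqnn n))] := cvgr_gt _ h _ r1.
rewrite /= /A Pr_setC; last exact: measurable_gt_rv.
by move=> hn; exists n%:R => //; rewrite /G; lra.
Qed.

Lemma tail_nonincr (y y' : R) : y <= y' -> G y' <= G y.
Proof.
move=> yy; apply: le_Pr; [exact: measurable_gt_rv..|].
by move=> x /=; exact: le_lt_trans.
Qed.

(** The generalized inverse of the tail [G]. The point 0 keeps the set nonempty, and the value 0
    outside []0, 1[] concerns a null set. *)
Definition upper_quantile (r : RT) : R :=
  if 0 < r < 1 then sup [set y | 0 <= y /\ (y = 0 \/ r < G y)] else 0.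

Lemma upper_quantile_sup (r : R) : 0 < r -> has_sup [set y | 0 <= y /\ (y = 0 \/ r < G y)].
Proof.
move=> r0; split; first by exists 0; split=> //; left.
have [K K0 hK] := tail_vanish r0; exists K => y [y0 [->//|h]].
rewrite leNgt; apply/negP => Ky; have := tail_nonincr (ltW Ky).
by rewrite leNgt (lt_trans hK).
Qed.

(** The equivalence of strict inequalities rests on right continuity of [G]; it shows that under the
    uniform law [upper_quantile] has the tail [G]. *)
Lemma upper_quantile_gt (r y : R) : 0 < r < 1 -> 0 <= y ->
  (y < upper_quantile r) = (r < G y).
Proof.
move=> r01 y0; rewrite /upper_quantile r01; have /andP[r0 r1] := r01.
apply/idP/idP => [h|h].
  have [z [z0 hz] yz] := sup_gt (upper_quantile_sup r0).1 h.
  case: hz => [z00|hz]; first by move: yz; rewrite z00 ltNge y0.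
  by apply: lt_le_trans hz _; apply: tail_nonincr; exact: ltW.
have [z yz hz] := tail_right_cts h; apply: (lt_le_trans yz).
apply: ub_le_sup; first by have [] := upper_quantile_sup r0.
by split; [exact: le_trans (ltW yz)|right].
Qed.

Lemma upper_quantile_ge0 r : 0 <= upper_quantile r.
Proof.
rewrite /upper_quantile; case: ifP => // /andP[r0 _].
by apply: ub_le_sup; [have [] := upper_quantile_sup r0|split=> //; left].
Qed.

Lemma upper_quantile_anti (r s : R) : 0 < r -> r <= s -> s < 1 ->
  upper_quantile s <= upper_quantile r.
Proof.
move=> r0 rs s1; rewrite leNgt; apply/negP => h.
have r01 : 0 < r < 1 by rewrite r0 (le_lt_trans rs).
have s01 : 0 < s < 1 by rewrite s1 (lt_le_trans r0).
have := h; rewrite upper_quantile_gt ?upper_quantile_ge0// => hs.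
have : upper_quantile r < upper_quantile r; last by rewrite ltxx.
by rewrite {2}/upper_quantile -/(upper_quantile r) upper_quantile_gt ?upper_quantile_ge0// (le_lt_trans rs).
Qed.

(** A monotone function pulls rays back to intervals. *)
Lemma measurable_unit_anti (q : RT -> R) :
  (forall r s : R, 0 < r -> r <= s -> s < 1 -> q s <= q r) ->
  (forall r : R, ~~ (0 < r < 1) -> q r = 0) -> measurable_fun setT q.
Proof.
move=> qanti q0; have -> : q = q \_ `]0, 1[.
  apply/funext => r; rewrite patchE; case: ifPn => //.
  by rewrite mem_setE in_itv/= => /q0.
have mI : measurable (`]0, 1[%classic : set R) by exact: measurable_itv.
suff mr : measurable_fun (`]0, 1[%classic : set RT) q by exact: (measurable_restrictT _ _).1.
apply: (measurability (@RGenCInfty.G R)) => [|/= _ [_] [y] -> <-].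
  exact: RGenCInfty.measurableE.
apply: is_interval_measurable => s t/=.
rewrite !in_itv/= !andbT => -[/andP[s0 s1] qs] [/andP[t0 t1] qt] u /andP[su ut].
have u01 : 0 < u < 1 by rewrite (lt_le_trans s0 su) (le_lt_trans ut t1).
rewrite in_itv/= u01 in_itv/= andbT; split=> //.
by apply: le_trans qt _; apply: qanti => //; case/andP: u01.
Qed.

Lemma measurable_upper_quantile : measurable_fun setT upper_quantile.
Proof.
apply: measurable_unit_anti; first exact: upper_quantile_anti.
by move=> r; rewrite /upper_quantile => /negPf ->.
Qed.

Lemma Ex_upper_quantile (w : R) : 0 <= w ->
  Ex (unif01 : probability RT R) (fun r => expR (- (w * upper_quantile r))) =
  Ex P (fun x => expR (- (w * Z x))).
Proof.
move=> w0; suff : (1 - Ex unif01 (fun r => expR (- (w * upper_quantile r))))%:E =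
  (1 - Ex P (fun x => expR (- (w * Z x))))%:E by move=> [] /addrI /oppr_inj.
rewrite (laplace_tail P mZ Z0 w0).
rewrite (laplace_tail unif01 measurable_upper_quantile upper_quantile_ge0 w0).
apply: eq_integral => v; rewrite inE/= in_itv/= andbT => v0.
congr (_ * _)%:E; rewrite -/(G v).
have G0 : 0 <= G v by exact: Pr_ge0.
have G1 : G v <= 1 by apply: Pr_le1; exact: measurable_gt_rv.
have -> : [set r | v < upper_quantile r] = `]0, G v[%classic.
  apply/seteqP; split=> r /=; rewrite in_itv/=.
    have [r01|r01] := boolP (0 < r < 1).
      by rewrite upper_quantile_gt// ?ltW//; case/andP: r01 => -> _ ->.
    by rewrite /upper_quantile (negPf r01) ltNge ltW.
  move=> /andP[r0 rG]; rewrite upper_quantile_gt// ?ltW//.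
  by rewrite r0 (lt_le_trans rG).
by rewrite unif01_itv// subr0.
Qed.

End Quantile.

(** * A variable whose Laplace transform is a given limit *)

Section WeakLimit.
Context {R : realType} {d : measure_display} {T : measurableType d}.
Local Notation RT := (measurableTypeR R).
Variable P : probability T R.

Lemma bounded_laplace (Z : T -> R) (w : R) : measurable_fun setT Z ->
  (forall x, 0 <= Z x) -> 0 <= w -> bounded_rv (fun x => expR (- (w * Z x))).
Proof.
move=> mZ Z0 w0; apply: bounded_rv_unit => [|x].
  apply: (measurableT_comp (@measurable_expR R)).
  by apply: measurable_funN; exact: measurable_funM.
by rewrite expR_ge0 -expR0 ler_expR oppr_le0 mulr_ge0.
Qed.

(** Markov's inequality for $1 - e^{-wZ}$, which is at least $1 - e^{-1}$ where $Z > 1/w$. *)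
Lemma laplace_markov (Z : T -> R) (w : R) : measurable_fun setT Z ->
  (forall x, 0 <= Z x) -> 0 < w ->
  (1 - expR (-1)) * Pr P [set x | w^-1 < Z x] <= 1 - Ex P (fun x => expR (- (w * Z x))).
Proof.
move=> mZ Z0 w0; have mA := measurable_gt_rv mZ w^-1.
have bl := bounded_laplace mZ Z0 (ltW w0).
have b1 := @bounded_rv_cst R _ T 1.
rewrite -Ex_indic// -ExZ; last exact: bounded_rv_indic.
have -> : 1 - Ex P (fun x => expR (- (w * Z x))) = Ex P (fun x => 1 - expR (- (w * Z x))).
  by rewrite ExB// Ex_cst.
apply: Ex_le.
- by apply: bounded_rvM; [exact: bounded_rv_cst|exact: bounded_rv_indic].
- exact: bounded_rvB.
move=> x; rewrite indicE; have [/set_mem/= h|_] := boolP (x \in _).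
  rewrite mulr1 lerD2l lerN2 ler_expR lerN2.
  by rewrite -ler_pdivrMl// mulr1 ltW.
by rewrite mulr0 subr_ge0 -expR0 ler_expR oppr_le0 mulr_ge0// ltW.
Qed.

Variables (Z : nat -> T -> R) (L : R -> R).
Hypotheses (mZ : forall n, measurable_fun setT (Z n)) (Z0 : forall n x, 0 <= Z n x).
Hypothesis LZ : forall w, 0 <= w ->
  Ex P (fun x => expR (- (w * Z n x))) @[n --> \oo] --> L w.
Hypothesis L0 : forall e : R, 0 < e -> exists2 w, 0 < w & 1 - L w < e.

(** [L0], continuity of [L] at 0, supplies a [w] for which [laplace_markov] leaves eventually at
    most mass [r] beyond [w^-1]. *)
Lemma upper_quantile_tight (r : R) : 0 < r < 1 -> exists K,
  \forall n \near \oo, upper_quantile P (Z n) r <= K.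
Proof.
move=> r01; have /andP[r0 r1] := r01.
have c0 : 0 < 1 - expR (-1) :> R by rewrite subr_gt0 -[ltRHS]expR0 ltr_expR ltrN10.
have [w w0 hw] := L0 (mulr_gt0 c0 r0).
exists w^-1; near=> n.
rewrite leNgt upper_quantile_gt ?invr_ge0 ?(ltW w0)// -leNgt.
rewrite -(ler_pM2l c0); apply: le_trans (laplace_markov _ _ _) _ => //.
rewrite lerBlDr -lerBlDl; near: n.
apply: (cvgr_ge _ (LZ (ltW w0))); lra.
Unshelve. all: by end_near. Qed.

(* By tightness the quantile functions of the [Z n] converge pointwise along an
   ultrafilter. *)
Lemma weak_limit_exists : exists2 q : RT -> R,
  measurable_fun setT q /\ (forall r, 0 <= q r) &
  forall w : R, 0 <= w -> Ex (unif01 : probability RT R) (fun r => expR (- (w * q r))) = L w.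
Proof.
pose qn n := upper_quantile P (Z n).
have [U [UU FU]] := ultraFilterLemma (eventually_filter).
have lim_ex (r : R) : exists y : R, [/\ 0 <= y, ~~ (0 < r < 1) -> y = 0 & qn n r @[n --> U] --> y].
  have [r01|r01] := boolP (0 < r < 1); last first.
    exists 0; split=> //; rewrite /qn /upper_quantile (negPf r01); exact: cvg_cst.
  have [K hK] := upper_quantile_tight r01.
  have cK : compact (`[0, K]%classic : set R) by exact: segment_compact.
  (* Compactness gives a cluster point, which is a limit because [U] is an ultrafilter. This avoids
     a diagonal choice of subsequences over all [r]. *)
  have [|y [/= yK yl]] := cK (qn n r @[n --> U]) _.
    apply: FU; apply: filterS hK => n h /=.
    by rewrite in_itv/= h upper_quantile_ge0.
  exists y; split=> //; first by move: yK; rewrite in_itv/= => /andP[].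
  move=> A yA; have [//|nA] := in_ultra_setVsetC (qn^~ r @^-1` A) UU.
  by have [z [nz Az]] := yl (~` A) A nA yA.
have [q hq] := choice lim_ex.
have q0 r : 0 <= q r by have [] := hq r.
have qout (r : R) : ~~ (0 < r < 1) -> q r = 0 by have [] := hq r.
have qlim r : qn n r @[n --> U] --> q r by have [] := hq r.
have qanti (r s : R) : 0 < r -> r <= s -> s < 1 -> q s <= q r.
  move=> r0 rs s1; apply: (ler_cvg_to (qlim s) (qlim r)).
  by apply: nearW => n; exact: upper_quantile_anti.
have mq : measurable_fun setT (q : RT -> R) by exact: measurable_unit_anti.
exists q => // w w0.
have h01 (g : RT -> R) r : 0 <= g r -> 0 <= expR (- (w * g r)) <= 1.
  by move=> g0; rewrite expR_ge0 -expR0 ler_expR oppr_le0 mulr_ge0.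
have hm (g : RT -> R) : measurable_fun setT g -> measurable_fun setT (fun r => expR (- (w * g r))).
  move=> mg; apply: (measurableT_comp (@measurable_expR R)).
  by apply: measurable_funN; exact: measurable_funM.
have hmono (g : RT -> R) : (forall r s : R, 0 < r -> r <= s -> s < 1 -> g s <= g r) ->
    forall r s : R, 0 < r -> r <= s -> s < 1 -> expR (- (w * g r)) <= expR (- (w * g s)).
  by move=> ga r s r0 rs s1; rewrite ler_expR lerN2 ler_wpM2l// ga.
(* Dominated convergence is about sequences, not ultrafilters. Riemann sums replace it: they involve
   finitely many points, and their error is uniform in [n]. *)
have key m : `|L w - Ex unif01 (fun r => expR (- (w * q r)))| <= m.+1%:R^-1 + m.+1%:R^-1.
  pose Rm (g : RT -> R) := m.+1%:R^-1 * \sum_(k < m) expR (- (w * g (k.+1%:R / m.+1%:R))).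
  have Rq := @Ex_riemann R (fun r => expR (- (w * q r))) m (hm q mq)
    (fun r => h01 q r (q0 r)) (hmono q qanti).
  have Rn n : `|Ex P (fun x => expR (- (w * Z n x))) - Rm (qn n)| <= m.+1%:R^-1.
    rewrite -Ex_upper_quantile//.
    have := @Ex_riemann R (fun r => expR (- (w * qn n r))) m; apply.
    - by apply: hm; exact: measurable_upper_quantile.
    - by move=> r; apply: h01; exact: upper_quantile_ge0.
    - by apply: hmono => r s; exact: upper_quantile_anti.
  have lR : Rm (qn n) @[n --> U] --> Rm q.
    apply: cvgM; first exact: cvg_cst.
    apply: (@cvg_big _ _ +%R); first exact: add_continuous.
    move=> k _.
    have : {for q (k.+1%:R / m.+1%:R), continuous (fun y => expR (- (w * y)))}.
      apply: continuous_comp; last exact: continuous_expR.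
      by apply: cvgN; apply: cvgM; [exact: cvg_cst|exact: cvg_id].
    move=> h; exact: (@cvg_comp _ _ _ (fun n => qn n (k.+1%:R / m.+1%:R)) _ _ _ _ (qlim _) h).
  have lA : Ex P (fun x => expR (- (w * Z n x))) @[n --> U] --> L w.
    by move=> A /(LZ w0) => h; exact: FU.
  have lD : `|Ex P (fun x => expR (- (w * Z n x))) - Rm (qn n)| @[n --> U] --> `|L w - Rm q|.
    by apply: cvg_norm; exact: cvgB.
  have h1 : `|L w - Rm q| <= m.+1%:R^-1.
    by apply: (ler_cvg_to lD (cvg_cst _)); exact: nearW.
  apply: le_trans (ler_distD (Rm q) _ _) _; apply: lerD => //.
  by rewrite distrC.
apply/esym/eqP; rewrite -subr_eq0 -normr_eq0 eq_le normr_ge0 andbT.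
apply/ler_addgt0Pr => e e0; rewrite add0r.
apply: le_trans (key (Num.truncn (e / 2)^-1)) _.
have : (Num.truncn (e / 2)^-1).+1%:R^-1 <= e / 2.
  rewrite -[leRHS]invrK lef_pV2 ?posrE ?invr_gt0 ?divr_gt0//.
  exact/ltW/truncnS_gt.
move: (Num.truncn _).+1%:R^-1 => x; lra.
Qed.

End WeakLimit.

(** * The counting process *)

Lemma expR_lip {R : realType} (a b : R) : 0 <= a -> 0 <= b ->
  `|expR (- a) - expR (- b)| <= `|a - b|.
Proof.
wlog ab : a b / a <= b => [H|a0 b0].
  move=> a0 b0; have [ab|ba] := leP a b; first exact: H.
  by rewrite distrC (distrC a); apply: H => //; exact: ltW.
have ea : expR (- a) <= 1 by rewrite -expR0 ler_expR oppr_le0.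
have h : expR (- b) <= expR (- a) by rewrite ler_expR lerN2.
rewrite ger0_norm ?subr_ge0// distrC ger0_norm ?subr_ge0//.
have -> : expR (- b) = expR (- a) * expR (- (b - a)) by rewrite -expRD; congr expR; ring.
have := expR_ge1Dx (- (b - a)); have := expR_ge0 (- a).
have ba : 0 <= b - a by rewrite subr_ge0.
move: ea; move: (expR (- a)) (expR (- (b - a))) => x y; nra.
Qed.

Lemma expR_diff_le1 {R : realType} (a b : R) : 0 <= a -> 0 <= b ->
  `|expR (- a) - expR (- b)| <= 1.
Proof.
move=> /expRN_itv/andP[a1 a2] /expRN_itv/andP[b1 b2].
rewrite ler_norml; apply/andP; split; lra.
Qed.

Lemma continuous_max0 {R : realType} : continuous (fun y : R => Num.max 0 y).
Proof.
have -> : (fun y : R => Num.max 0 y) = (fun y => 2^-1 * (y + `|y|)).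
  apply/funext => y; have [y0|y0] := leP 0 y; first by rewrite ger0_norm//; lra.
  by rewrite ltr0_norm// subrr mulr0.
move=> y; apply: cvgM; first exact: cvg_cst.
by apply: cvgD; [exact: cvg_id|apply: cvg_norm; exact: cvg_id].
Qed.

Section Counting.
Context {R : realType} {d : measure_display} {T : measurableType d}.
Variables (P : probability T R) (N : R -> {RV P >-> nat}).
Context {dQ : measure_display} {TQ : measurableType dQ}.
Variables (Q : probability TQ R) (Theta : {RV Q >-> R}).
Hypothesis hN : cvg_in_distribution P Q (fun t x => (N t x)%:R / t) (Theta : TQ -> R).

(** [Theta] is nonnegative only almost surely; this version is so everywhere, as the power and the
    bounds on Laplace kernels require. *)
Definition pos_part (x : TQ) : R := Num.max 0 (Theta x).

Lemma pos_part_ge0 x : 0 <= pos_part x. Proof. by rewrite /pos_part le_max lexx. Qed.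

Lemma measurable_pos_part : measurable_fun setT pos_part.
Proof. exact: measurable_maxr. Qed.

Lemma measurable_Nreal t : measurable_fun setT (fun x => (N t x)%:R : R).
Proof. by apply: (@measurable_fun_partition _ _ _ P (N t) _ R (fun n _ => n%:R)) => n; exact: measurable_cst. Qed.

Lemma measurable_Nratio t : measurable_fun setT (fun x => (N t x)%:R / t : R).
Proof. by apply: measurable_funM => //; exact: measurable_Nreal. Qed.

(** The test function $1 - e^{-\max(0,-y)}$ vanishes on the ratios [N t / t] and is positive for
    negative [y]; in the limit its expectation is 0. *)
Lemma Theta_ge0 : {ae Q, forall x, 0 <= Theta x}.
Proof.
pose f (y : R) := 1 - expR (- Num.max 0 (- y)).
have cf : continuous f.
  move=> y; apply: cvgB; first exact: cvg_cst.
  apply: continuous_comp; last exact: continuous_expR.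
  apply: cvgN; apply: (@continuous_comp _ _ _ -%R (fun y : R => Num.max 0 y)).
    exact: opp_continuous.
  exact: continuous_max0.
have f01 y : 0 <= f y <= 1.
  have m0 : 0 <= Num.max 0 (- y) by rewrite le_max lexx.
  by have /andP[h1 h2] := expRN_itv m0; rewrite /f subr_ge0 h2 lerBlDr lerDl ltW.
have fb : exists M : R, forall x, `|f x| <= M.
  by exists 1 => x; have /andP[h0 h1] := f01 x; rewrite ger0_norm.
have h := hN cf fb.
have E0 : 'E_Q[f \o Theta]%E = 0%E.
  have h0 : 'E_P[f \o (fun x => ((N t x)%:R / t)%R)]%E @[t --> +oo] --> 0%E.
    have c0 : (cst 0%E : R -> \bar R) @ +oo --> 0%E by exact: cvg_cst.
    apply: cvg_trans c0; apply: near_eq_cvg; near=> t.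
    have t0 : 0 < t by near: t; exact/nbhs_pinfty_gt/num_real.
    rewrite unlock integral0_eq// => x _ /=; congr EFin.
    rewrite /f max_l ?oppr0 ?expR0 ?subrr//.
    by rewrite oppr_le0 divr_ge0// ltW.
  exact: cvg_unique h h0.
have mfT : measurable_fun setT (EFin \o (f \o Theta)).
  by apply/measurable_EFinP; apply: measurableT_comp => //; exact: continuous_measurable_fun.
rewrite unlock in E0.
have : (\int[Q]_x `|(EFin \o (f \o Theta)) x| = 0)%E.
  rewrite -[RHS]E0; apply: eq_integral => x _.
  by rewrite gee0_abs//= lee_fin; case/andP: (f01 (Theta x)).
move/(ae_eq_integral_abs Q measurableT mfT).
apply: filterS => x /(_ Logic.I)/= [] hx; rewrite leNgt; apply/negP => Tx.
move: hx; rewrite /f max_r; last by rewrite oppr_ge0 ltW.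
rewrite opprK => h1.
have : expR (Theta x) < 1 by rewrite -[ltRHS]expR0 ltr_expR.
by lra.
Unshelve. all: by end_near. Qed.

Lemma laplace_Theta kappa : 0 <= kappa ->
  laplace Q Theta kappa = (Ex Q (fun x => expR (- (kappa * pos_part x))))%:E.
Proof.
move=> k0; rewrite -expectation_Ex; last first.
  exact: (bounded_laplace measurable_pos_part pos_part_ge0 k0).
rewrite /laplace unlock; apply: ae_eq_integral => //.
- apply/measurable_EFinP; apply: (measurableT_comp (@measurable_expR R)).
  by apply: measurable_funN; exact: measurable_funM.
- by apply/measurable_EFinP; have [] := bounded_laplace measurable_pos_part pos_part_ge0 k0.
- by apply: filterS Theta_ge0 => x Tx _; rewrite /pos_part max_r.
Qed.

Lemma cvg_N_laplace kappa : 0 <= kappa ->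
  Ex P (fun x => expR (- (kappa * ((N t x)%:R / t)))) @[t --> +oo] -->
  Ex Q (fun x => expR (- (kappa * pos_part x))).
Proof.
move=> k0; pose f (y : R) := expR (- (kappa * Num.max 0 y)).
have cf : continuous f.
  move=> y; apply: continuous_comp; last exact: continuous_expR.
  apply: cvgN; apply: cvgM; first exact: cvg_cst.
  exact: continuous_max0.
have f01 y : 0 <= f y <= 1.
  by rewrite /f expR_ge0 -expR0 ler_expR oppr_le0 mulr_ge0// le_max lexx.
have fb : exists M : R, forall x, `|f x| <= M.
  by exists 1 => x; have /andP[h0 h1] := f01 x; rewrite ger0_norm.
have h := hN cf fb.
have bQ : bounded_rv (f \o Theta).
  exact: (bounded_laplace measurable_pos_part pos_part_ge0 k0).
rewrite (expectation_Ex Q bQ) in h.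
have bP t : bounded_rv (f \o (fun x => (N t x)%:R / t)).
  apply: bounded_rv_unit => [|x]; last exact: f01.
  exact: (measurableT_comp (continuous_measurable_fun cf) (measurable_Nratio t)).
have {}h : (Ex P (f \o (fun x => (N t x)%:R / t)))%:E @[t --> +oo] -->
    (Ex Q (f \o Theta))%:E.
  by apply: cvg_trans h; apply: near_eq_cvg; apply: nearW => t; rewrite expectation_Ex.
move/fine_cvg : h => h.
apply: cvg_trans h; apply: near_eq_cvg; near=> t.
have t0 : 0 < t by near: t; exact/nbhs_pinfty_gt/num_real.
rewrite /=; congr (Ex P _); apply/funext => x.
by rewrite /f /= max_r// divr_ge0// ltW.
Unshelve. all: by end_near. Qed.

(** At the argument [n.+1%:R^-1] the Laplace transform of the limit is close to 1, hence also that
    of [N t / t]; [laplace_markov] turns this into a tail bound at [K = n.+1]. *)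
Lemma N_tight (e : R) : 0 < e -> exists2 K : R, 0 < K &
  \forall t \near +oo, Pr P [set x | K < (N t x)%:R / t] <= e.
Proof.
move=> e0; have c0 : 0 < 1 - expR (-1) :> R by rewrite subr_gt0 -[ltRHS]expR0 ltr_expR ltrN10.
have ce : 0 < (1 - expR (-1)) * e / 2 by rewrite divr_gt0 ?mulr_gt0.
have h : Ex Q (fun x => expR (- (n.+1%:R^-1 * pos_part x))) @[n --> \oo] --> (1 : R).
  rewrite -[X in _ --> X](Ex_cst Q 1); apply: (@cvg_Ex _ _ _ _ _ _ 1) => [n|n x|x].
  - have n0 : 0 <= n.+1%:R^-1 :> R by rewrite invr_ge0 ler0n.
    by have [] := bounded_laplace measurable_pos_part pos_part_ge0 n0.
  - rewrite ger0_norm ?expR_ge0// -[leRHS]expR0 ler_expR oppr_le0 mulr_ge0// ?invr_ge0 ?ler0n//.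
    exact: pos_part_ge0.
  - have c : {for (0 : R), continuous (fun y : R => expR (- (y * pos_part x)))}.
      apply: continuous_comp; last exact: continuous_expR.
      by apply: cvgN; apply: cvgM; [exact: cvg_id|exact: cvg_cst].
    have := @cvg_comp _ _ _ _ (fun y : R => expR (- (y * pos_part x))) _ _ _ (@cvg_harmonic R) c.
    by rewrite mul0r oppr0 expR0.
have /cvgrPdist_lt /(_ _ ce) [n _ /(_ n (leqnn n)) /= hn] := h.
exists n.+1%:R; first by rewrite ltr0n.
have n0 : 0 < n.+1%:R^-1 :> R by rewrite invr_gt0 ltr0n.
have /cvgrPdist_lt /(_ _ ce) hP := cvg_N_laplace (ltW n0).
near=> t; have t0 : 0 < t by near: t; exact/nbhs_pinfty_gt/num_real.
have Z0 x : 0 <= (N t x)%:R / t by rewrite divr_ge0// ltW.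
have := laplace_markov P (measurable_Nratio t) Z0 n0; rewrite invrK => h1.
rewrite -(ler_pM2l c0); apply: le_trans h1 _.
have h2 : `|Ex Q (fun x => expR (- (n.+1%:R^-1 * pos_part x))) -
    Ex P (fun x => expR (- (n.+1%:R^-1 * ((N t x)%:R / t))))| < (1 - expR (-1)) * e / 2.
  by near: t.
move: hn h2; rewrite !ltr_norml => /andP[_ h3] /andP[_ h4]; lra.
Unshelve. all: by end_near. Qed.

End Counting.

(** * Claims *)

Definition exceeds {R : realType} (c y : R) : R := (c < y)%R%:R.

(** On positive claims the maximum has no effect; it gives values in [[0, 1]] on the whole line, as
    [chernoff] requires. *)
Definition clip {R : realType} (c y : R) : R := Num.max 0 (Num.min (y / c) 1).

Lemma exceeds_itv {R : realType} (c y : R) : 0 <= exceeds c y <= 1.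
Proof. by rewrite /exceeds ler0n lern1 leq_b1. Qed.

Lemma clip_itv {R : realType} (c y : R) : 0 <= clip c y <= 1.
Proof. by rewrite /clip le_max lexx/= ge_max ler01 ge_min lexx orbT. Qed.

Lemma measurable_exceeds {R : realType} (c : R) : measurable_fun setT (exceeds c).
Proof.
have -> : exceeds c = \1_`]c, +oo[.
  apply/funext => y; rewrite indicE /exceeds; congr (nat_of_bool _)%:R.
  apply/idP/idP => [h|/set_mem/=]; last by rewrite in_itv/= andbT.
  by apply/mem_set; rewrite /= in_itv/= andbT.
exact: measurable_indic.
Qed.

Lemma measurable_clip {R : realType} (c : R) : measurable_fun setT (clip c).
Proof.
apply: measurable_maxr => //; apply: measurable_minr => //.
exact: measurable_funM.
Qed.

Lemma clipE {R : realType} (c y : R) : 0 < c -> 0 < y -> clip c y = Num.min (y / c) 1.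
Proof. by move=> c0 y0; rewrite /clip max_r// le_min ler01 andbT divr_ge0// ltW. Qed.

Lemma min_clip {R : realType} (c y : R) : 0 < c -> 0 < y -> Num.min y c = c * clip c y.
Proof.
move=> c0 y0; rewrite clipE// minr_pMr ?(ltW c0)// mulr1 mulrCA mulfV ?gt_eqF// mulr1.
by [].
Qed.

Lemma near_ratio_le {R : realType} (f p : R -> R) (r C : R) :
  (\forall t \near +oo, 0 < p t) -> f t / p t @[t --> +oo] --> r -> r < C ->
  \forall t \near +oo, f t <= C * p t.
Proof.
move=> p0 h rC; near=> t.
rewrite -ler_pdivrMr; last by near: t.
by near: t; exact: (cvgr_le _ h).
Unshelve. all: by end_near. Qed.

Lemma near_ratio_ge {R : realType} (f p : R -> R) (r C : R) :
  (\forall t \near +oo, 0 < p t) -> f t / p t @[t --> +oo] --> r -> C < r ->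
  \forall t \near +oo, C * p t <= f t.
Proof.
move=> p0 h rC; near=> t.
rewrite -ler_pdivlMr; last by near: t.
by near: t; exact: (cvgr_ge _ h).
Unshelve. all: by end_near. Qed.

Section Claims.
Context {R : realType} {d : measure_display} {T : measurableType d}.
Variables (P : probability T R) (alpha : R) (l F : R -> R) (X : nat -> {RV P >-> R}).
Hypothesis halpha : 0 < alpha < 1.
Hypothesis hl : slowly_varying l.
Hypothesis hXpos : forall i x, 0 < X i x.
Hypothesis hXF : forall i (y : R), cdf (X i) y = (F y)%:E.
Hypothesis hXind : mutually_independent X.
Hypothesis hF : forall x : R, 0 < x -> 1 - F x = x `^ (- alpha) * l x.
Let Fb x := 1 - F x.
Let U := tail_quantile F.

Lemma F_mono x y : x <= y -> F x <= F y.
Proof. by move=> xy; rewrite -lee_fin -!(hXF 0) cdf_nondecreasing. Qed.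

Lemma cdf_F : F = fine \o cdf (X 0%N).
Proof. by apply/funext => y /=; rewrite hXF. Qed.

Lemma F_right_cts a : F x @[x --> a^'+] --> F a.
Proof.
rewrite {1}cdf_F; apply: fine_cvg; rewrite -(hXF 0).
exact: cdf_right_continuous.
Qed.

Lemma cvg_F_pinfty : F x @[x --> +oo] --> (1 : R).
Proof. by rewrite cdf_F; apply: fine_cvg; exact: cvg_cdfy1. Qed.

Lemma F_neg x : x <= 0 -> F x = 0.
Proof.
move=> x0; apply: EFin_inj; rewrite -(hXF 0) /cdf /distribution /pushforward/=.
rewrite (_ : _ @^-1` _ = set0) ?measure0//.
apply/seteqP; split=> // w /=; rewrite in_itv/= => h.
by have := lt_le_trans (hXpos 0 w) (le_trans h x0); rewrite ltxx.
Qed.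

Lemma claim_tail i v : Pr P [set x | v < X i x] = Fb v.
Proof.
have mA : measurable [set x | X i x <= v].
  rewrite -[X in measurable X]setTI.
  exact: (measurable_fun_ler _ _ measurableT (Y := [set true])).
have -> : [set x | v < X i x] = ~` [set x | X i x <= v].
  by apply/seteqP; split=> x /=; [move=> h; apply/negP; rewrite -ltNge|move=> /negP; rewrite -ltNge].
rewrite Pr_setC//; congr (1 - _); apply: EFin_inj; rewrite -PrE// -(hXF i).
by rewrite /cdf /distribution /pushforward/=; congr (P _).
Qed.

(** Far out [l] is positive, hence so is the tail; monotonicity carries this to every [x]. *)
Lemma F_lt1 x : F x < 1.
Proof.
have [_ lpos _] := hl.
have h : \forall y \near +oo, F y < 1.
  near=> y; have y0 : 0 < y by near: y; exact/nbhs_pinfty_gt/num_real.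
  by rewrite -subr_gt0 hF// mulr_gt0 ?powR_gt0//; near: y.
have [K [_ hK]] := h; apply: (@le_lt_trans _ _ (F (Num.max x (K + 1)))).
  by apply: F_mono; rewrite le_max lexx.
by apply: hK; rewrite lt_max ltrDl ltr01 orbT.
Unshelve. all: by end_near. Qed.

Lemma Fb_rv a : 0 < a -> Fb (a * x) / Fb x @[x --> +oo] --> a `^ (- alpha).
Proof.
move=> a0; have [_ lpos /(_ a a0) hla] := hl.
have h : a `^ (- alpha) * (l (a * x) / l x) @[x --> +oo] --> a `^ (- alpha).
  by rewrite -[X in _ --> X]mulr1; apply: cvgM; [exact: cvg_cst|].
apply: cvg_trans h; apply: near_eq_cvg; near=> x.
have x0 : 0 < x by near: x; exact/nbhs_pinfty_gt/num_real.
have lx : 0 < l x by near: x.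
rewrite /Fb !hF ?mulr_gt0// powRM ?(ltW a0) ?(ltW x0)//.
have px : x `^ (- alpha) != 0 by rewrite gt_eqF// powR_gt0.
by field; rewrite px gt_eqF.
Unshelve. all: by end_near. Qed.

Let Fb_gt0 x : 0 < Fb x. Proof. exact: (tail_gt0 F_lt1). Qed.
Let Fb_anti x y : x <= y -> Fb y <= Fb x. Proof. exact: (tail_anti F_mono). Qed.
Let Fb_le1 x : Fb x <= 1. Proof. exact: (tail_le1 F_mono F_neg). Qed.

Let X0 i x : 0 <= X i x. Proof. exact/ltW/hXpos. Qed.
Let mX i : measurable_fun setT (X i). Proof. by []. Qed.

Definition claim_laplace (lam : R) : R := Ex P (fun x => expR (- (lam * X 0 x))).

(** The claims share only their distribution function; by [laplace_tail] the transform depends on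
    nothing else. *)
Lemma claim_laplaceE i lam : 0 <= lam ->
  Ex P (fun x => expR (- (lam * X i x))) = claim_laplace lam.
Proof.
move=> lam0; suff : (1 - Ex P (fun x => expR (- (lam * X i x))))%:E =
  (1 - claim_laplace lam)%:E by move=> [] /addrI /oppr_inj.
rewrite (laplace_tail P (mX i) (X0 i) lam0) (laplace_tail P (mX 0) (X0 0) lam0).
by apply: eq_integral => v _; rewrite !claim_tail.
Qed.

Definition truncated_mean (y : R) : R := Ex P (fun x => Num.min (X 0 x / y) 1).

Lemma truncated_meanE i y : 0 < y ->
  Ex P (fun x => Num.min (X i x / y) 1) = truncated_mean y.
Proof.
move=> y0; apply: EFin_inj.
have H j : (Ex P (fun x => Num.min (X j x / y) 1))%:E =
  (\int[lebesgue_measure]_(v in `]0%R, +oo[) (\1_`]0%R, 1[ v * Fb (y * v))%:E)%E.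
  rewrite (@min_tail _ _ _ P (fun x => X j x / y)).
  - by apply: eq_integral => v _; rewrite (tail_scaled (claim_tail j)).
  - exact: measurable_funM.
  - by move=> x; rewrite divr_ge0// ltW.
by rewrite /truncated_mean !H.
Qed.

Lemma Ex_tail_indic i y : Ex P (fun x => (y < X i x)%R%:R) = Fb y.
Proof.
rewrite -(claim_tail i) -Ex_indic; last exact: measurable_gt_rv.
congr (Ex P _); apply/funext => x; rewrite indicE; congr (nat_of_bool _)%:R.
by apply/idP/idP => [h|/set_mem//]; exact/mem_set.
Qed.

Let psi := stable_exponent alpha^-1.

Lemma U_pinfty : U y @[y --> +oo] --> +oo.
Proof. exact: (tail_quantile_pinfty F_mono F_lt1 F_neg F_right_cts cvg_F_pinfty). Qed.

Lemma cvg_UFb k : 0 < k -> y * Fb (k * U y) @[y --> +oo] --> k `^ (- alpha).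
Proof. by move=> k0; apply: (cvg_tail_scaled halpha F_mono F_lt1 F_neg F_right_cts cvg_F_pinfty Fb_rv). Qed.

Lemma cvg_laplace_defectU u : 0 <= u ->
  y * (1 - claim_laplace (u / U y)) @[y --> +oo] --> psi u.
Proof.
move=> u0.
have h1 := cvg_laplace_defect halpha Fb_gt0 Fb_le1 Fb_anti Fb_rv (mX 0) (X0 0) (claim_tail 0) u0.
have h2 : (1 - claim_laplace (u / U y)) / Fb (U y) @[y --> +oo] --> psi u.
  exact: (@cvg_comp _ _ _ U (fun y => (1 - claim_laplace (u / y)) / Fb y) _ _ _ U_pinfty h1).
have h3 := cvg_UFb ltr01; rewrite powR1 in h3.
have h4 : y * Fb (1 * U y) * ((1 - claim_laplace (u / U y)) / Fb (U y)) @[y --> +oo] --> psi u.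
  by rewrite -[X in _ --> X]mul1r; apply: cvgM.
apply: cvg_trans h4; apply: near_eq_cvg; apply: nearW => y.
by rewrite mul1r mulrA mulrAC mulfK// gt_eqF.
Qed.

Lemma claim_laplace_itv lam : 0 <= lam -> 0 <= claim_laplace lam <= 1.
Proof.
move=> l0; have bl := bounded_laplace (mX 0) (X0 0) l0.
apply: Ex_itv => // x.
by rewrite expR_ge0 -expR0 ler_expR oppr_le0 mulr_ge0.
Qed.

Lemma ln_le_sub1 (y : R) : 0 < y -> ln y <= y - 1.
Proof.
move=> y0; rewrite -ler_expR lnK ?posrE//.
by apply: le_trans (expR_ge1Dx (y - 1)); rewrite addrC subrK.
Qed.

(** With [z] the defect, $z \le -\ln(1-z) \le z/(1-z)$, and [z] tends to 0 because [y * z y]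
    converges. *)
Lemma cvg_log_laplace u : 0 <= u ->
  - (y * ln (claim_laplace (u / U y))) @[y --> +oo] --> psi u.
Proof.
move=> u0; pose z y := 1 - claim_laplace (u / U y).
have hz : y * z y @[y --> +oo] --> psi u by exact: cvg_laplace_defectU.
have Upos : \forall y \near +oo, 0 < U y.
  by apply: (cvgryPgt _).1; exact: U_pinfty.
have zge0 : \forall y \near +oo, 0 <= z y.
  near=> y; have U0 : 0 < U y by near: y.
  have /andP[_ h] : 0 <= claim_laplace (u / U y) <= 1.
    by apply: claim_laplace_itv; rewrite divr_ge0// ltW.
  by rewrite subr_ge0.
have psi0 : 0 <= psi u.
  have h : \forall y \near +oo, 0 <= y * z y.
    near=> y; apply: mulr_ge0; last by near: y.
    by near: y; exact/nbhs_pinfty_ge/num_real.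
  exact: (cvgr_to_ge hz h).
have z0 : z y @[y --> +oo] --> (0 : R).
  apply/cvgrPdist_le => e e0; near=> y.
  have y0 : 0 < y by near: y; exact/nbhs_pinfty_gt/num_real.
  have zy : 0 <= z y by near: y.
  have ye : (psi u + 1) / e <= y by near: y; exact/nbhs_pinfty_ge/num_real.
  have h : y * z y <= psi u + 1.
    by near: y; apply: (cvgr_le _ hz); rewrite ltrDl.
  rewrite sub0r normrN ger0_norm//; rewrite ler_pdivrMr// in ye.
  by rewrite -(ler_pM2l y0); exact: le_trans h ye.
have h1z : y * z y * (1 - z y)^-1 @[y --> +oo] --> psi u.
  rewrite -[X in _ --> X]mulr1; apply: cvgM => //.
  rewrite -[X in _ --> X]invr1; apply: cvgV => //.
  by rewrite -[X in _ --> X]subr0; apply: cvgB => //; exact: cvg_cst.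
apply: (squeeze_cvgr _ hz h1z).
near=> y.
have y0 : 0 < y by near: y; exact/nbhs_pinfty_gt/num_real.
have zy : 0 <= z y by near: y.
have z1 : z y < 1 by near: y; apply: (cvgr_lt _ z0).
have phiE : claim_laplace (u / U y) = 1 - z y by rewrite /z opprB addrCA subrr addr0.
have z1' : 0 < 1 - z y by rewrite subr_gt0.
rewrite phiE -mulrN -mulrA !ler_pM2l//; apply/andP; split.
  by have := ln_le_sub1 z1'; lra.
have z2 : 0 < (1 - z y)^-1 by rewrite invr_gt0.
have := ln_le_sub1 z2; rewrite lnV ?posrE// => h.
apply: le_trans h _; rewrite le_eqVlt; apply/orP; left; apply/eqP.
by field; rewrite gt_eqF.
Unshelve. all: by end_near. Qed.

Lemma stable_exponent0 : psi 0 = 0.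
Proof.
rewrite /psi /stable_exponent /Rintegral integral0_eq ?mulr0// => v _.
by rewrite mul0r oppr0 expR0 subrr mul0r.
Qed.

Lemma stable_exponent_ge0 u : 0 <= u -> 0 <= psi u.
Proof.
move=> u0; have hz := cvg_laplace_defectU u0.
have Upos : \forall y \near +oo, 0 < U y.
  by apply: (cvgryPgt _).1; exact: U_pinfty.
have h : \forall y \near +oo, 0 <= y * (1 - claim_laplace (u / U y)).
  near=> y; have U0 : 0 < U y by near: y.
  apply: mulr_ge0; first by near: y; exact/nbhs_pinfty_ge/num_real.
  have /andP[_ h] : 0 <= claim_laplace (u / U y) <= 1.
    by apply: claim_laplace_itv; rewrite divr_ge0// ltW.
  by rewrite subr_ge0.
exact: (cvgr_to_ge hz h).
Unshelve. all: by end_near. Qed.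

Lemma stable_exponentM (a u : R) : 0 < a -> 0 <= u -> psi (a * u) = a `^ alpha * psi u.
Proof.
exact: (stable_exponentZ halpha Fb_gt0 Fb_le1 Fb_anti Fb_rv (mX 0) (X0 0) (claim_tail 0)).
Qed.

Lemma claim_laplace_near u : 0 <= u -> \forall y \near +oo, 0 < claim_laplace (u / U y).
Proof.
move=> u0; have hz := cvg_laplace_defectU u0.
have p0 := stable_exponent_ge0 u0.
near=> y.
have y0 : 0 < y by near: y; exact/nbhs_pinfty_gt/num_real.
have ye : psi u + 1 < y by near: y; exact/nbhs_pinfty_gt/num_real.
have h : y * (1 - claim_laplace (u / U y)) <= psi u + 1.
  by near: y; apply: (cvgr_le _ hz); rewrite ltrDl.
have : y * (1 - claim_laplace (u / U y)) < y * 1 by rewrite mulr1; exact: le_lt_trans h ye.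
rewrite ltr_pM2l//; lra.
Unshelve. all: by end_near. Qed.

Lemma indep_claims_setT (J : seq nat) (B : nat -> set R) : uniq J ->
  (forall i, measurable (B i)) ->
  P (setT `&` \bigcap_(i in [set` J]) (X i @^-1` B i)) =
  (P setT * \prod_(i <- J) P (X i @^-1` B i))%E.
Proof. by move=> uJ mB; rewrite setTI hXind// probability_setT mul1e. Qed.

(** The two events belong to the independent sigma-algebras of the counting process and of the
    claims; mutual independence then splits the second. *)
Lemma indep_claims_counting (N : R -> {RV P >-> nat}) (t : R) (n : nat)
    (J : seq nat) (B : nat -> set R) :
  independent_systems P
    (sigma_of_family [set t : R | 0 <= t] (fun t => N t : T -> nat))
    (sigma_of_family [set: nat] (fun i => X i : T -> R)) ->
  0 <= t -> uniq J -> (forall i, measurable (B i)) ->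
  P ([set x | N t x = n] `&` \bigcap_(i in [set` J]) (X i @^-1` B i)) =
  (P [set x | N t x = n] * \prod_(i <- J) P (X i @^-1` B i))%E.
Proof.
move=> hNX t0 uJ mB; rewrite -hXind//; apply: hNX.
  apply: sub_sigma_algebra; exists t => //.
  by exists [set n] => //; rewrite setTI.
pose GT : set_system T := \bigcup_(i in [set: nat]) preimage_set_system setT (X i) measurable.
have mG : forall i, @measurable _ (g_sigma_algebraType GT) (X i @^-1` B i).
  move=> i; apply: sub_sigma_algebra; exists i => //.
  by exists (B i) => //; rewrite setTI.
have := @fin_bigcap_measurable _ (g_sigma_algebraType GT) _ [set` J] (fun i => X i @^-1` B i)
  (finite_seq J) (fun i _ => mG i).
exact.
Qed.

Lemma Ex_exp_claims (A : set T) (lam : R) (n : nat) : measurable A ->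
  (forall (J : seq nat) (B : nat -> set R), uniq J -> (forall i, measurable (B i)) ->
    P (A `&` \bigcap_(i in [set` J]) (X i @^-1` B i)) =
    (P A * \prod_(i <- J) P (X i @^-1` B i))%E) -> 0 <= lam ->
  Ex P (fun x => \1_A x * expR (- (lam * \sum_(i <- iota 0 n) X i x))) =
  Pr P A * claim_laplace lam ^+ n.
Proof.
move=> mA indA lam0.
have maxE i x : Num.max 0 (X i x) = X i x by rewrite max_r.
have mmax : measurable_fun setT (fun y : R => Num.max 0 y) by exact: measurable_maxr.
have max0 (y : R) : 0 <= Num.max 0 y by rewrite le_max lexx.
have h i : Ex P (fun x => expR (- (lam * Num.max 0 (X i x)))) = claim_laplace lam.
  by rewrite -(claim_laplaceE i lam0); congr (Ex P _); apply/funext => x; rewrite maxE.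
rewrite -(Ex_exp_sum mA indA n mmax max0 h lam0).
congr (Ex P _); apply/funext => x; congr (_ * expR (- (_ * _))).
by apply: eq_bigr => i _; rewrite maxE.
Qed.

(** The stable law is the weak limit of the sum of [n] claims divided by [U n], whose Laplace
    transform is [claim_laplace (w / U n) ^+ n]. *)
Lemma stable_law_exists : exists2 q : measurableTypeR R -> R,
  measurable_fun setT q /\ (forall r, 0 <= q r) &
  forall w : R, 0 <= w ->
    Ex (unif01 : probability (measurableTypeR R) R) (fun r => expR (- (w * q r))) = expR (- psi w).
Proof.
(* The norm makes [Z n] nonnegative for every [n]; positivity of [U n] is at hand for large [n]
   only. *)
pose Z n x := (\sum_(i <- iota 0 n) X i x) / `|U n%:R|.
have mS n : measurable_fun setT (fun x => \sum_(i <- iota 0 n) X i x).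
  exact: measurable_sum.
have mZ n : measurable_fun setT (Z n) by exact: measurable_funM.
have Z0 n x : 0 <= Z n x by rewrite /Z divr_ge0// sumr_ge0.
apply: (weak_limit_exists mZ Z0 (L := fun w => expR (- psi w))) => [w w0|e e0].
  have hk := (cvg_pinftyP _ _).1 (cvg_log_laplace w0) (fun n => n%:R) (cvgr_idn).
  have h : expR (- - (n%:R * ln (claim_laplace (w / U n%:R)))) @[n --> \oo] --> expR (- psi w).
    have ce : {for psi w, continuous (fun y : R => expR (- y))}.
      by apply: continuous_comp; [exact: opp_continuous|exact: continuous_expR].
    exact: (@cvg_comp _ _ _ _ (fun y => expR (- y)) _ _ _ hk ce).
  have Un : \forall n \near \oo, 0 < U n%:R /\ 0 < claim_laplace (w / U n%:R).
    have hh : \forall y \near +oo, 0 < U y /\ 0 < claim_laplace (w / U y).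
      near=> y; split; near: y; last exact: claim_laplace_near.
      by apply: (cvgryPgt _).1; exact: U_pinfty.
    exact: (@cvgr_idn R _ hh).
  apply: cvg_trans h; apply: near_eq_cvg; near=> n.
  have [U0 phi0] : 0 < U n%:R /\ 0 < claim_laplace (w / U n%:R) by near: n.
  have wU : 0 <= w / U n%:R by rewrite divr_ge0// ltW.
  have := Ex_exp_claims n measurableT indep_claims_setT wU.
  rewrite /Pr probability_setT mul1r => E.
  have E2 : Ex P (fun x => expR (- (w * Z n x))) =
      Ex P (fun x => \1_setT x * expR (- (w / U n%:R * \sum_(i <- iota 0 n) X i x))).
    congr (Ex P _); apply/funext => x; rewrite indicT mul1r /Z gtr0_norm//.
    by congr (expR (- _)); rewrite mulrCA mulrC.
  transitivity (claim_laplace (w / U n%:R) ^+ n); last by rewrite -E -E2.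
  by rewrite opprK expRM_natl lnK ?posrE.
have p1 : 0 <= psi 1 by exact: stable_exponent_ge0.
have a0 : 0 < alpha by case/andP: halpha.
(* Scaling gives $\psi(w) = w^\alpha\psi(1) = e\,\psi(1)/(\psi(1)+1) < e$, and $1 - e^{-x} \le
   x$. *)
pose w := (e / (psi 1 + 1)) `^ alpha^-1.
have q0 : 0 < e / (psi 1 + 1) by rewrite divr_gt0// ltr_pwDr.
have w0 : 0 < w by rewrite powR_gt0.
exists w => //.
rewrite -[w]mulr1 stable_exponentM// /w -powRrM mulVf ?gt_eqF// powRr1 ?(ltW q0)//.
have h := expR_ge1Dx (- (e / (psi 1 + 1) * psi 1)).
apply: (@le_lt_trans _ _ (e / (psi 1 + 1) * psi 1)); first by lra.
by rewrite -mulrA gtr_pMr// mulrC ltr_pdivrMr ?ltr_pwDr// mul1r ltrDl.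
Unshelve. all: by end_near. Qed.

(** * The sum of a random number of claims *)

Variable N : R -> {RV P >-> nat}.
Hypothesis hNX : independent_systems P
    (sigma_of_family [set t : R | 0 <= t] (fun t => N t : T -> nat))
    (sigma_of_family [set: nat] (fun i => X i : T -> R)).
Context {dQ : measure_display} {TQ : measurableType dQ}.
Variables (Q : probability TQ R) (Theta : {RV Q >-> R}).
Hypothesis hN : cvg_in_distribution P Q (fun t x => (N t x)%:R / t) (Theta : TQ -> R).

Definition total_claims (t : R) (x : T) : R := \sum_(i <- iota 0 (N t x)) X i x.

Lemma measurable_total_claims t : measurable_fun setT (total_claims t).
Proof.
apply: (@measurable_fun_partition _ _ _ P (N t) _ R
  (fun n x => \sum_(i <- iota 0 n) X i x)) => n.
exact: measurable_sum.
Qed.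

Lemma total_claims_ge0 t x : 0 <= total_claims t x.
Proof. by apply: sumr_ge0 => i _; exact/ltW/hXpos. Qed.

(** On [N t = n] the claims contribute $\varphi(\lambda)^n = e^{t\ln\varphi(\lambda)\cdot n/t}$,
    which merges with the exponential of [N t / t]. *)
Lemma Ex_exp_total_claims (t lam w : R) : 0 < t -> 0 <= lam -> 0 <= w ->
  0 < claim_laplace lam ->
  Ex P (fun x => expR (- (lam * total_claims t x + w * ((N t x)%:R / t)))) =
  Ex P (fun x => expR (- ((w - t * ln (claim_laplace lam)) * ((N t x)%:R / t)))).
Proof.
move=> t0 lam0 w0 phi0.
have Z0 x : 0 <= (N t x)%:R / t by rewrite divr_ge0// ltW.
have ln0 : 0 <= - (t * ln (claim_laplace lam)).
  rewrite oppr_ge0 pmulr_rle0// ln_le0//.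
  by have /andP[] := claim_laplace_itv lam0.
have b2 : bounded_rv (fun x => expR (- (lam * total_claims t x + w * ((N t x)%:R / t)))).
  apply: bounded_rv_unit => [|x].
    apply: measurable_expRN; apply: measurable_funD; apply: measurable_funM => //.
      exact: measurable_total_claims.
    exact: measurable_Nratio.
  have h : 0 <= lam * total_claims t x + w * ((N t x)%:R / t).
    by rewrite addr_ge0// mulr_ge0//; exact: total_claims_ge0.
  by have /andP[/ltW -> ->] := expRN_itv h.
apply: (@eq_Ex_partition _ _ _ P (N t)) => // [|n].
  by apply: bounded_laplace => //; [exact: measurable_Nratio|rewrite addr_ge0].
have E1 : (fun x => \1_[set x | N t x = n] x *
    expR (- (lam * total_claims t x + w * ((N t x)%:R / t)))) =
  (fun x => expR (- (w * (n%:R / t))) *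
    (\1_[set x | N t x = n] x * expR (- (lam * \sum_(i <- iota 0 n) X i x)))).
  apply/funext => x; rewrite indicE.
  have [/set_mem/= h|_] := boolP (x \in _); last by rewrite !mul0r mulr0.
  by rewrite !mul1r /total_claims h opprD expRD mulrC.
have E2 : (fun x => \1_[set x | N t x = n] x *
    expR (- ((w - t * ln (claim_laplace lam)) * ((N t x)%:R / t)))) =
  (fun x => (expR (- (w * (n%:R / t))) * claim_laplace lam ^+ n) * \1_[set x | N t x = n] x).
  apply/funext => x; rewrite indicE.
  have [/set_mem/= ->|_] := boolP (x \in _); last by rewrite !mul0r mulr0.
  rewrite mulr1 mul1r mulrBl opprB addrC expRD; congr (_ * _).
  rewrite (_ : t * _ * (n%:R / t) = n%:R * ln (claim_laplace lam)); last first.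
    by field; rewrite gt_eqF.
  by rewrite expRM_natl lnK ?posrE.
have mA := measurable_Neq (N t) n.
rewrite E1 E2 !ExZ; [|exact: bounded_rv_indic|]; last first.
  apply: bounded_rvM; first exact: bounded_rv_indic.
  apply: bounded_laplace => // [|x]; first exact: measurable_sum.
  by apply: sumr_ge0 => i _; exact/ltW/hXpos.
rewrite (Ex_exp_claims n mA) ?Ex_indic//; first by rewrite mulrCA mulrC mulrA.
by move=> J B; exact: (indep_claims_counting n hNX (ltW t0)).
Qed.

(** The coefficient [kap t] of [N t / t] varies with [t]. On the event [N t / t <= K], of
    probability near 1 by tightness, exchanging it for its limit costs at most [K] times their
    distance. *)
Lemma cvg_total_claims (u w : R) : 0 <= u -> 0 <= w ->
  Ex P (fun x => expR (- (u / U t * total_claims t x + w * ((N t x)%:R / t)))) @[t --> +oo] -->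
  Ex Q (fun x => expR (- ((psi u + w) * pos_part Theta x))).
Proof.
move=> u0 w0.
have psi0 : 0 <= psi u by exact: (stable_exponent_ge0 u0).
have k0 : 0 <= psi u + w by rewrite addr_ge0.
pose kap t := w - t * ln (claim_laplace (u / U t)).
have hk : kap t @[t --> +oo] --> psi u + w.
  rewrite addrC; apply: cvgD; first exact: cvg_cst.
  exact: (cvg_log_laplace u0).
have H : Ex P (fun x => expR (- (kap t * ((N t x)%:R / t)))) @[t --> +oo] -->
  Ex Q (fun x => expR (- ((psi u + w) * pos_part Theta x))).
  apply/cvgrPdist_le => e e0.
  have e3 : 0 < e / 3 by rewrite divr_gt0.
  have [K K0 hK] := N_tight hN e3.
  have d0 : 0 < e / 3 / K by rewrite divr_gt0.
  have /cvgrPdist_le /(_ _ e3) h1 := cvg_N_laplace hN k0.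
  have /cvgrPdist_le /(_ _ d0) h2 := hk.
  near=> t; have t0 : 0 < t by near: t; exact/nbhs_pinfty_gt/num_real.
  have Z0 x : 0 <= (N t x)%:R / t by rewrite divr_ge0// ltW.
  have U0 : 0 < U t by near: t; apply: (cvgryPgt _).1; exact: U_pinfty.
  have phi0 : 0 < claim_laplace (u / U t).
    by near: t; exact: (claim_laplace_near u0).
  have kt0 : 0 <= kap t.
    rewrite addr_ge0// oppr_ge0 pmulr_rle0// ln_le0//.
    have uU : 0 <= u / U t by rewrite divr_ge0// ltW.
    by have /andP[] := claim_laplace_itv uU.
  have h1t : `|Ex Q (fun x => expR (- ((psi u + w) * pos_part Theta x))) -
      Ex P (fun x => expR (- ((psi u + w) * ((N t x)%:R / t))))| <= e / 3 by near: t.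
  have h2t : `|psi u + w - kap t| <= e / 3 / K by near: t.
  have hKt : Pr P [set x | K < (N t x)%:R / t] <= e / 3 by near: t.
  have mA := measurable_gt_rv (measurable_Nratio N t) K.
  have bl kappa : 0 <= kappa -> bounded_rv (fun x => expR (- (kappa * ((N t x)%:R / t)))).
    by move=> ?; apply: bounded_laplace => //; exact: measurable_Nratio.
  have h3 : `|Ex P (fun x => expR (- ((psi u + w) * ((N t x)%:R / t)))) -
      Ex P (fun x => expR (- (kap t * ((N t x)%:R / t))))| <= e / 3 + e / 3.
    apply: (@le_trans _ _ (Ex P (fun x => e / 3 + \1_[set x | K < (N t x)%:R / t] x))).
      apply: normr_ExB; [exact: bl|exact: bl| |].
        by apply: bounded_rvD; [exact: bounded_rv_cst|exact: bounded_rv_indic].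
      move=> x; rewrite indicE; have [/set_mem/= h|h] := boolP (x \in _).
        apply: le_trans (expR_diff_le1 (mulr_ge0 k0 (Z0 x)) (mulr_ge0 kt0 (Z0 x))) _.
        by rewrite lerDr ltW.
      have {}h : (N t x)%:R / t <= K by rewrite leNgt; apply: contra h => /mem_set.
      rewrite addr0; apply: le_trans (expR_lip (mulr_ge0 k0 (Z0 x)) (mulr_ge0 kt0 (Z0 x))) _.
      rewrite -mulrBl normrM (ger0_norm (Z0 x)).
      apply: le_trans (ler_pM _ _ h2t h) _ => //.
      by rewrite divfK// gt_eqF.
    rewrite ExD; [|exact: bounded_rv_cst|exact: bounded_rv_indic].
    by rewrite Ex_cst Ex_indic// lerD2l.
  rewrite (_ : e = e / 3 + (e / 3 + e / 3)); last by field.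
  by apply: le_trans (ler_distD _ _ _) (lerD h1t h3).
apply: cvg_trans H; apply: near_eq_cvg; near=> t.
have t0 : 0 < t by near: t; exact/nbhs_pinfty_gt/num_real.
have U0 : 0 < U t by near: t; apply: (cvgryPgt _).1; exact: U_pinfty.
have phi0 : 0 < claim_laplace (u / U t).
  by near: t; exact: (claim_laplace_near u0).
by rewrite Ex_exp_total_claims// divr_ge0// ltW.
Unshelve. all: by end_near. Qed.

(** * Intermediate and small claims *)

Variable p : R -> R.
Hypothesis hp0 : p t @[t --> +oo] --> (0 : R).
Hypothesis hp1 : t * p t @[t --> +oo] --> +oo.
Let b t := U (p t)^-1.

Lemma near_p_gt0 : \forall t \near +oo, 0 < p t.
Proof.
near=> t; have t0 : 0 < t by near: t; exact/nbhs_pinfty_gt/num_real.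
by rewrite -(pmulr_rgt0 _ t0); near: t; exact: (cvgryPgt _).1.
Unshelve. all: by end_near. Qed.

Lemma cvg_pV : (p t)^-1 @[t --> +oo] --> +oo.
Proof. exact: (cvgrVy near_p_gt0).2 hp0. Qed.

Lemma cvg_exceeds k : 0 < k -> Fb (k * b t) / p t @[t --> +oo] --> k `^ (- alpha).
Proof.
move=> k0; have h := cvg_UFb k0.
have := @cvg_comp _ _ _ (fun t => (p t)^-1) (fun y => y * Fb (k * U y)) _ _ _ cvg_pV h.
by under eq_fun do rewrite /= mulrC.
Qed.

Lemma near_b_gt0 : \forall t \near +oo, 0 < b t.
Proof.
have h : \forall y \near +oo, 0 < U y.
  by apply: (cvgryPgt _).1; exact: U_pinfty.
exact: (cvg_pV h).
Qed.

Lemma cvg_clip k : 0 < k ->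
  truncated_mean (k * b t) / p t @[t --> +oo] --> (1 - alpha)^-1 * k `^ (- alpha).
Proof.
move=> k0; have h := cvg_truncated_mean halpha Fb_gt0 Fb_le1 Fb_anti Fb_rv (mX 0) (X0 0) (claim_tail 0).
have hb : k * b t @[t --> +oo] --> +oo.
  apply: gt0_cvgMry => //.
  exact: (@cvg_comp _ _ _ (fun t => (p t)^-1) U _ _ _ cvg_pV U_pinfty).
have h2 : truncated_mean (k * b t) / Fb (k * b t) @[t --> +oo] --> (1 - alpha)^-1.
  exact: (@cvg_comp _ _ _ (fun t => k * b t) (fun y => truncated_mean y / Fb y) _ _ _ hb h).
have h3 : truncated_mean (k * b t) / Fb (k * b t) * (Fb (k * b t) / p t) @[t --> +oo] -->
    (1 - alpha)^-1 * k `^ (- alpha).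
  by apply: cvgM => //; exact: cvg_exceeds.
apply: cvg_trans h3; apply: near_eq_cvg; apply: nearW => t.
by rewrite mulrA divfK// gt_eqF.
Qed.

(** The means leave room for a relative error [delta], so that concentration yields the premises of
    [order_stat_bounds]. The squares become the cubes there after multiplication by the cap
    [(1 + e) * b t] or [(1 - e) * b t]. The bounds [p t / 4] make all conditional means at least
    [M / 4] once [N t * p t] is at least [M]. *)
Definition mean_bounds (e delta t : R) : Prop :=
  [/\ p t / 4 <= Fb ((1 + e) * b t) /\ (1 + delta) * Fb ((1 + e) * b t) <= p t,
      p t / 4 <= Fb ((1 - e) * b t) /\ p t <= (1 - delta) * Fb ((1 - e) * b t),
      p t / 4 <= truncated_mean ((1 + e) * b t) /\
      (1 + delta) * truncated_mean ((1 + e) * b t) <= p t * ((1 + e) ^+ 2 / (1 - alpha)) &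
      p t / 4 <= truncated_mean ((1 - e) * b t) /\
      p t * ((1 - e) ^+ 2 / (1 - alpha)) <= (1 - delta) * truncated_mean ((1 - e) * b t)].

(** One side suffices at each level: upper deviations above [b t], lower deviations below it. *)
Definition claims_deviate (e delta M t : R) : set T :=
  (deviation X (N t) (exceeds ((1 + e) * b t)) (Fb ((1 + e) * b t)) delta M (delta / 4) `|`
   deviation X (N t) (exceeds ((1 - e) * b t)) (Fb ((1 - e) * b t)) delta M (- (delta / 4))) `|`
  (deviation X (N t) (clip ((1 + e) * b t)) (truncated_mean ((1 + e) * b t)) delta M (delta / 4) `|`
   deviation X (N t) (clip ((1 - e) * b t)) (truncated_mean ((1 - e) * b t)) delta M (- (delta / 4))).

Lemma Pr_claims_deviate (e delta M t : R) : 0 <= t -> 0 < b t -> 0 < e <= 2^-1 ->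
  0 < delta <= 1 -> measurable (claims_deviate e delta M t) /\
  Pr P (claims_deviate e delta M t) <= 4 * expR (- (M * (delta ^+ 2 / 8))).
Proof.
move=> t0 b0 /andP[e0 e2] d01.
have indN n J B := @indep_claims_counting N t n J B hNX t0.
have d4 : `|delta / 4| = delta / 4 by rewrite gtr0_norm// divr_gt0//; case/andP: d01.
have d4' : `|- (delta / 4)| = delta / 4 by rewrite normrN.
have cp : 0 < (1 + e) * b t by rewrite mulr_gt0//; lra.
have cm : 0 < (1 - e) * b t by rewrite mulr_gt0//; lra.
have mclip c i : 0 < c -> Ex P (clip c \o X i) = truncated_mean c.
  move=> c0; rewrite -(truncated_meanE i c0); congr (Ex P _).
  by apply/funext => x; rewrite /= clipE.
have D1 := Pr_deviation indN M (measurable_exceeds _) (exceeds_itv _)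
  (Ex_tail_indic ^~ ((1 + e) * b t)) d01 d4.
have D2 := Pr_deviation indN M (measurable_exceeds _) (exceeds_itv _)
  (Ex_tail_indic ^~ ((1 - e) * b t)) d01 d4'.
have D3 := Pr_deviation indN M (measurable_clip _) (clip_itv _) (mclip _ ^~ cp) d01 d4.
have D4 := Pr_deviation indN M (measurable_clip _) (clip_itv _) (mclip _ ^~ cm) d01 d4'.
have m1 c m s := measurable_deviation X (N t) m delta M (measurable_exceeds c) s.
have m2 c m s := measurable_deviation X (N t) m delta M (measurable_clip c) s.
have U1 A B (x y : R) : measurable A /\ Pr P A <= x -> measurable B /\ Pr P B <= y ->
    measurable (A `|` B) /\ Pr P (A `|` B) <= x + y.
  move=> [mA hA] [mB hB]; split; first exact: measurableU.
  by apply: le_trans (Pr_setU P mA mB) _; exact: lerD.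
rewrite (_ : 4 * expR _ = expR (- (M * (delta ^+ 2 / 8))) + expR (- (M * (delta ^+ 2 / 8))) +
  (expR (- (M * (delta ^+ 2 / 8))) + expR (- (M * (delta ^+ 2 / 8))))); last by ring.
by apply: (U1 _ _ _ _ (U1 _ _ _ _ _ _) (U1 _ _ _ _ _ _)).
Qed.

Lemma claims_close (t e delta : R) (M : nat) (x : T) :
  0 < p t < 1 -> 0 < b t -> 0 < e <= 2^-1 -> 0 < delta <= 1 -> 1 <= e * M%:R ->
  (M <= trim (fun t => N t : T -> nat) p t x)%N ->
  mean_bounds e delta t -> ~ claims_deviate e delta (M%:R / 4) t x ->
  let n := (N t x)%:R in
  [/\ (1 - e) * b t <= mid_claim X N p t x <= (1 + e) * b t,
      0 <= small_claims X N p t x,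
      `|small_claims X N p t x - n * p t * b t * ((1 - alpha)^-1 - 1)| <=
        n * p t * b t * (e * (8 / (1 - alpha))) &
      total_claims t x =
        small_claims X N p t x + mid_claim X N p t x + large_claims X N p t x].
Proof.
move=> /andP[p0 p1] b0 /andP[e0 e2] d01 eM Mtr [[q1 r1] [q2 r2] [q3 r3] [q4 r4]].
move=> /not_orP[/not_orP[D1 D2] /not_orP[D3 D4]] n.
have /andP[d0 d1] := d01.
have e1 : 0 < 1 - e by lra.
have e1' : 0 < 1 + e by lra.
have n0 : 0 <= n by exact: ler0n.
have pn0 : 0 <= p t * n by rewrite mulr_ge0// ltW.
have /andP[t1 _] := truncn_itv pn0.
have Mn : M%:R <= n * p t.
  by rewrite mulrC; apply: le_trans t1; rewrite ler_nat.
have Mq (q : R) : p t / 4 <= q -> M%:R / 4 <= n * q.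
  move=> hq; apply: le_trans (ler_wpM2l n0 hq); rewrite mulrA ler_pM2r//.
have E1 := deviation_upper d01 D1 (Mq _ q1).
have E2 := deviation_lower d01 D2 (Mq _ q2).
have E3 := deviation_upper d01 D3 (Mq _ q3).
have E4 := deviation_lower d01 D4 (Mq _ q4).
pose xs := [seq X i x | i <- iota 0 (N t x)].
have sxs : size xs = N t x by rewrite size_map size_iota.
have xs0 y : y \in xs -> 0 < y by move=> /mapP[i _ ->].
have cmin c : 0 < c -> \sum_(y <- xs) Num.min y c =
    c * \sum_(i <- iota 0 (N t x)) clip c (X i x).
  move=> c0; rewrite big_map mulr_sumr; apply: eq_bigr => i _.
  by rewrite min_clip.
(* [p t < 1] keeps the trimmed number below [N t x], which is positive because [1 <= e * M] and
   [M <= N t x * p t]. *)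
have kgt0 : (0 < N t x - trim (fun t => N t : T -> nat) p t x)%N.
  rewrite subn_gt0 -(ltr_nat R); apply: le_lt_trans t1 _.
  rewrite gtr_pMl// lt_neqAle n0 andbT eq_sym; apply/eqP => n00.
  by move: eM Mn; rewrite n00 mul0r; nra.
have := @order_stat_bounds R xs xs0 (p t) (b t) e (1 - alpha)
  (N t x - trim (fun t => N t : T -> nat) p t x).
rewrite sxs -/n; case => //.
- by have /andP[a0 a1] := halpha; apply/andP; split; lra.
- by rewrite e0.
- apply: le_trans eM _; by rewrite ler_pM2l.
- rewrite big_map; apply: le_trans (ltW E1) _.
  by rewrite mulrCA ler_wpM2l.
- rewrite big_map; apply: le_lt_trans E2.
  by rewrite mulrCA ler_wpM2l.
- rewrite cmin ?mulr_gt0//; apply: le_trans (ler_wpM2l _ (ltW E3)) _.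
    by rewrite ltW// mulr_gt0.
  rewrite (_ : (1 + e) * b t * _ = n * b t * (1 + e) *
    ((1 + delta) * truncated_mean ((1 + e) * b t))); last by ring.
  rewrite (_ : n * p t * b t * _ = n * b t * (1 + e) *
    (p t * ((1 + e) ^+ 2 / (1 - alpha)))); last by rewrite exprS; ring.
  by rewrite ler_wpM2l// !mulr_ge0// ltW.
- rewrite cmin ?mulr_gt0//; apply: le_trans (ler_wpM2l _ (ltW E4)).
    rewrite (_ : (1 - e) * b t * _ = n * b t * (1 - e) *
      ((1 - delta) * truncated_mean ((1 - e) * b t))); last by ring.
    rewrite (_ : n * p t * b t * _ = n * b t * (1 - e) *
      (p t * ((1 - e) ^+ 2 / (1 - alpha)))); last by rewrite exprS; ring.
    by rewrite ler_wpM2l// !mulr_ge0// ltW.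
  by rewrite ltW// mulr_gt0.
move=> G1 G2 G3; split => //.
rewrite /total_claims -(big_map (fun i => X i x) xpredT id).
rewrite (@sum_sort_split _ xs (N t x - trim (fun t => N t : T -> nat) p t x)).
  by rewrite sxs.
by rewrite sxs kgt0 leq_subr.
Qed.

(** Potter's bound at [U t] with [eta = b t / U t]: since [Fb (U t) <= t^-1] and
    [Fb (b t) > p t / 2], it gives $t\,p(t) \le 2C\eta^{-\beta}$, so $\eta =
    O((t\,p(t))^{-1/\beta})$. As $\beta < 1$, the product $t\,p(t)\,\eta$ still tends to 0. *)
Lemma cvg_ratio_U : t * p t * b t / U t @[t --> +oo] --> (0 : R).
Proof.
have /andP[a0 a1] := halpha.
pose beta := (alpha + 1) / 2.
have ab : alpha < beta by rewrite /beta; lra.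
have b1 : beta < 1 by rewrite /beta; lra.
have b0 : 0 < beta by rewrite /beta; lra.
have [C [X1 [C0 X10 hC]]] := potter halpha Fb_gt0 Fb_le1 Fb_anti Fb_rv ab.
have hb : (p t)^-1 * Fb (U ((p t)^-1)) @[t --> +oo] --> (1 : R).
  have h3 := cvg_UFb ltr01; rewrite powR1 in h3.
  have {}h3 : y * Fb (U y) @[y --> +oo] --> (1 : R) by under eq_fun do rewrite -[U _]mul1r.
  exact: (@cvg_comp _ _ _ (fun t => (p t)^-1) (fun y => y * Fb (U y)) _ _ _ cvg_pV h3).
pose D := (2 * C) `^ beta^-1.
have h0 : D * (t * p t) `^ (- (beta^-1 - 1)) @[t --> +oo] --> (0 : R).
  rewrite -[X in _ --> X](mulr0 D); apply: cvgM; first exact: cvg_cst.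
  have bb : 0 < beta^-1 - 1 by rewrite subr_gt0 invf_gt1.
  exact: (@cvg_comp _ _ _ (fun t => t * p t) _ _ _ _ hp1 (cvg_powRN_pinfty bb)).
apply: (@squeeze_cvgr _ _ _ _ (cst 0) (fun t => D * (t * p t) `^ (- (beta^-1 - 1)))) h0.
- near=> t.
  have t1 : 1 < t by near: t; exact/nbhs_pinfty_gt/num_real.
  have t0 : 0 < t := lt_trans ltr01 t1.
  have p0 : 0 < p t by near: t; exact: near_p_gt0.
  have tp0 : 0 < t * p t by rewrite mulr_gt0.
  have U0 : 0 < U t by near: t; apply: (cvgryPgt _).1; exact: U_pinfty.
  have UX : X1 <= U t by near: t; apply: (cvgryPge _).1; exact: U_pinfty.
  have B0 : 0 < b t by near: t; exact: near_b_gt0.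
  have Fbb : 2^-1 < (p t)^-1 * Fb (b t).
    by near: t; apply: (cvgr_gt _ hb); rewrite invf_lt1// ltr1n.
  move: B0 Fbb; rewrite -/(b t); move: (b t) => c B0 Fbb.
  have FU : Fb (U t) <= t^-1.
    exact: (tail_quantile_ge F_mono F_neg F_right_cts cvg_F_pinfty t1).
  have tp2 : 2 < t * p t by near: t; exact: (cvgryPgt _).1.
  have FB : p t / 2 < Fb c by move: Fbb; rewrite ltr_pdivlMl.
  (* Otherwise [p t / 2 < t^-1], against [2 < t * p t]. This is [eta <= 1], required by [hC]. *)
  have bU : c <= U t.
    rewrite leNgt; apply/negP => /ltW/Fb_anti h.
    have : p t / 2 < t^-1 by apply: lt_le_trans FB (le_trans h FU).
    rewrite -(ltr_pM2l t0) mulfV ?gt_eqF//; lra.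
  rewrite /cst divr_ge0 ?mulr_ge0 ?(ltW t0) ?(ltW p0) ?(ltW B0) ?(ltW U0)//=.
  pose eta := c / U t.
  have e0 : 0 < eta by rewrite divr_gt0.
  have e1 : eta <= 1 by rewrite /eta ler_pdivrMr// mul1r.
  have := hC (U t) eta UX; rewrite e0 e1 /eta mulrC divfK ?gt_eqF// -/eta => /(_ isT) h.
  have h2 : t * p t <= 2 * C * eta `^ (- beta).
    have : p t / 2 <= C * eta `^ (- beta) * t^-1.
      apply: le_trans (ltW FB) (le_trans h _).
      by rewrite ler_pM2l// mulr_gt0// powR_gt0.
    rewrite -(ler_pM2l t0) (mulrC _ t^-1) (mulrA t t^-1) mulfV ?gt_eqF// mul1r.
    by move: (eta `^ (- beta)) => z; lra.
  have h3 : eta `^ beta <= 2 * C / (t * p t).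
    rewrite powRN ler_pdivlMr ?powR_gt0// in h2.
    by rewrite ler_pdivlMr// mulrC.
  have h4 : eta <= D * (t * p t) `^ (- beta^-1).
    have -> : eta = (eta `^ beta) `^ beta^-1 by rewrite -powRrM mulfV ?gt_eqF// powRr1// ltW.
    have -> : (t * p t) `^ (- beta^-1) = (t * p t)^-1 `^ beta^-1.
      by rewrite -(powR_inv1 (ltW tp0)) -powRrM mulN1r.
    rewrite /D -powRM ?mulr_ge0 ?invr_ge0 ?(ltW C0) ?(ltW tp0)//.
    have h5 : 0 <= 2 * C / (t * p t) by exact: le_trans (powR_ge0 _ _) h3.
    by apply: ge0_ler_powR; rewrite ?nnegrE ?powR_ge0// invr_ge0 ltW.
  have -> : - (beta^-1 - 1) = 1 + - beta^-1 by ring.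
  have E : (t * p t) `^ (1 + - beta^-1) = t * p t * (t * p t) `^ (- beta^-1).
    by rewrite powRD ?powRr1 ?(ltW tp0)//; apply/implyP => _; rewrite gt_eqF.
  rewrite E (mulrCA D) -(mulrA (t * p t) c) ler_pM2l//.
- exact: cvg_cst.
Unshelve. all: by end_near. Qed.

(** After division by [p t] the exceedance probabilities tend to $(1 \pm e)^{-\alpha}$, strictly on
    the required sides of 1, and [delta] is fitted into these gaps. The truncated means carry the
    extra factor $1/(1-\alpha)$ on both sides of the comparison. *)
Lemma good_means (e : R) : 0 < e <= 2^-1 -> exists2 delta : R, 0 < delta <= 1 &
  \forall t \near +oo, mean_bounds e delta t.
Proof.
move=> /andP[e0 e2]; have /andP[a0 a1] := halpha.
have e1 : 0 < 1 + e by lra.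
have e1' : 0 < 1 - e by lra.
set u := (1 + e) `^ (- alpha); set v := (1 - e) `^ (- alpha).
have one_powR : 1 `^ alpha = 1 by rewrite powR1.
have u1 : u < 1.
  rewrite /u powRN invf_lt1 ?powR_gt0// -[ltLHS]one_powR.
  by apply: gt0_ltr_powR => //; rewrite ?nnegrE; lra.
(* As [alpha < 1], [u] is at least $1/(1+e)$, and [e <= 2^-1]. *)
have u4 : 4^-1 < u.
  apply: (@lt_le_trans _ _ ((1 + e) `^ (-1))).
    rewrite powR_inv1 ?ltW// ltf_pV2 ?posrE//; lra.
  by apply: ler_powR; lra.
have v1 : 1 < v.
  have h : (1 - e) `^ alpha < 1.
    rewrite -[ltRHS]one_powR; apply: gt0_ltr_powR => //; rewrite ?nnegrE; lra.
  by rewrite /v powRN invf_gt1 ?powR_gt0.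
have u0 : 0 < u by rewrite powR_gt0.
have v0 : 0 < v by rewrite powR_gt0.
have [delta [d0 d1 d2 d3]] : exists delta, [/\ 0 < delta, delta <= 2^-1,
    (1 + delta) * u < 1 & 1 < (1 - delta) * v].
  have w1 : 0 < (u^-1 - 1) / 2 by rewrite divr_gt0// subr_gt0 invf_gt1.
  have w2 : 0 < (1 - v^-1) / 2 by rewrite divr_gt0// subr_gt0 invf_lt1.
  exists (Num.min 2^-1 (Num.min ((u^-1 - 1) / 2) ((1 - v^-1) / 2))).
  set D := Num.min _ _.
  have D0 : 0 < D by rewrite !lt_min w1 w2 invr_gt0 ltr0n.
  have [D1 D2 D3] : [/\ D <= 2^-1, D <= (u^-1 - 1) / 2 & D <= (1 - v^-1) / 2].
    by rewrite /D !ge_min !lexx !orbT.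
  split => //.
    by rewrite -ltr_pdivlMr// mul1r; lra.
  by rewrite -ltr_pdivrMr// mul1r; lra.
exists delta; first by rewrite d0; lra.
have p0 := near_p_gt0.
have al0 : 0 < 1 - alpha by rewrite subr_gt0.
have al1 : 1 <= (1 - alpha)^-1 by rewrite invf_ge1//; lra.
have de0 : 0 < 1 + delta by lra.
have de1 : 0 < 1 - delta by lra.
have h1 := cvg_exceeds e1.
have h2 := cvg_exceeds e1'.
have h3 := cvg_clip e1.
have h4 := cvg_clip e1'.
have e21 : 1 <= (1 + e) ^+ 2 by rewrite expr2; nra.
have e22 : (1 - e) ^+ 2 <= 1 by rewrite expr2; nra.
have c1 : u < (1 + delta)^-1 by rewrite -[ltRHS]mul1r ltr_pdivlMr// mulrC.
have c2 : (1 - delta)^-1 < v by rewrite -[ltLHS]mul1r ltr_pdivrMr// mulrC.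
have c3 : 4^-1 < v by apply: lt_trans v1; rewrite invf_lt1 ?ltr1n.
have c4 : 4^-1 < (1 - alpha)^-1 * u.
  by apply: lt_le_trans u4 _; rewrite ler_peMl// ltW.
have c5 : 4^-1 < (1 - alpha)^-1 * v.
  by apply: lt_le_trans c3 _; rewrite ler_peMl// ltW.
have c6 : (1 - alpha)^-1 * u < (1 + delta)^-1 * ((1 + e) ^+ 2 / (1 - alpha)).
  rewrite mulrA mulrC ltr_pM2r ?invr_gt0//; apply: lt_le_trans c1 _.
  by rewrite ler_peMr// invr_ge0 ltW.
have c7 : (1 - delta)^-1 * ((1 - e) ^+ 2 / (1 - alpha)) < (1 - alpha)^-1 * v.
  rewrite mulrA mulrC ltr_pM2l ?invr_gt0//; apply: le_lt_trans c2.
  by rewrite ler_piMr// invr_ge0 ltW.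
near=> t.
have g1 : 4^-1 * p t <= Fb ((1 + e) * b t) by near: t; exact: (near_ratio_ge p0 h1).
have g2 : Fb ((1 + e) * b t) <= (1 + delta)^-1 * p t by near: t; exact: (near_ratio_le p0 h1).
have g3 : 4^-1 * p t <= Fb ((1 - e) * b t) by near: t; exact: (near_ratio_ge p0 h2).
have g4 : (1 - delta)^-1 * p t <= Fb ((1 - e) * b t) by near: t; exact: (near_ratio_ge p0 h2).
have g5 : 4^-1 * p t <= truncated_mean ((1 + e) * b t).
  by near: t; exact: (near_ratio_ge p0 h3).
have g6 : truncated_mean ((1 + e) * b t) <= (1 + delta)^-1 * ((1 + e) ^+ 2 / (1 - alpha)) * p t.
  by near: t; exact: (near_ratio_le p0 h3).
have g7 : 4^-1 * p t <= truncated_mean ((1 - e) * b t).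
  by near: t; exact: (near_ratio_ge p0 h4).
have g8 : (1 - delta)^-1 * ((1 - e) ^+ 2 / (1 - alpha)) * p t <= truncated_mean ((1 - e) * b t).
  by near: t; exact: (near_ratio_ge p0 h4).
split; split; rewrite 1?(mulrC (p t)) //.
- by rewrite -ler_pdivlMl.
- by rewrite -ler_pdivrMl.
- by rewrite -ler_pdivlMl// mulrA.
- by rewrite -ler_pdivrMl// mulrA.
Unshelve. all: by end_near. Qed.

(** By [nth_sort_le] the preimage of a ray is an event on a count of claims; ranks outside [1..n]
    give the default 0. *)
Lemma measurable_order_stat n r : measurable_fun setT (order_stat (fun i => X i : T -> R) n r).
Proof.
have [rn|rn] := boolP (0 < r <= n)%N; last first.
  rewrite (_ : order_stat _ _ _ = fun=> 0); first exact: measurable_cst.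
  apply/funext => x; rewrite /order_stat; case: r rn => // r; rewrite -ltnNge /= => rn.
  by rewrite nth_default// size_sort size_map size_iota.
apply: (measurability _ (RGenOInfty.measurableE R)) => _ [_] [y] -> <-.
rewrite setTI (_ : _ @^-1` _ = ~` [set x | r%:R <= \sum_(i <- iota 0 n) (X i x <= y)%R%:R :> R]).
  apply: measurableC; apply: measurable_le_rv => //.
  apply: measurable_sum => i.
  have -> : (fun x => (X i x <= y)%R%:R) = \1_[set x | X i x <= y] :> (T -> R).
    apply/funext => x; rewrite indicE; congr (nat_of_bool _)%:R.
    by apply/idP/idP => [h|/set_mem//]; exact/mem_set.
  by apply: measurable_indic; exact: measurable_le_rv.
apply/seteqP; split=> x /=; rewrite in_itv/= andbT.
  move=> h; apply/negP; rewrite -ltNge -natr_sum ltr_nat.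
  move: h; rewrite ltNge /order_stat nth_sort_le ?size_map ?size_iota// -ltnNge.
  by rewrite count_map -sum1_count big_mkcond.
move=> /negP; rewrite -ltNge -natr_sum ltr_nat => h.
rewrite ltNge /order_stat nth_sort_le ?size_map ?size_iota// -ltnNge.
by rewrite count_map -sum1_count big_mkcond.
Qed.

Lemma order_stat_ge0 n r x : 0 <= order_stat (fun i => X i : T -> R) n r x.
Proof. by apply: nth_sort_ge0 => y /mapP[i _ ->]. Qed.

Let V t x := (large_claims X N p t x / U t, mid_claim X N p t x / b t,
              small_claims X N p t x / (t * p t * b t)).

Lemma random_nonneg3_claims : \forall t \near +oo, random_nonneg3 (V t).
Proof.
near=> t.
have t0 : 0 < t by near: t; exact/nbhs_pinfty_gt/num_real.
have p0 : 0 < p t by near: t; exact: near_p_gt0.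
have b0 : 0 < b t by near: t; exact: near_b_gt0.
have U0 : 0 < U t by near: t; apply: (cvgryPgt _).1; exact: U_pinfty.
split=> [| | |x].
- apply: measurable_funM => //.
  apply: (@measurable_fun_partition _ _ _ P (N t) _ R (fun n x =>
    \sum_((n - Num.truncn (p t * n%:R)).+1 <= j < n.+1) order_stat X n j x)) => n.
  by apply: measurable_sum => j; exact: measurable_order_stat.
- apply: measurable_funM => //.
  apply: (@measurable_fun_partition _ _ _ P (N t) _ R (fun n x =>
    order_stat X n (n - Num.truncn (p t * n%:R)) x)) => n.
  exact: measurable_order_stat.
- apply: measurable_funM => //.
  apply: (@measurable_fun_partition _ _ _ P (N t) _ R (fun n x =>
    \sum_(1 <= j < n - Num.truncn (p t * n%:R)) order_stat X n j x)) => n.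
  by apply: measurable_sum => j; exact: measurable_order_stat.
split; rewrite /V/= divr_ge0//; try exact: ltW.
- by apply: sumr_ge0 => j _; exact: order_stat_ge0.
- exact: order_stat_ge0.
- by apply: sumr_ge0 => j _; exact: order_stat_ge0.
- by rewrite !mulr_ge0// ltW.
Unshelve. all: by end_near. Qed.

Lemma measurable_trim_ge M t :
  measurable [set x | (M <= trim (fun t => N t : T -> nat) p t x)%N].
Proof.
rewrite (_ : [set x | _] = N t @^-1` [set n | (M <= Num.truncn (p t * n%:R))%N])//.
exact: measurable_funPTI.
Qed.

(** The exponents differ in three terms: the total [Z] in place of the large claims, at a cost of
    order [t * p t * b t / U t], and the intermediate and the small claims replaced by their
    approximations, at a cost proportional to [e]. On the nonnegative half-line $e^{-x}$ is
    1-Lipschitz. *)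
Lemma claims_gap (t x1 x2 x3 Z e eta K : R) (i j k : nat) (n : R) :
  0 < t -> 0 < p t -> 1 <= t * p t -> 0 < b t -> 0 < U t ->
  t * p t * b t / U t <= eta -> 0 < e <= 2^-1 -> 0 <= n -> n / t <= K -> 0 <= x1 ->
  (1 - e) * b t <= x2 <= (1 + e) * b t -> 0 <= x3 ->
  `|x3 - n * p t * b t * ((1 - alpha)^-1 - 1)| <= n * p t * b t * (e * (8 / (1 - alpha))) ->
  Z = x3 + x2 + x1 ->
  `|expR (- (i%:R * (x1 / U t) + j%:R * (x2 / b t) + k%:R * (x3 / (t * p t * b t)))) -
    expR (- (i%:R / U t * Z + j%:R + k%:R * ((1 - alpha)^-1 - 1) * (n / t)))| <=
  i%:R * (2 + 5 / (1 - alpha) * K) * eta + e * (j%:R + 8 / (1 - alpha) * K * k%:R).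
Proof.
move=> t0 p0 tp1 b0 U0 he /andP[e0 e2] n0 nK x10 /andP[x21 x22] x30 hx3 ZE.
have /andP[a0 a1] := halpha.
have al0 : 0 < 1 - alpha by rewrite subr_gt0.
have al1 : 1 <= (1 - alpha)^-1 by rewrite invf_ge1//; lra.
move: (i%:R) (j%:R) (k%:R) (ler0n R i) (ler0n R j) (ler0n R k) => I J L I0 J0 L0.
move: (1 - alpha)^-1 al1 hx3 => c c1 hx3.
have c0 : 0 <= c - 1 by rewrite subr_ge0.
have x20 : 0 <= x2 by apply: le_trans x21; rewrite mulr_ge0 ?(ltW b0)//; lra.
have tp0 : 0 < t * p t by rewrite mulr_gt0.
have tpb0 : 0 < t * p t * b t by rewrite mulr_gt0.
have K0 : 0 <= K by apply: le_trans nK; rewrite divr_ge0// ltW.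
have Z0 : 0 <= Z by rewrite ZE !addr_ge0.
have iU : 0 <= (U t)^-1 by rewrite invr_ge0 ltW.
have ib : 0 <= (b t)^-1 by rewrite invr_ge0 ltW.
have it : 0 <= t^-1 by rewrite invr_ge0 ltW.
have itpb : 0 <= (t * p t * b t)^-1 by rewrite invr_ge0 ltW.
apply: le_trans (expR_lip _ _) _.
- by rewrite !addr_ge0// !mulr_ge0.
- by rewrite !addr_ge0// !mulr_ge0.
have -> : I * (x1 / U t) + J * (x2 / b t) + L * (x3 / (t * p t * b t)) -
    (I / U t * Z + J + L * (c - 1) * (n / t)) =
  - (I * ((x3 + x2) / U t)) + J * (x2 / b t - 1) +
    L * ((x3 - n * p t * b t * (c - 1)) / (t * p t * b t)).
  by rewrite ZE; field; rewrite !gt_eqF.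
have A1 : `|I * ((x3 + x2) / U t)| <= I * (2 + 5 * c * K) * eta.
  rewrite ger0_norm ?mulr_ge0 ?invr_ge0 ?(ltW U0) ?addr_ge0// -mulrA ler_wpM2l//.
  apply: (@le_trans _ _ ((2 + 5 * c * K) * (t * p t * b t / U t))); last first.
    by rewrite ler_wpM2l// addr_ge0 ?mulr_ge0//; lra.
  rewrite [leRHS]mulrA ler_pM2r ?invr_gt0//.
  have h1 : x2 <= 2 * (t * p t * b t).
    have : b t <= t * p t * b t by rewrite ler_peMl// ltW.
    have : x2 <= 2 * b t by apply: le_trans x22 _; rewrite ler_pM2r//; lra.
    by lra.
  have nt : n <= K * t by rewrite -ler_pdivrMr.
  have npb : n * p t * b t <= K * (t * p t * b t).
    by rewrite !mulrA ler_pM2r// ler_pM2r.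
  (* The 5 is 1 for the centre, at most [c], plus 4 for the error [8 * e * c] with [e <= 2^-1]. *)
  have h2 : x3 <= 5 * c * (n * p t * b t).
    have := le_trans (ler_norm _) hx3.
    have : 0 <= n * p t * b t by rewrite !mulr_ge0 ?(ltW p0) ?(ltW b0).
    move: (n * p t * b t) => q q0 hq.
    have : q * (e * (8 * c)) <= q * (4 * c).
      by rewrite ler_wpM2l//; nra.
    by nra.
  have h3 : 5 * c * (n * p t * b t) <= 5 * c * (K * (t * p t * b t)).
    by rewrite ler_wpM2l//; lra.
  by rewrite mulrDl; lra.
have A2 : `|J * (x2 / b t - 1)| <= e * J.
  rewrite normrM (ger0_norm J0) mulrC ler_wpM2r//.
  have -> : x2 / b t - 1 = (x2 - b t) / b t by field; rewrite gt_eqF.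
  rewrite normrM (gtr0_norm (_ : 0 < (b t)^-1)) ?invr_gt0// ler_pdivrMr//.
  by rewrite ler_norml; apply/andP; split; lra.
have A3 : `|L * ((x3 - n * p t * b t * (c - 1)) / (t * p t * b t))| <= e * (8 * c * K * L).
  rewrite normrM (ger0_norm L0) normrM (gtr0_norm (_ : 0 < (t * p t * b t)^-1)) ?invr_gt0//.
  rewrite (_ : e * (8 * c * K * L) = L * (e * (8 * c) * K)); last by ring.
  rewrite ler_wpM2l// ler_pdivrMr//; apply: le_trans hx3 _.
  rewrite (_ : n * p t * b t * (e * (8 * c)) = e * (8 * c) * (n / t) * (t * p t * b t)); last first.
    by field; rewrite gt_eqF.
  by rewrite ler_pM2r// ler_wpM2l//; nra.
apply: le_trans (ler_normD _ _) _; apply: le_trans (lerD (ler_normD _ _) (lexx _)) _.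
by rewrite normrN (mulrDr e) addrA; apply: lerD => //; exact: lerD.
Qed.

Hypothesis hs : diverges_in_probability P (trim (fun t => N t : T -> nat) p).

Lemma near_trim_small (M : nat) (e : R) : 0 < e ->
  \forall t \near +oo, Pr P (~` [set x | (M <= trim (fun t => N t : T -> nat) p t x)%N]) <= e.
Proof.
move=> e0; have /fine_cvg h := hs M.
have {}h : Pr P [set x | (M <= trim (fun t => N t : T -> nat) p t x)%N] @[t --> +oo] --> (1 : R).
  exact: h.
near=> t; rewrite Pr_setC; last exact: measurable_trim_ge.
rewrite lerBlDr -lerBlDl; near: t; apply: (cvgr_ge _ h); lra.
Unshelve. all: by end_near. Qed.

(** [claims_gap] applies outside a bad event, on which [N t / t] is large, few claims are trimmed,
    or a sum deviates. The bad event has probability at most [e / 2], and off it the difference is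
    at most [e / 4]. *)
Lemma cvg_lap3_gap (i j k : nat) :
  Ex P (lap3 i j k \o V t) -
  Ex P (fun x => expR (- (i%:R / U t * total_claims t x + j%:R +
                          k%:R * ((1 - alpha)^-1 - 1) * ((N t x)%:R / t)))) @[t --> +oo] --> (0 : R).
Proof.
have /andP[a0 a1] := halpha.
have al0 : 0 < (1 - alpha)^-1 by rewrite invr_gt0 subr_gt0.
have al1 : 1 <= (1 - alpha)^-1 by rewrite invf_ge1//; lra.
apply/cvgrPdist_le => e e0; have e8 : 0 < e / 8 by rewrite divr_gt0.
have [K K0 hK] := N_tight hN e8.
(* The [+ 1] keeps the divisors [C2] and [C3] positive when the indices vanish. *)
pose C2 := i%:R * (2 + 5 / (1 - alpha) * K) + 1.
pose C3 := j%:R + 8 / (1 - alpha) * K * k%:R + 1.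
have C20 : 0 < C2 by rewrite ltr_pwDr// mulr_ge0// addr_ge0// !mulr_ge0// ltW.
have C30 : 0 < C3 by rewrite ltr_pwDr// addr_ge0// !mulr_ge0// ltW.
pose eps := Num.min 2^-1 (e / 8 / C3).
have eps0 : 0 < eps by rewrite lt_min invr_gt0 ltr0n/= divr_gt0.
have eps1 : eps <= 2^-1 by rewrite ge_min lexx.
have eps2 : eps <= e / 8 / C3 by rewrite ge_min lexx orbT.
have eps01 : 0 < eps <= 2^-1 by rewrite eps0.
pose eta := e / 8 / C2.
have [delta d01 hmeans]  := good_means eps01.
have /andP[d0 d1] := d01.
(* The first summand gives [1 <= eps * M] for the rounding; the second makes each of the four
   Chernoff terms at most [e / 32]. *)
pose M := (Num.truncn (eps^-1 + 32 * 32 / (e * delta ^+ 2))).+1.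
have M1 : eps^-1 + 32 * 32 / (e * delta ^+ 2) < M%:R by exact: truncnS_gt.
have dd : 0 < e * delta ^+ 2 by rewrite mulr_gt0// exprn_gt0.
have Me : 1 <= eps * M%:R.
  rewrite -ler_pdivrMl// mulr1; apply: le_trans (ltW M1).
  by rewrite lerDl divr_ge0 ?mulr_ge0 ?ler0n ?(ltW e0) ?exprn_ge0 ?(ltW d0).
have MD : expR (- (M%:R / 4 * (delta ^+ 2 / 8))) <= e / 32.
  have h : 32 / e <= M%:R / 4 * (delta ^+ 2 / 8).
    have : 32 * 32 / (e * delta ^+ 2) <= M%:R.
      by apply: le_trans (ltW M1); rewrite lerDr invr_ge0 ltW.
    rewrite ler_pdivrMr// => h; rewrite ler_pdivrMr//.
    rewrite (_ : M%:R / 4 * (delta ^+ 2 / 8) * e = M%:R * (e * delta ^+ 2) / 32); last by field.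
    by rewrite ler_pdivlMr//; lra.
  rewrite expRN -[leRHS]invrK lef_pV2 ?posrE ?expR_gt0 ?invr_gt0 ?divr_gt0// invf_div.
  by apply: le_trans h _; apply: le_trans (expR_ge1Dx _); rewrite lerDr.
near=> t; rewrite sub0r normrN.
have t0 : 0 < t by near: t; exact/nbhs_pinfty_gt/num_real.
have p0 : 0 < p t by near: t; exact: near_p_gt0.
have p1 : p t < 1 by near: t; apply: (cvgr_lt _ hp0).
have tp1 : 1 <= t * p t by near: t; apply: (cvgryPge _).1.
have b0 : 0 < b t by near: t; exact: near_b_gt0.
have U0 : 0 < U t by near: t; apply: (cvgryPgt _).1; exact: U_pinfty.
have p01 : 0 < p t < 1 by rewrite p0.
have he : t * p t * b t / U t <= eta.
  near: t; apply: (cvgr_le _ cvg_ratio_U).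
  by rewrite divr_gt0.
have rV : random_nonneg3 (V t) by near: t; exact: (random_nonneg3_claims).
have mt : mean_bounds eps delta t by near: t.
have B1 : Pr P [set x | K < (N t x)%:R / t] <= e / 8 by near: t.
have B2 : Pr P (~` [set x | (M <= trim (fun t => N t : T -> nat) p t x)%N]) <= e / 8.
  by near: t; exact: near_trim_small.
have [mD PD] := Pr_claims_deviate (M%:R / 4) (ltW t0) b0 eps01 d01.
pose A1 := [set x | K < (N t x)%:R / t].
pose A2 := ~` [set x | (M <= trim (fun t => N t : T -> nat) p t x)%N].
pose D := claims_deviate eps delta (M%:R / 4) t.
have mA1 : measurable A1 by exact: (measurable_gt_rv (measurable_Nratio N t)).
have mA2 : measurable A2 by apply: measurableC; exact: measurable_trim_ge.
pose Bad := A1 `|` (A2 `|` D).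
have mA : measurable (A2 `|` D) by exact: measurableU.
have mBad : measurable Bad by exact: measurableU.
have PBad : Pr P Bad <= e / 2.
  have := Pr_setU P mA1 mA; have := Pr_setU P mA2 mD; rewrite -/Bad -/D.
  by move: B1 B2 PD MD; rewrite -/A1 -/A2 -/D; lra.
have Z0 x : 0 <= (N t x)%:R / t by rewrite divr_ge0// ltW.
have kc0 : 0 <= k%:R * ((1 - alpha)^-1 - 1) by rewrite mulr_ge0// subr_ge0.
have B0 x : 0 <= i%:R / U t * total_claims t x + j%:R +
    k%:R * ((1 - alpha)^-1 - 1) * ((N t x)%:R / t).
  rewrite !addr_ge0 ?(mulr_ge0 kc0 (Z0 x))// mulr_ge0//; last exact: total_claims_ge0.
  by rewrite divr_ge0// ltW.
have bB : bounded_rv (fun x => expR (- (i%:R / U t * total_claims t x + j%:R +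
    k%:R * ((1 - alpha)^-1 - 1) * ((N t x)%:R / t)))).
  apply: bounded_rv_unit => [|x]; last first.
    by have /andP[/ltW -> ->] := expRN_itv (B0 x).
  apply: measurable_expRN; apply: measurable_funD.
    by apply: measurable_funD => //; apply: measurable_funM => //; exact: measurable_total_claims.
  by apply: measurable_funM => //; exact: measurable_Nratio.
have bV : bounded_rv (lap3 i j k \o V t) by apply: exp_poly_rv => //; exact: lap3_exp_poly.
apply: (@le_trans _ _ (Ex P (fun x => e / 4 + \1_Bad x))); last first.
  rewrite ExD; [|exact: bounded_rv_cst|exact: bounded_rv_indic].
  by rewrite Ex_cst Ex_indic//; lra.
apply: normr_ExB => //.
  by apply: bounded_rvD; [exact: bounded_rv_cst|exact: bounded_rv_indic].
move=> x; have [_ _ _ /(_ x) [V1 V2 V3]] := rV.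
rewrite indicE; have [_|/negP Bx] := boolP (x \in Bad).
  rewrite /= mulr1n; apply: le_trans (expR_diff_le1 _ (B0 x)) _.
    by rewrite !addr_ge0// mulr_ge0.
  by rewrite lerDr divr_ge0// ltW.
have {}Bx : ~ Bad x by move=> h; apply: Bx; exact/mem_set.
move: Bx => /not_orP[/negP nA1 /not_orP[nA2 nD]].
rewrite -leNgt in nA1.
have {}nA2 : (M <= trim (fun t => N t : T -> nat) p t x)%N by move: nA2 => /contrapT.
have [G1 G2 G3 G4] := claims_close p01 b0 eps01 d01 Me nA2 mt nD.
have L0 : 0 <= large_claims X N p t x.
  by apply: sumr_ge0 => r _; exact: order_stat_ge0.
rewrite addr0.
apply: le_trans (claims_gap i j k t0 p0 tp1 b0 U0 he eps01 (ler0n R (N t x)) nA1 L0 G1 G2 G3 G4) _.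
have s1 : i%:R * (2 + 5 / (1 - alpha) * K) * eta <= e / 8.
  apply: (@le_trans _ _ (C2 * eta)); last by rewrite /eta mulrC divfK// gt_eqF.
  rewrite ler_wpM2r ?lerDl ?ler01// /eta divr_ge0 ?(ltW C20)//; exact: ltW.
have s2 : eps * (j%:R + 8 / (1 - alpha) * K * k%:R) <= e / 8.
  apply: (@le_trans _ _ (eps * C3)); first by rewrite ler_pM2l// lerDl.
  by rewrite -ler_pdivlMr.
by rewrite (_ : e / 4 = e / 8 + e / 8); [exact: lerD|field].
Unshelve. all: by end_near. Qed.

Lemma cvg_lap3 (i j k : nat) :
  Ex P (lap3 i j k \o V t) @[t --> +oo] -->
  expR (- j%:R) * Ex Q (fun x => expR (- ((stable_exponent alpha^-1 i%:R +
    k%:R * ((1 - alpha)^-1 - 1)) * pos_part Theta x))).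
Proof.
have /andP[a0 a1] := halpha.
have al1 : 1 <= (1 - alpha)^-1 by rewrite invf_ge1//; lra.
have k0 : 0 <= k%:R * ((1 - alpha)^-1 - 1) by rewrite mulr_ge0// subr_ge0.
have h1 := cvg_lap3_gap i j k.
have h2 := cvg_total_claims (ler0n R i) k0.
have h3 : expR (- j%:R) * Ex P (fun x => expR (- (i%:R / U t * total_claims t x +
    k%:R * ((1 - alpha)^-1 - 1) * ((N t x)%:R / t)))) @[t --> +oo] -->
  expR (- j%:R) * Ex Q (fun x => expR (- ((stable_exponent alpha^-1 i%:R +
    k%:R * ((1 - alpha)^-1 - 1)) * pos_part Theta x))).
  by apply: cvgM; [exact: cvg_cst|exact: h2].
have h4 : Ex P (lap3 i j k \o V t) -
  Ex P (fun x => expR (- (i%:R / U t * total_claims t x + j%:R +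
                          k%:R * ((1 - alpha)^-1 - 1) * ((N t x)%:R / t)))) +
  expR (- j%:R) * Ex P (fun x => expR (- (i%:R / U t * total_claims t x +
    k%:R * ((1 - alpha)^-1 - 1) * ((N t x)%:R / t)))) @[t --> +oo] -->
  expR (- j%:R) * Ex Q (fun x => expR (- ((stable_exponent alpha^-1 i%:R +
    k%:R * ((1 - alpha)^-1 - 1)) * pos_part Theta x))).
  by rewrite -[X in _ --> X]add0r; apply: cvgD; [exact: h1|exact: h3].
apply: cvg_trans h4; apply: near_eq_cvg; near=> t.
have t0 : 0 < t by near: t; exact/nbhs_pinfty_gt/num_real.
have U0 : 0 < U t by near: t; apply: (cvgryPgt _).1; exact: U_pinfty.
have Z0 x : 0 <= (N t x)%:R / t by rewrite divr_ge0// ltW.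
rewrite -ExZ.
  rewrite (_ : (fun x => expR (- j%:R) * _) = (fun x => expR (- (i%:R / U t * total_claims t x + j%:R +
                          k%:R * ((1 - alpha)^-1 - 1) * ((N t x)%:R / t))))); first by rewrite subrK.
  by apply/funext => x; rewrite -expRD; congr expR; ring.
apply: bounded_rv_unit => [|x].
  apply: measurable_expRN; apply: measurable_funD; apply: measurable_funM => //.
    exact: measurable_total_claims.
  exact: measurable_Nratio.
have B0 : 0 <= i%:R / U t * total_claims t x + k%:R * ((1 - alpha)^-1 - 1) * ((N t x)%:R / t).
  rewrite addr_ge0 ?(mulr_ge0 k0 (Z0 x))// mulr_ge0//; last exact: total_claims_ge0.
  by rewrite divr_ge0// ltW.
by have /andP[/ltW -> ->] := expRN_itv B0.
Unshelve. all: by end_near. Qed.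

End Claims.

(** * The limit law *)

Section LimitLaw.
Context {R : realType} {dQ : measure_display} {TQ : measurableType dQ}.
Variables (Q : probability TQ R) (Theta : {RV Q >-> R}) (alpha : R).
Let RT := measurableTypeR R.
Let psi : R -> R := stable_exponent alpha^-1.
Variable q : RT -> R.
Hypothesis halpha : 0 < alpha < 1.
Hypotheses (mq : measurable_fun setT q) (q0 : forall r, 0 <= q r).
Hypothesis psi0 : psi 0 = 0.
Hypothesis psi_ge0 : forall u, 0 <= u -> 0 <= psi u.
Hypothesis psiM : forall a u : R, 0 < a -> 0 <= u -> psi (a * u) = a `^ alpha * psi u.
Hypothesis Eq : forall w : R, 0 <= w ->
  Ex (unif01 : probability RT R) (fun r => expR (- (w * q r))) = expR (- psi w).

(** For fixed $\Theta$, scaling of the stable exponent makes the Laplace transform of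
    $\Theta^{1/\alpha}q$ equal to $e^{-\Theta\psi(u)}$. *)
Definition limit_large (z : TQ * RT) : R := pos_part Theta z.1 `^ alpha^-1 * q z.2.
Definition limit_small (z : TQ * RT) : R := pos_part Theta z.1 / (alpha^-1 - 1).

Let mpos : measurable_fun setT (fun z : TQ * RT => pos_part Theta z.1).
Proof. exact: (measurableT_comp (measurable_pos_part Theta)). Qed.

Lemma measurable_limit_large : measurable_fun setT limit_large.
Proof.
apply: measurable_funM; last exact: (measurableT_comp mq).
exact: (measurableT_comp (measurable_powR _)).
Qed.

Lemma measurable_limit_small : measurable_fun setT limit_small.
Proof. exact: measurable_funM. Qed.

Let g1 : 0 < alpha^-1 - 1.
Proof. by have /andP[a0 a1] := halpha; rewrite subr_gt0 invf_gt1. Qed.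

Lemma limit_large_ge0 z : 0 <= limit_large z.
Proof. by rewrite mulr_ge0 ?powR_ge0. Qed.

Lemma limit_small_ge0 z : 0 <= limit_small z.
Proof. by rewrite divr_ge0 ?pos_part_ge0 ?(ltW g1). Qed.

Lemma stable_exponent_pos_part u x : 0 <= u ->
  psi (u * pos_part Theta x `^ alpha^-1) = pos_part Theta x * psi u.
Proof.
move=> u0; have /andP[a0 _] := halpha.
have := pos_part_ge0 Theta x; rewrite le_eqVlt => /predU1P[<-|t0].
  by rewrite powR0 ?invr_eq0 ?gt_eqF// mulr0 mul0r.
by rewrite mulrC psiM ?powR_gt0// -powRrM mulVf ?gt_eqF// powRr1// ltW.
Qed.

(** Tonelli's theorem integrates over the stable coordinate first, where [Eq] applies at the
    argument $u\,\Theta^{1/\alpha}$. *)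
Lemma laplace_limit (u v w : R) : 0 <= u -> 0 <= v -> 0 <= w ->
  (\int[Q \x unif01]_z (expR (- (u * limit_large z) - v * 1 - w * limit_small z))%:E =
   (expR (- v) * Ex Q (fun x => expR (- ((psi u + w / (alpha^-1 - 1)) * pos_part Theta x))))%:E)%E.
Proof.
move=> u0 v0 w0.
have k0 : 0 <= psi u + w / (alpha^-1 - 1) by rewrite addr_ge0 ?psi_ge0// divr_ge0// ltW.
pose f (z : TQ * RT) := (expR (- (u * limit_large z) - v * 1 - w * limit_small z))%:E.
have mf : measurable_fun setT f.
  apply/measurable_EFinP; apply: (measurableT_comp (@measurable_expR R)).
  apply: measurable_funB; last by apply: measurable_funM => //; exact: measurable_limit_small.
  apply: measurable_funB => //; apply: measurable_funN; apply: measurable_funM => //.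
  exact: measurable_limit_large.
have f0 z : (0 <= f z)%E by rewrite lee_fin expR_ge0.
rewrite (@fubini_tonelli1 _ _ TQ RT R Q unif01 f mf f0).
have bQ := bounded_laplace (measurable_pos_part Theta) (pos_part_ge0 Theta) k0.
rewrite EFinM -expectation_Ex// unlock -ge0_integralZl//; last first.
  by apply/measurable_EFinP; case: bQ.
apply: eq_integral => x _; rewrite /fubini_F /f /=.
have ux : 0 <= u * pos_part Theta x `^ alpha^-1 by rewrite mulr_ge0// powR_ge0.
pose c := expR (- v - w / (alpha^-1 - 1) * pos_part Theta x).
transitivity (\int[unif01]_y (c%:E * (expR (- (u * pos_part Theta x `^ alpha^-1 * q y)))%:E))%E.
  apply: eq_integral => y _; rewrite -EFinM -expRD; congr (expR _)%:E.
  by rewrite /limit_large /limit_small/=; ring.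
have bq := bounded_laplace mq q0 ux.
rewrite ge0_integralZl//; last 2 first.
  by apply/measurable_EFinP; case: bq.
  by rewrite lee_fin expR_ge0.
have := expectation_Ex (unif01 : probability RT R) bq; rewrite unlock => ->.
rewrite Eq// stable_exponent_pos_part// -!EFinM -!expRD; congr (expR _)%:E.
by ring.
Qed.

End LimitLaw.

Theorem proposition3p2
  (R : realType) (d : measure_display) (T : measurableType d)
  (P : probability T R)
  (alpha gamma : R) (l F U p : R -> R)
  (X : nat -> {RV P >-> R}) (N : R -> {RV P >-> nat})
  (dQ : measure_display) (TQ : measurableType dQ)
  (Q : probability TQ R) (Theta : {RV Q >-> R})
  (* the claims *)
  (halpha : 0 < alpha < 1)
  (hgamma : gamma = alpha^-1)
  (hl : slowly_varying l)
  (hXpos : forall i x, 0 < X i x)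
  (hXF : forall i (y : R), cdf (X i) y = (F y)%:E)
  (hXind : mutually_independent X)
  (hF : forall x : R, 0 < x -> 1 - F x = x `^ (- alpha) * l x)
  (hU : U = tail_quantile F)
  (* the claim number process *)
  (hNmono : forall (s t : R) x, 0 <= s -> s <= t -> (N s x <= N t x)%N)
  (hNX : independent_systems P
    (sigma_of_family [set t : R | 0 <= t] (fun t => N t : T -> nat))
    (sigma_of_family [set: nat] (fun i => X i : T -> R)))
  (hN : cvg_in_distribution P Q (fun t x => (N t x)%:R / t) (Theta : TQ -> R))
  (* the number of large claims *)
  (hp0 : p t @[t --> +oo] --> (0 : R))
  (hp1 : t * p t @[t --> +oo] --> +oo)
  (hs : diverges_in_probability P (trim (fun t => N t : T -> nat) p)) :
  exists (d' : measure_display) (T' : measurableType d')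
    (P' : probability T' R) (Lambda Xi Sigma : {RV P' >-> R}),
    [/\ cvg_in_distribution P P'
          (fun t x =>
             (large_claims X N p t x / U t,
              mid_claim X N p t x / U ((p t)^-1),
              small_claims X N p t x / (t * p t * U ((p t)^-1))))
          (fun x => (Lambda x, Xi x, Sigma x)),
        (forall u v w : R, 0 <= u -> 0 <= v -> 0 <= w ->
           laplace3 P' Lambda Xi Sigma u v w =
           ((expR (- v))%:E *
             laplace Q Theta (stable_exponent gamma u + w / (gamma - 1)))%E) &
        ({ae Q, forall x, Theta x = 1} ->
         forall u v w : R, 0 <= u -> 0 <= v -> 0 <= w ->
           laplace3 P' Lambda Xi Sigma u v w =
           (expR (- stable_exponent gamma u - v - w / (gamma - 1)))%:E)].
Proof.
subst gamma U; have /andP[a0 a1] := halpha.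
have [q [mq q0] Eq] := stable_law_exists halpha hl hXpos hXF hXind hF.
have psi0 := stable_exponent0 alpha.
have psi_ge0 := stable_exponent_ge0 halpha hl hXpos hXF hF.
have psiM := stable_exponentM halpha hl hXpos hXF hF.
pose P' : probability (TQ * measurableTypeR R)%type R := (Q \x unif01)%E.
pose Lambda : {RV P' >-> R} := mfun_Sub (mem_set (measurable_limit_large Theta alpha mq)).
pose Xi : {RV P' >-> R} := cst 1.
pose Sigma : {RV P' >-> R} := mfun_Sub (mem_set (measurable_limit_small Theta alpha)).
have rW : random_nonneg3 (fun x => (Lambda x, Xi x, Sigma x)).
  split=> [| | |z] /=; [exact: measurable_limit_large|exact: measurable_cst|exact: measurable_limit_small|].
  by split; [exact: limit_large_ge0|exact: ler01|exact: (limit_small_ge0 Theta halpha)].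
have EL (u v w : R) : 0 <= u -> 0 <= v -> 0 <= w -> laplace3 P' Lambda Xi Sigma u v w =
    (expR (- v) * Ex Q (fun x => expR (- ((stable_exponent alpha^-1 u +
      w / (alpha^-1 - 1)) * pos_part Theta x))))%:E.
  move=> u0 v0 w0; rewrite /laplace3 unlock.
  exact: (laplace_limit Theta halpha mq q0 psi0 psi_ge0 psiM Eq u0 v0 w0).
have g1 : 0 < alpha^-1 - 1 by rewrite subr_gt0 invf_gt1.
have E2 (u v w : R) : 0 <= u -> 0 <= v -> 0 <= w -> laplace3 P' Lambda Xi Sigma u v w =
    ((expR (- v))%:E * laplace Q Theta (stable_exponent alpha^-1 u + w / (alpha^-1 - 1)))%E.
  move=> u0 v0 w0; rewrite EL// EFinM (laplace_Theta hN)//.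
  by rewrite addr_ge0 ?psi_ge0// divr_ge0// ltW.
exists _, _, P', Lambda, Xi, Sigma; split => //.
- apply: laplace_cvg_in_distribution.
  + exact: (random_nonneg3_claims hl hXpos hXF hF N hp0 hp1).
  + exact: rW.
  move=> i j k.
  have -> : Ex P' (lap3 i j k \o (fun x => (Lambda x, Xi x, Sigma x))) =
      expR (- j%:R) * Ex Q (fun x => expR (- ((stable_exponent alpha^-1 i%:R +
        k%:R * ((1 - alpha)^-1 - 1)) * pos_part Theta x))).
    (* Both equal $k\alpha/(1-\alpha)$: the truncated mean less the trimmed part is the
       $1/(\gamma-1)$ of the statement. *)
    have -> : k%:R * ((1 - alpha)^-1 - 1) = k%:R / (alpha^-1 - 1).
      by congr (_ * _); field; rewrite gt_eqF//= mulN1r gt_eqF ?subr_gt0.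
    apply: EFin_inj; rewrite -EL ?ler0n// /laplace3 -expectation_Ex.
      congr ('E_P'[_])%E; apply/funext => z; rewrite /lap3/=; congr expR; ring.
    apply: exp_poly_rv; last exact: lap3_exp_poly.
    exact: rW.
  exact: (cvg_lap3 halpha hl hXpos hXF hXind hF hNX hN hp0 hp1 hs).
- move=> T1 u v w u0 v0 w0; rewrite E2//.
  set kappa := stable_exponent _ _ + _.
  have -> : laplace Q Theta kappa = (expR (- kappa))%:E.
    rewrite -[in RHS](Ex_cst Q (expR (- kappa))) -expectation_Ex; last exact: bounded_rv_cst.
    rewrite /laplace unlock; apply: ae_eq_integral => //.
    + apply/measurable_EFinP; apply: (measurableT_comp (@measurable_expR R)).
      by apply: measurable_funN; exact: measurable_funM.
    + by apply: filterS T1 => x -> _; rewrite mulr1.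
  by rewrite -EFinM -expRD; congr (expR _)%:E; rewrite /kappa; ring.
Qed.
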